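(* Let $a\ge4$ and $b>a$ both be even. Then: (1) $\rho^*(\alpha)=\delta_{0,1}=(1-\eta)(1-\beta)$. (2) If $b\ge 2a$ or $(a,b)=(4,6)$, then $(\delta_{k,1})_{k\ge0}$ is strictly decreasing with limit $$\delta_{\infty,1}:=\Big(1-\eta+\frac{2D^2}{1+D}\Big)\Big(1-\beta-\frac{2\beta}{1+D}\Big),$$ and $\mathcal L^*\cap(\delta_{\infty,1},\infty)=\{\delta_{k,1}:k\ge0\}\cup\{\delta_{0,5}\}\cup E_1\cup E_2$, where $E_1=\{\delta_{0,4}\}$ if $2a\le b\le 3a-6$ and $E_1=\emptyset$ otherwise, and $E_2=\{\delta_{-2}\}$ if $(a,b)=(4,6)$ and $E_2=\emptyset$ otherwise. (3) If $b=2a-2$ and $a\ge 8$, then $(\delta_{k,2})_{k\ge1}$ is increasing with limit $$\delta_{\infty,2}:=\Big(1-3\eta+\frac{2D(2-\eta)}{1-D}\Big)\Big(1+\beta-\frac{2\beta D(1-\eta+D)}{1-D}\Big),$$ and $\mathcal L^*\cap(\delta_{\infty,2},\infty)=\{\delta_{0,1},\delta_{0,4}\}$.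
   Context: Negative continued fractions: $[0;c_1,c_2,\dots]^-:=\cfrac{1}{c_1-\cfrac{1}{c_2-\cdots}}$. Fix integers $2\le a<b$ and set $\alpha=\eta:=[0;\overline{a,b}]^-=\tfrac12\big(b-\sqrt{b^2-4b/a}\big)$, $\beta:=[0;\overline{b,a}]^-=\tfrac12\big(a-\sqrt{a^2-4a/b}\big)$, $D:=\eta\beta$. For real $\gamma$, $M(\alpha,\gamma):=\liminf_{|n|\to\infty,\ n\in\mathbb Z}|n|\,\|n\alpha-\gamma\|$ ($\|x\|$ = distance from $x$ to the nearest integer) and $M^*(\alpha,\gamma):=4(1-D)M(\alpha,\gamma)$. Let $\mathcal L^*:=\{M^*(\alpha,\gamma):\gamma\in\mathbb R\setminus(\mathbb Z+\alpha\mathbb Z)\}$ and $\rho^*(\alpha):=\max\mathcal L^*$. Expansions: to a bounded integer sequence $(b_i)_{i\ge1}$ associate $\gamma((b_i)):=\sum_{i\ge1}(b_{2i-1}\eta+b_{2i}D)D^{i-1}$; a block is a pair $(b_{2i-1},b_{2i})$. For a finite word $P$ of blocks, $\gamma_P$ is $\gamma((b_i))$ for the purely periodic sequence repeating $P$; $X^k$ denotes $k$ repetitions of $X$ ($X^0$ empty). Blocks (with $a,b$ even, $t$ even): $A_t=\big(\tfrac{a-2}{2},\tfrac{b-2+t}{2}\big)$, $A'_t=\big(\tfrac{a-2}{2},\tfrac{b-2-t}{2}\big)$, $C_t=\big(\tfrac{a-4}{2},\tfrac{b-2+t}{2}\big)$, $C'_t=\big(\tfrac{a}{2},\tfrac{b-2-t}{2}\big)$.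 Define $\delta_{k,1}:=M^*(\alpha,\gamma_{A_0(A_2A_2')^k})$ ($k\ge0$), $\delta_{k,2}:=M^*(\alpha,\gamma_{A_2C_4^kC_2A_2'C_4'^{\,k}C_2'})$ ($k\ge1$), $\delta_{0,4}:=M^*(\alpha,\gamma_{C_4})$, $\delta_{0,5}:=M^*(\alpha,\gamma_{A_2A_2'})$, and (for $(a,b)=(4,6)$) $\delta_{-2}:=M^*(\alpha,\gamma_{A_2C_2})$. *)

(* Defs.v *)
From Stdlib Require Import Reals Lra Lia ZArith List ClassicalEpsilon.
Import ListNotations.
Open Scope R_scope.

(* ||x|| = distance from x to the nearest integer.  (IZR (up x) - 1) is floor x. *)
Definition frac_part (x : R) : R := x - (IZR (up x) - 1).
Definition dist_Z (x : R) : R := Rmin (frac_part x) (1 - frac_part x).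

Definition is_liminf_Z (f : Z -> R) (L : R) : Prop :=
  (forall eps, 0 < eps -> exists N : Z, forall n : Z, (N <= Z.abs n)%Z -> L - eps < f n) /\
  (forall eps, 0 < eps -> forall N : Z, exists n : Z, (N <= Z.abs n)%Z /\ f n < L + eps).

Definition liminf_Z (f : Z -> R) : R :=
  epsilon (inhabits 0) (fun L => is_liminf_Z f L).

Definition Mfun (alpha gamma : R) : Z -> R :=
  fun n => IZR (Z.abs n) * dist_Z (IZR n * alpha - gamma).

Definition M (alpha gamma : R) : R := liminf_Z (Mfun alpha gamma).


Definition eta (a b : Z) : R :=
  (IZR b - sqrt (IZR b ^ 2 - 4 * IZR b / IZR a)) / 2.
Definition beta (a b : Z) : R :=
  (IZR a - sqrt (IZR a ^ 2 - 4 * IZR a / IZR b)) / 2.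
Definition Dab (a b : Z) : R := eta a b * beta a b.
Definition alpha (a b : Z) : R := eta a b.

Definition Mstar (a b : Z) (gamma : R) : R :=
  4 * (1 - Dab a b) * M (alpha a b) gamma.

Definition in_lattice (a b : Z) (gamma : R) : Prop :=
  exists m n : Z, gamma = IZR m + alpha a b * IZR n.

(* x is in L^* : x = M^*(alpha,gamma) for some gamma not in Z + alpha Z
   (the liminf being finite, as it always is). *)
Definition Lstar (a b : Z) (x : R) : Prop :=
  exists gamma : R, ~ in_lattice a b gamma /\
    is_liminf_Z (Mfun (alpha a b) gamma) (M (alpha a b) gamma) /\
    x = Mstar a b gamma.

(* A block is a pair (b_{2i-1}, b_{2i}); blk i is the (i+1)-th block.
   gamma((b_i)) = sum_{i>=0} (blk_i.1 * eta + blk_i.2 * D) D^i. *)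
Definition gamma_blocks (a b : Z) (blk : nat -> Z * Z) : R :=
  epsilon (inhabits 0) (fun l => infinite_sum
    (fun i => (IZR (fst (blk i)) * eta a b + IZR (snd (blk i)) * Dab a b) * Dab a b ^ i) l).

Definition gamma_P (a b : Z) (P : list (Z * Z)) : R :=
  gamma_blocks a b (fun i => nth (i mod length P) P (0%Z, 0%Z)).

Definition blkA  (a b t : Z) : Z * Z := (((a - 2) / 2)%Z, ((b - 2 + t) / 2)%Z).
Definition blkA' (a b t : Z) : Z * Z := (((a - 2) / 2)%Z, ((b - 2 - t) / 2)%Z).
Definition blkC  (a b t : Z) : Z * Z := (((a - 4) / 2)%Z, ((b - 2 + t) / 2)%Z).
Definition blkC' (a b t : Z) : Z * Z := ((a / 2)%Z, ((b - 2 - t) / 2)%Z).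

Definition wpow (X : list (Z * Z)) (k : nat) : list (Z * Z) := concat (repeat X k).

Definition delta1 (a b : Z) (k : nat) : R :=
  Mstar a b (gamma_P a b ([blkA a b 0] ++ wpow [blkA a b 2; blkA' a b 2] k)).
Definition delta2 (a b : Z) (k : nat) : R :=
  Mstar a b (gamma_P a b ([blkA a b 2] ++ wpow [blkC a b 4] k ++ [blkC a b 2; blkA' a b 2]
                          ++ wpow [blkC' a b 4] k ++ [blkC' a b 2])).
Definition delta04 (a b : Z) : R := Mstar a b (gamma_P a b [blkC a b 4]).
Definition delta05 (a b : Z) : R := Mstar a b (gamma_P a b [blkA a b 2; blkA' a b 2]).
Definition delta_m2 (a b : Z) : R := Mstar a b (gamma_P a b [blkA a b 2; blkC a b 2]).

Definition delta_inf1 (a b : Z) : R :=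
  let e := eta a b in let be := beta a b in let D := Dab a b in
  (1 - e + 2 * D ^ 2 / (1 + D)) * (1 - be - 2 * be / (1 + D)).
Definition delta_inf2 (a b : Z) : R :=
  let e := eta a b in let be := beta a b in let D := Dab a b in
  (1 - 3 * e + 2 * D * (2 - e) / (1 - D)) * (1 + be - 2 * be * D * (1 - e + D) / (1 - D)).

Definition is_max (S : R -> Prop) (x : R) : Prop := S x /\ forall y, S y -> y <= x.

(* Main.v *)
Require Import Defs.
From Stdlib Require Import Reals Lra Lia Psatz ZArith List Classical ClassicalEpsilon FunctionalExtensionality.
From Coquelicot Require Import Coquelicot.
Import ListNotations.
Open Scope R_scope.

(* Up to the factor 4 (1 - D), the liminf of |n| ||n alpha - gamma|| is the liminf, over the divided
   cells of the grid of alpha and gamma, of the smallest product of coordinates at the four vertices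
   of a cell: an expansion of gamma produces the cells, and no lattice point far out can beat all the
   vertices.  Two consecutive cells form a block, which is described by the even integers tau and T
   (doubled and centred digits) and by two tails p and r satisfying
   p(i+1) = f (T + e (tau + p(i))) and r(i) = f (T + e (tau(i+1) + r(i+1))), with e = eta, f = beta.
   A value above the limit point imposes eight inequalities at each block.  They leave few choices
   for (tau, T), and the choices propagate to the following blocks, because a tail depends on the
   digits at distance n only by the factor D^n; eventually the expansion is, up to sign, one of the
   listed periodic words.  The value of a periodic word is read off from an explicit solution of the
   recursion for the tails. *)

(** Since a eta = b beta = 1 + D, conditions on a and b become inequalities between [e] and [f]: 2a
    <= b is 2f <= e, and (3f - e)(1 + D) equals (3a - b) D. A block is centred at its eta-digit
    because its conditions are then symmetric in the two tails, besides being invariant under a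
    change of all signs, so one case out of four is treated. The obstacle is that the threshold is
    itself a limit of values. Estimates with a fixed margin only remove local patterns; they leave
    the words with tau = 0 whose nonzero letters alternate in sign, with runs of any length between
    zeros. Near the limit the deviations of the tails from the alternating tail 2 / (1 + D) decide.
    A run of length l makes the deviation about D^l, the two critical vertices at a zero compare the
    deviations on its two sides up to a factor of order e D, and e D is much larger than D^2; hence
    neighbouring runs, which have even length, are equal. In the third part the same comparison of
    two deviations shows that a word turning from C'_4 to C_4 stays below the limit. *)

Lemma dist_Z_le (x : R) (m : Z) : dist_Z x <= Rabs (x - IZR m).
Proof.
  unfold dist_Z, Defs.frac_part. destruct (archimed x) as [h1 h2].
  destruct (Z_le_gt_dec (up x) m) as [h|h].
  - apply IZR_le in h. apply Rle_trans with (1 := Rmin_r _ _).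
    rewrite Rabs_left1; lra.
  - assert (h' : (m <= up x - 1)%Z) by lia. apply IZR_le in h'. rewrite minus_IZR in h'.
    apply Rle_trans with (1 := Rmin_l _ _). rewrite Rabs_right; lra.
Qed.

Lemma dist_Z_attained (x : R) : exists m : Z, dist_Z x = Rabs (x - IZR m) /\ dist_Z x <= 1 / 2.
Proof.
  unfold dist_Z, Defs.frac_part. destruct (archimed x) as [h1 h2].
  destruct (Rle_dec (x - (IZR (up x) - 1)) (1 / 2)) as [h|h].
  - exists (up x - 1)%Z. rewrite minus_IZR, Rmin_left by lra. rewrite Rabs_right; lra.
  - exists (up x). rewrite Rmin_right by lra. rewrite Rabs_left1; lra.
Qed.

Lemma is_liminf_Z_unique (h : Z -> R) (L1 L2 : R) :
  is_liminf_Z h L1 -> is_liminf_Z h L2 -> L1 = L2.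
Proof.
  assert (H : forall L1 L2, is_liminf_Z h L1 -> is_liminf_Z h L2 -> L1 <= L2).
  { intros l1 l2 [h1 _] [_ h2]. apply Rnot_lt_le; intros hlt.
    destruct (h1 ((l1 - l2) / 2)) as [N HN]; [lra|].
    destruct (h2 ((l1 - l2) / 2) ltac:(lra) N) as [n [hn1 hn2]].
    specialize (HN n hn1). lra. }
  intros; apply Rle_antisym; auto.
Qed.

Lemma liminf_Z_eq (h : Z -> R) (L : R) : is_liminf_Z h L -> liminf_Z h = L.
Proof.
  intros H. apply is_liminf_Z_unique with h; trivial. unfold liminf_Z.
  apply epsilon_spec. now exists L.
Qed.

Definition liminf_nat (u : nat -> R) (L : R) : Prop :=
  (forall eps, 0 < eps -> exists N, forall k, (N <= k)%nat -> L - eps < u k) /\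
  (forall eps, 0 < eps -> forall N, exists k, (N <= k)%nat /\ u k < L + eps).

Lemma liminf_nat_exists (u : nat -> R) (K : nat) (lo hi : R) :
  (forall k, (K <= k)%nat -> lo <= u k <= hi) -> exists L, liminf_nat u L.
Proof.
  intros H. destruct (ex_LimInf_seq u) as [[L| |] HL]; simpl in HL.
  - exists L. split; intros eps heps; destruct (HL (mkposreal eps heps)) as [h1 h2]; auto.
  - destruct (HL hi) as [N hN]. specialize (hN (max K N) ltac:(lia)).
    specialize (H (max K N) ltac:(lia)). lra.
  - destruct (HL lo K) as [n [h1 h2]]. specialize (H n h1). lra.
Qed.

Lemma div_mult_cancel (x y : R) : y <> 0 -> x / y * y = x.
Proof. intros; field; trivial. Qed.

(** Iterating forwards bounds [w k] by (3/10)^n M for every n. This is the form needed for right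
    tails, which are determined by the digits ahead and have no initial value; 3/10 is the bound on
    [e]. *)
Lemma contract_zero (w : nat -> R) (M : R) :
  (forall k, Rabs (w k) <= 3 / 10 * Rabs (w (S k))) -> (forall k, Rabs (w k) <= M) -> forall k, w k = 0.
Proof.
  intros Hw HM k.
  assert (H : forall n k, Rabs (w k) <= (3 / 10) ^ n * M).
  { induction n as [|n IH]; intros k'; simpl; [rewrite Rmult_1_l; auto|].
    specialize (IH (S k')). specialize (Hw k'). lra. }
  assert (hM : 0 <= M) by (apply Rle_trans with (2 := HM 0%nat), Rabs_pos).
  apply NNPP. intros hne. apply Rabs_pos_lt in hne.
  destruct (pow_lt_1_zero (3 / 10) ltac:(rewrite Rabs_right; lra) (Rabs (w k) / (M + 1))) as [n hn].
  { apply Rdiv_lt_0_compat; lra. }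
  specialize (hn n (le_n _)). specialize (H n k).
  rewrite Rabs_right in hn by (apply Rle_ge, pow_le; lra).
  apply Rmult_lt_compat_r with (r := M + 1) in hn; [|lra]. rewrite div_mult_cancel in hn by lra.
  assert (0 <= (3 / 10) ^ n) by (apply pow_le; lra). nra.
Qed.

(** * Divided cells *)

Section Cells.

Context (e f : R) (a b : Z).
Context (f_pos : 0 < f) (fe : f < e) (e_small : 4 * e <= 1 + e * f) (e_lt : e < 3 / 10)
  (ae : IZR a * e = 1 + e * f) (bf : IZR b * f = 1 + e * f).

Definition A (k : nat) : R := if Nat.even k then e else f.
Definition cq (k : nat) : Z := if Nat.even k then a else b.

Lemma A_SS k : A (S (S k)) = A k.
Proof. reflexivity. Qed.

Lemma even_S k : Nat.even (S k) = negb (Nat.even k).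
Proof. rewrite Nat.even_succ. now rewrite <- Nat.negb_even. Qed.

Lemma A_bounds k : 0 < A k < 3 / 10.
Proof. unfold A. destruct (Nat.even k); lra. Qed.

Lemma A_A k : A k * A (S k) = e * f.
Proof. unfold A. rewrite even_S. destruct (Nat.even k); simpl; ring. Qed.

(** One step of the periodic negative continued fraction: A k = 1 / (cq k - A (S k)). *)
Lemma AC k : A k * IZR (cq k) = 1 + A k * A (S k).
Proof. rewrite A_A. unfold A, cq. destruct (Nat.even k); lra. Qed.

(* The products of coordinates at the four vertices of the [k]-th cell. *)
Definition S1 (X Y : nat -> R) k := X k * Y k.
Definition S2 (X Y : nat -> R) k := (X k + 2 * A (S k)) * (2 - Y k).
Definition S3 (X Y : nat -> R) k := (2 - 2 * A (S k) - X k) * (2 - 2 * A k - Y k).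
Definition S4 (X Y : nat -> R) k := (2 - X k) * (Y k + 2 * A k).

(** [X] carries the digits already read and [Y] those still to come. The digits are doubled so that
    the centred coordinates of the blocks involve no halves; gamma is half of [Y 0] up to an
    integer. *)
Definition chain (g : nat -> Z) (X Y : nat -> R) : Prop :=
  forall k, X (S k) = A k * (X k + 2 * IZR (g k)) /\ Y k = A k * (2 * IZR (g k) + Y (S k)).

Definition positive (K : nat) (X Y : nat -> R) : Prop :=
  forall k, (K <= k)%nat -> 0 < X k < 2 - 2 * A (S k) /\ 0 < Y k < 2 - 2 * A k.

(** Coordinates of the grid point (i, j) relative to the k-th cell. The pairs (0,0), (1,0), (1,1),
    (0,1) are its vertices, whose products are [S1], [S2], [S3], [S4] up to sign. *)
Definition cx (X : nat -> R) (i j : nat -> Z) k := X k + 2 * A (S k) * IZR (i k) - 2 * IZR (j k).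
Definition cy (Y : nat -> R) (i j : nat -> Z) k := Y k - 2 * IZR (i k) + 2 * A k * IZR (j k).

(** The change of grid coordinates from one cell to the next, an integral affine map of determinant
    1. It multiplies [cx] by [A k] and divides [cy] by [A k], so the product of the coordinates of a
    point does not depend on the cell. *)
Definition step (g i j : nat -> Z) : Prop :=
  forall k, j (S k) = i k /\ i (S k) = (cq k * i k - j k - g k)%Z.

Lemma cx_step g X Y i j k : chain g X Y -> step g i j -> cx X i j (S k) = A k * cx X i j k.
Proof.
  intros H HS. destruct (H k) as [h1 _], (HS k) as [h2 h3]. unfold cx.
  rewrite h1, h2, h3, A_SS, !minus_IZR, mult_IZR.
  pose proof (AC k) as h. apply Rminus_diag_uniq.
  match goal with |- ?x = 0 => replace x with (2 * IZR (i k) * (A k * IZR (cq k) - (1 + A k * A (S k)))) by ring end.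
  rewrite h; ring.
Qed.

Lemma cy_step g X Y i j k : chain g X Y -> step g i j -> cy Y i j k = A k * cy Y i j (S k).
Proof.
  intros H HS. destruct (H k) as [_ h1], (HS k) as [h2 h3]. unfold cy.
  rewrite h1, h2, h3, !minus_IZR, mult_IZR.
  pose proof (AC k) as h. apply Rminus_diag_uniq.
  match goal with |- ?x = 0 => replace x with (2 * IZR (i k) * (A k * IZR (cq k) - (1 + A k * A (S k)))) by ring end.
  rewrite h; ring.
Qed.

Lemma cxy_const g X Y i j K k : chain g X Y -> step g i j -> (K <= k)%nat ->
  cx X i j k * cy Y i j k = cx X i j K * cy Y i j K.
Proof.
  intros H HS. induction 1 as [|k hk IH]; trivial.
  rewrite (cx_step g X Y) by trivial. rewrite <- IH.
  rewrite (cy_step g X Y i j k) by trivial. ring.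
Qed.

Lemma digit_bounds g X Y K k : chain g X Y -> positive K X Y -> (K <= k)%nat ->
  0 <= IZR (g k) /\ A k * IZR (g k) < 1 - A k.
Proof.
  intros H HP hk. destruct (H k) as [_ h]. destruct (HP k hk) as [_ h1].
  destruct (HP (S k) ltac:(lia)) as [_ h2]. pose proof (A_bounds k). pose proof (A_bounds (S k)).
  split; [|nra].
  assert (hg : -1 < IZR (g k)) by nra. apply (lt_IZR (-1)) in hg. apply IZR_le. lia.
Qed.

Lemma shrink_stops (h : nat -> Z) (K : nat) :
  (forall k, (K <= k)%nat -> 0 <= IZR (h (S k)) < IZR (h k)) -> False.
Proof.
  intros H.
  assert (HH : forall n, (h (K + n)%nat <= h K - Z.of_nat n)%Z).
  { induction n; [rewrite Nat.add_0_r; simpl; lia|].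
    destruct (H (K + n)%nat ltac:(lia)) as [_ h1]. apply lt_IZR in h1.
    replace (K + S n)%nat with (S (K + n)) by lia. lia. }
  set (n := Z.to_nat (h K + 1)). specialize (HH (S n)).
  destruct (H (K + n)%nat ltac:(lia)) as [h1 _]. apply le_IZR in h1.
  replace (K + S n)%nat with (S (K + n)) in HH by lia. lia.
Qed.

(** Descent: as long as the point beats all first vertices, i and j are nonpositive and -i < A * -j.
    Since j at the next cell is i at this one, the natural number -j then decreases for ever. *)
Lemma quad_pp g X Y i j K : chain g X Y -> step g i j -> positive K X Y ->
  0 < cx X i j K -> 0 <= cy Y i j K < Y K ->
  exists k, (K <= k)%nat /\ X k * Y k <= cx X i j K * cy Y i j K.
Proof.
  intros HC HS HP hx hy.
  assert (sgn : forall k, (K <= k)%nat -> 0 < cx X i j k /\ 0 <= cy Y i j k).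
  { induction 1 as [|k hk [IHx IHy]]; [lra|]. pose proof (A_bounds k).
    rewrite (cx_step g X Y) by trivial. rewrite (cy_step g X Y i j k) in IHy by trivial. nra. }
  assert (le0 : forall k, (K <= k)%nat -> (i k <= 0 /\ j k <= 0)%Z).
  { intros k hk. destruct (sgn k hk) as [h1 h2]. destruct (HP k hk) as [h3 h4].
    unfold cx in h1. unfold cy in h2. pose proof (A_bounds k). pose proof (A_bounds (S k)).
    destruct (Z_le_gt_dec (i k) 0) as [hi|hi].
    - split; trivial. apply IZR_le in hi.
      assert (hj : IZR (j k) < 1) by nra. apply lt_IZR in hj. lia.
    - assert (hi' : (1 <= i k)%Z) by lia. apply IZR_le in hi'.
      assert (IZR (j k) - 1 > 0) by nra.
      assert (h5 : (IZR (j k) - 1) * A k > IZR (i k) - 1) by nra.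
      assert (h6 : (IZR (i k) - 1) * A (S k) > IZR (j k) - 1) by nra.
      exfalso. nra. }
  apply NNPP. intros HN.
  assert (HN' : forall k, (K <= k)%nat -> cx X i j k * cy Y i j k < X k * Y k).
  { intros k hk. rewrite (cxy_const g X Y i j K k) by trivial. apply Rnot_le_lt.
    intros hle. apply HN. now exists k. }
  assert (HH : forall k, (K <= k)%nat -> - IZR (i k) < A k * - IZR (j k)).
  { induction 1 as [|k hk IH].
    - unfold cy in hy. nra.
    - destruct (sgn k hk) as [sx sy]. destruct (sgn (S k) ltac:(lia)) as [sx' sy'].
      destruct (le0 k hk) as [li lj]. destruct (le0 (S k) ltac:(lia)) as [li' _].
      destruct (HP k hk) as [px py]. destruct (HP (S k) ltac:(lia)) as [px' py'].
      pose proof (A_bounds k) as Ab. pose proof (A_bounds (S k)) as Ab'.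
      destruct (HS k) as [hj hi]. rewrite hj.
      pose proof (HN' (S k) ltac:(lia)) as hn. pose proof (HN' k hk) as hn0.
      destruct (digit_bounds g X Y K k HC HP hk) as [hg0 hg1].
      apply Rnot_le_lt. intros hle.
      (* In the first case both coordinates of the point are at least those of the first vertex of
         the next cell. Otherwise i k = 0, and the point lies on the grid line that joins the first
         vertices of the two cells. *)
      destruct (Rle_dec (IZR (i k)) (A k * IZR (i (S k)))) as [hc|hc].
      + apply (Rlt_not_le _ _ hn). apply Rmult_le_compat; try lra.
        * unfold cx. rewrite A_SS, hj. lra.
        * unfold cy. rewrite hj. lra.
      + apply Rnot_le_lt in hc.
        assert (hi0 : i k = 0%Z).
        { destruct (Z.eq_dec (i k) 0) as [|hne]; trivial. exfalso.
          assert (h1 : (i k <= -1)%Z) by lia. apply IZR_le in h1.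
          rewrite hi, !minus_IZR, mult_IZR in hc.
          assert (h2 : (1 + A k * A (S k)) * IZR (i k) - A k * IZR (j k) - A k * IZR (g k) < IZR (i k)).
          { rewrite <- AC. lra. }
          assert (h3 : A k * A (S k) < A k * 1) by (apply Rmult_lt_compat_l; lra).
          assert (h4 : (1 - A k * A (S k)) * (- 1) >= (1 - A k * A (S k)) * IZR (i k))
            by (apply Rle_ge, Rmult_le_compat_l; lra).
          lra. }
        rewrite hi0 in *.
        assert (hjg : (- j k <= g k)%Z) by lia. apply IZR_le in hjg. rewrite opp_IZR in hjg.
        assert (hm : 0 < - IZR (j k)) by nra.
        set (m := - IZR (j k)) in *.
        assert (F0 : cx X i j k * cy Y i j k = (X k + 2 * m) * (Y k - 2 * A k * m)).
        { unfold cx, cy. rewrite hi0. unfold m. ring. }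
        assert (Fg : X (S k) * Y (S k) = (X k + 2 * IZR (g k)) * (Y k - 2 * A k * IZR (g k))).
        { destruct (HC k) as [c1 c2]. rewrite c1, c2. ring. }
        assert (F1 : cx X i j (S k) * cy Y i j (S k) = cx X i j k * cy Y i j k).
        { apply (cxy_const g X Y); trivial. lia. }
        rewrite F1, Fg, F0 in hn. rewrite F0 in hn0.
        set (G := IZR (g k)) in *.
        (* Concavity along that line: m = 0 and m = G give the first vertices of cells k and k + 1,
           the product is a concave quadratic in m, and 0 < m <= G, so the point cannot beat both
           ends. *)
        assert (id : G * ((X k + 2 * m) * (Y k - 2 * A k * m))
                 = (G - m) * (X k * Y k) + m * ((X k + 2 * G) * (Y k - 2 * A k * G)) + 4 * A k * m * G * (G - m)) by ring.
        assert (0 <= 4 * A k * m * G * (G - m)).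
        { repeat apply Rmult_le_pos; lra. }
        nra. }
  apply (shrink_stops (fun k => (- j k)%Z) K). intros k hk.
  destruct (le0 k hk) as [li lj]. destruct (HS k) as [hj hi]. rewrite !opp_IZR, hj.
  pose proof (HH k hk). apply IZR_le in li, lj. pose proof (A_bounds k). nra.
Qed.

(** Either i stays nonpositive, and then the sign of [cy] makes -j decrease for ever, or it becomes
    positive for a first time, and at that cell both coordinates are, in absolute value, at least
    those of the second vertex. *)
Lemma quad_pm g X Y i j K : chain g X Y -> step g i j -> positive K X Y ->
  0 < cx X i j K -> 0 < - cy Y i j K < 1 -> - cy Y i j K < 2 - Y K ->
  exists k, (K <= k)%nat /\ (X k + 2 * A (S k)) * (2 - Y k) <= cx X i j K * - cy Y i j K.
Proof.
  intros HC HS HP hx hy hy2.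
  assert (sgn : forall k, (K <= k)%nat -> 0 < cx X i j k /\ 0 < - cy Y i j k).
  { induction 1 as [|k hk [IHx IHy]]; [lra|]. pose proof (A_bounds k).
    rewrite (cx_step g X Y) by trivial. rewrite (cy_step g X Y i j k) in IHy by trivial. nra. }
  assert (start : (i K <= 0)%Z).
  { apply Z.nlt_ge. intros hi. assert (hi' : (1 <= i K)%Z) by lia. apply IZR_le in hi'.
    destruct (HP K (le_n _)) as [px py]. unfold cx in hx. unfold cy in hy, hy2.
    pose proof (A_bounds K). pose proof (A_bounds (S K)).
    destruct (Z_le_gt_dec (j K) 0) as [hj|hj].
    - apply IZR_le in hj. nra.
    - assert (hj' : (1 <= j K)%Z) by lia. apply IZR_le in hj'.
      assert (h1 : A (S K) * (IZR (i K) - 1) > IZR (j K) - 1) by nra.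
      assert (h2 : 0 < IZR (i K) - 1) by nra. apply (lt_IZR 0 (i K - 1)) || idtac.
      assert (h3 : 2 <= IZR (i K)).
      { assert (h4 : 1 < IZR (i K)) by lra. apply lt_IZR in h4. apply IZR_le. lia. }
      assert (A K * (IZR (j K) - 1) <= 1 / 10 * (IZR (i K) - 1)) by nra.
      nra. }
  apply NNPP. intros HN.
  assert (HH : forall k, (K <= k)%nat -> (i k <= 0)%Z /\ - IZR (i k) < A k * - IZR (j k)).
  { assert (HB : forall k, (K <= k)%nat -> (i k <= 0)%Z -> - IZR (i k) < A k * - IZR (j k)).
    { intros k hk hi. destruct (sgn k hk) as [_ h]. destruct (HP k hk). unfold cy in h. lra. }
    intros k hk. enough ((i k <= 0)%Z) by auto.
    induction hk as [|k hk IH]; trivial.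
    apply Z.nlt_ge. intros hi. assert (hi' : (1 <= i (S k))%Z) by lia.
    apply HN. exists (S k). split; [lia|].
    assert (E : cx X i j K * - cy Y i j K = cx X i j (S k) * - cy Y i j (S k)).
    { pose proof (cxy_const g X Y i j K (S k) HC HS ltac:(lia)). lra. }
    rewrite E. destruct (HS k) as [hj _].
    destruct (HP (S k) ltac:(lia)) as [px py]. pose proof (A_bounds (S k)). pose proof (A_bounds k).
    apply IZR_le in hi', IH. unfold cx, cy. rewrite hj, A_SS in *.
    apply Rmult_le_compat; nra. }
  apply (shrink_stops (fun k => (- j k)%Z) K). intros k hk.
  destruct (HH k hk) as [li lt]. destruct (HS k) as [hj _]. rewrite !opp_IZR, hj.
  apply IZR_le in li. pose proof (A_bounds k). nra.
Qed.

(** The half turn of the grid, which corresponds to -gamma: the vertex (i, j) becomes (1 - i, 1 -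
    j). It reduces the quadrants with negative first coordinate to the other two, and later accounts
    for the sign in the classification of words. *)
Definition neg_digit (g : nat -> Z) k := (cq k - 2 - g k)%Z.
Definition negX (X : nat -> R) k := 2 - 2 * A (S k) - X k.
Definition negY (Y : nat -> R) k := 2 - 2 * A k - Y k.
Definition negi (i : nat -> Z) (k : nat) := (1 - i k)%Z.

Lemma neg_chain g X Y : chain g X Y -> chain (neg_digit g) (negX X) (negY Y).
Proof.
  intros H k. destruct (H k) as [h1 h2]. unfold negX, negY, neg_digit.
  rewrite h1, A_SS, !minus_IZR. pose proof (AC k) as h.
  split; [|rewrite h2]; apply Rminus_diag_uniq;
  match goal with |- ?x = 0 => replace x with (-2 * (A k * IZR (cq k) - (1 + A k * A (S k)))) by ring end;
  rewrite h; ring.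
Qed.

Lemma neg_step g i j : step g i j -> step (neg_digit g) (negi i) (negi j).
Proof.
  intros H k. destruct (H k) as [h1 h2]. unfold negi, neg_digit. rewrite h1, h2. split; ring.
Qed.

Lemma neg_positive K X Y : positive K X Y -> positive K (negX X) (negY Y).
Proof. intros H k hk. destruct (H k hk). unfold negX, negY. lra. Qed.

Lemma neg_cx X i j k : cx (negX X) (negi i) (negi j) k = - cx X i j k.
Proof. unfold cx, negX, negi. rewrite !minus_IZR. ring. Qed.

Lemma neg_cy Y i j k : cy (negY Y) (negi i) (negi j) k = - cy Y i j k.
Proof. unfold cy, negY, negi. rewrite !minus_IZR. ring. Qed.

Definition fmin (X Y : nat -> R) k := Rmin (Rmin (S1 X Y k) (S2 X Y k)) (Rmin (S3 X Y k) (S4 X Y k)).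

Lemma fmin_le X Y k : fmin X Y k <= S1 X Y k /\ fmin X Y k <= S2 X Y k /\
  fmin X Y k <= S3 X Y k /\ fmin X Y k <= S4 X Y k.
Proof. unfold fmin. repeat split; unfold Rmin; repeat destruct Rle_dec; lra. Qed.

Lemma fmin_cases X Y k : fmin X Y k = S1 X Y k \/ fmin X Y k = S2 X Y k \/
  fmin X Y k = S3 X Y k \/ fmin X Y k = S4 X Y k.
Proof. unfold fmin, Rmin; repeat destruct Rle_dec; auto. Qed.

(* The divided-cell principle: a lattice point far out along the X axis never beats
   all the vertices of the cells. *)
Lemma point_lower g X Y i j K L : chain g X Y -> step g i j -> positive K X Y ->
  (forall k, (K <= k)%nat -> L <= fmin X Y k) ->
  cx X i j K <> 0 -> Rabs (cy Y i j K) < 1 ->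
  Rabs (cy Y i j K) < Y K < 2 - 2 * A K - Rabs (cy Y i j K) ->
  L <= Rabs (cx X i j K * cy Y i j K).
Proof.
  intros HC HS HP HL hx h1 h2. pose proof (A_bounds K) as Ab.
  destruct (HP K (le_n _)) as [px py].
  destruct (Rtotal_order (cx X i j K) 0) as [x|[x|x]]; [|contradiction|];
  (destruct (Rle_dec 0 (cy Y i j K)) as [y|y]; [|apply Rnot_le_lt in y]).
  - destruct (Rle_lt_or_eq_dec _ _ y) as [y'|y'].
    + rewrite (Rabs_right (cy Y i j K)) in * by lra.
      destruct (quad_pm (neg_digit g) (negX X) (negY Y) (negi i) (negi j) K) as [k [hk H]];
        auto using neg_chain, neg_step, neg_positive;
        rewrite ?neg_cx, ?neg_cy; unfold negY; try lra.
      rewrite neg_cx, neg_cy in H. apply Rle_trans with (1 := HL k hk).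
      destruct (fmin_le X Y k) as (_ & _ & _ & H4).
      rewrite Rabs_mult, (Rabs_left (cx X i j K)), (Rabs_right (cy Y i j K)) by lra.
      unfold S4, negX, negY in *. lra.
    + rewrite <- y' in *.
      destruct (quad_pp (neg_digit g) (negX X) (negY Y) (negi i) (negi j) K) as [k [hk H]];
        auto using neg_chain, neg_step, neg_positive;
        rewrite ?neg_cx, ?neg_cy; unfold negY; rewrite ?Rabs_R0 in *; try lra.
      rewrite neg_cx, neg_cy in H. apply Rle_trans with (1 := HL k hk).
      destruct (fmin_le X Y k) as (_ & _ & H3 & _).
      rewrite Rmult_0_r, Rabs_R0. unfold S3, negX, negY in *. rewrite <- y' in H. lra.
  - rewrite (Rabs_left (cy Y i j K)) in * by lra.
    destruct (quad_pp (neg_digit g) (negX X) (negY Y) (negi i) (negi j) K) as [k [hk H]];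
      auto using neg_chain, neg_step, neg_positive;
      rewrite ?neg_cx, ?neg_cy; unfold negY; try lra.
    rewrite neg_cx, neg_cy in H. apply Rle_trans with (1 := HL k hk).
    destruct (fmin_le X Y k) as (_ & _ & H3 & _).
    rewrite Rabs_mult, (Rabs_left (cx X i j K)), (Rabs_left (cy Y i j K)) by lra.
    unfold S3, negX, negY in *. lra.
  - rewrite (Rabs_right (cy Y i j K)) in * by lra.
    destruct (quad_pp g X Y i j K) as [k [hk H]]; auto; try lra.
    apply Rle_trans with (1 := HL k hk).
    destruct (fmin_le X Y k) as (H1 & _). unfold S1 in H1.
    rewrite Rabs_right; [lra|]. apply Rle_ge, Rmult_le_pos; lra.
  - rewrite (Rabs_left (cy Y i j K)) in * by lra.
    destruct (quad_pm g X Y i j K) as [k [hk H]]; auto; try lra.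
    apply Rle_trans with (1 := HL k hk).
    destruct (fmin_le X Y k) as (_ & H2 & _). unfold S2 in H2.
    rewrite Rabs_mult, Rabs_right, Rabs_left by lra. lra.
Qed.

(** * Lattice points in the coordinates of the cells *)

Fixpoint Pi (k : nat) : R := match k with O => 1 | S k' => Pi k' * A k' end.

Lemma Pi_pos k : 0 < Pi k.
Proof. induction k; simpl; [lra|]. pose proof (A_bounds k). nra. Qed.

Lemma Pi_small (eps : R) : 0 < eps -> exists k0, forall k, (k0 <= k)%nat -> Pi k < eps.
Proof.
  intros h. assert (H : forall k, Pi k <= (3 / 10) ^ k).
  { induction k as [|k IH]; simpl; [lra|]. pose proof (A_bounds k). pose proof (Pi_pos k). nra. }
  destruct (pow_lt_1_zero (3 / 10) ltac:(rewrite Rabs_right; lra) eps h) as [k0 h0].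
  exists k0. intros k hk. specialize (h0 k hk). specialize (H k).
  rewrite Rabs_right in h0; [lra|]. apply Rle_ge, pow_le. lra.
Qed.

(** The pair (n, mu) stands for the number n alpha - gamma - m with mu = z + m, where z is the
    integer part split off from gamma. It is carried to the grid coordinates (i, j) of the k-th
    cell. *)
Fixpoint coords (g : nat -> Z) (n mu : Z) (k : nat) : Z * Z :=
  match k with
  | O => (- mu, - n)%Z
  | S k' => let p := coords g n mu k' in ((cq k' * fst p - snd p - g k')%Z, fst p)
  end.

Definition ci g n mu k := fst (coords g n mu k).
Definition cj g n mu k := snd (coords g n mu k).

Lemma coords_step g n mu : step g (ci g n mu) (cj g n mu).
Proof. intros k. split; reflexivity. Qed.

(** [py] is -2 times the small number n alpha - gamma - m, and [px] is the other coordinate of the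
    lattice point in cell 0. When [py] is small, [px] is close to 2 (1 - D) n up to a bounded term;
    this is the origin of the factor 4 (1 - D). *)
Definition px (n mu : Z) : R := 2 * (IZR n - f * IZR mu).
Definition py (Y : nat -> R) (n mu : Z) : R := Y 0%nat + 2 * IZR mu - 2 * e * IZR n.

Lemma cx_coords g X Y n mu k : chain g X Y -> X 0%nat = 0 ->
  cx X (ci g n mu) (cj g n mu) k = Pi k * px n mu.
Proof.
  intros HC H0. induction k as [|k IH].
  - unfold cx, px, ci, cj; simpl. rewrite H0, !opp_IZR. unfold A; simpl. ring.
  - rewrite (cx_step g X Y) by auto using coords_step. rewrite IH. simpl. ring.
Qed.

Lemma cy_coords g X Y n mu k : chain g X Y ->
  py Y n mu = Pi k * cy Y (ci g n mu) (cj g n mu) k.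
Proof.
  intros HC. induction k as [|k IH].
  - unfold cy, py, ci, cj; simpl. rewrite !opp_IZR. unfold A; simpl. ring.
  - rewrite IH, (cy_step g X Y _ _ k) by auto using coords_step. simpl. ring.
Qed.

Lemma coords_surj g k : forall i0 j0 : Z, exists n mu, coords g n mu k = (i0, j0).
Proof.
  induction k as [|k IH]; intros i0 j0.
  - exists (- j0)%Z, (- i0)%Z. simpl. now rewrite !Z.opp_involutive.
  - destruct (IH j0 (cq k * j0 - g k - i0)%Z) as (n & mu & h).
    exists n, mu. simpl. rewrite h. simpl. f_equal. ring.
Qed.

Lemma px_py Y n mu : px n mu = 2 * (1 - e * f) * IZR n - f * py Y n mu + f * Y 0%nat.
Proof. unfold px, py. ring. Qed.

(** By [px_py] the two first factors differ by f (Y 0 - py). That difference is multiplied by [py],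
    hence negligible along good approximations. *)
Lemma product_compare Y n mu :
  Rabs (Rabs (px n mu * py Y n mu) - 2 * (1 - e * f) * IZR (Z.abs n) * Rabs (py Y n mu))
  <= f * (Rabs (py Y n mu) + Rabs (Y 0%nat)) * Rabs (py Y n mu).
Proof.
  set (y := py Y n mu).
  assert (hD : 0 < 1 - e * f) by nra.
  replace (2 * (1 - e * f) * IZR (Z.abs n) * Rabs y) with (Rabs (2 * (1 - e * f) * IZR n * y)).
  2:{ rewrite !Rabs_mult, abs_IZR. rewrite (Rabs_right 2), (Rabs_right (1 - e * f)) by lra. ring. }
  apply Rle_trans with (1 := Rabs_triang_inv2 _ _).
  replace (px n mu * y - 2 * (1 - e * f) * IZR n * y) with (f * (Y 0%nat - y) * y)
    by (unfold y; rewrite (px_py Y n mu); ring).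
  rewrite !Rabs_mult, (Rabs_right f) by lra.
  apply Rmult_le_compat_r; [apply Rabs_pos|]. apply Rmult_le_compat_l; [lra|].
  unfold Rminus. apply Rle_trans with (1 := Rabs_triang _ _). rewrite Rabs_Ropp. lra.
Qed.

Lemma dist_py (gamma : R) (z : Z) (Y : nat -> R) (n : Z) : gamma = IZR z + Y 0%nat / 2 ->
  (exists mu, dist_Z (IZR n * e - gamma) = Rabs (py Y n mu) / 2 /\ Rabs (py Y n mu) <= 1) /\
  forall mu, dist_Z (IZR n * e - gamma) <= Rabs (py Y n mu) / 2.
Proof.
  intros hg.
  assert (H : forall m, Rabs (IZR n * e - gamma - IZR m) = Rabs (py Y n (z + m)) / 2).
  { intros m. replace (py Y n (z + m)) with (- 2 * (IZR n * e - gamma - IZR m)).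
    - rewrite Rabs_mult, (Rabs_left (- 2)); lra.
    - unfold py. rewrite plus_IZR, hg. field. }
  split.
  - destruct (dist_Z_attained (IZR n * e - gamma)) as [m [h1 h2]].
    exists (z + m)%Z. rewrite H in h1. split; [trivial|lra].
  - intros mu. replace mu with (z + (mu - z))%Z by ring. rewrite <- H. apply dist_Z_le.
Qed.

(** A product below L with [px] large forces the second coordinate in cell K below d, a margin
    chosen so that the hypotheses of [point_lower] on [Y K] are met; that lemma then gives a
    contradiction. *)
Lemma far_points_lower g X Y K L : chain g X Y -> X 0%nat = 0 -> positive K X Y -> 0 < L ->
  (forall k, (K <= k)%nat -> L <= fmin X Y k) ->
  exists r, 0 < r /\ forall n mu, r <= Rabs (px n mu) -> L <= Rabs (px n mu * py Y n mu).
Proof.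
  intros HC H0 HP hL HL. destruct (HP K (le_n _)) as [_ hY]. pose proof (Pi_pos K) as hPi.
  set (d := Rmin (1 / 2) (Rmin (Y K) (2 - 2 * A K - Y K) / 2)).
  assert (hd : 0 < d /\ d < 1 /\ d < Y K /\ d < 2 - 2 * A K - Y K).
  { unfold d, Rmin. repeat destruct Rle_dec; lra. }
  exists (L / (Pi K * d)).
  assert (hr : 0 < L / (Pi K * d)) by (apply Rdiv_lt_0_compat; nra).
  split; trivial. intros n mu h. apply Rnot_lt_le. intros hlt.
  pose proof (cx_coords g X Y n mu K HC H0) as ex. pose proof (cy_coords g X Y n mu K HC) as ey.
  assert (hy : Rabs (cy Y (ci g n mu) (cj g n mu) K) < d).
  { rewrite Rabs_mult, ey, Rabs_mult, (Rabs_right (Pi K)) in hlt by lra.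
    set (w := Rabs (cy _ _ _ _)) in *. assert (0 <= w) by apply Rabs_pos.
    assert (h1 : L / (Pi K * d) * (Pi K * w) < L).
    { apply Rle_lt_trans with (2 := hlt). apply Rmult_le_compat_r; nra. }
    replace (L / (Pi K * d) * (Pi K * w)) with (L * (w / d)) in h1 by (field; lra).
    apply Rnot_le_lt. intros hdw. assert (1 <= w / d).
    { apply Rmult_le_reg_r with d; [lra|]. rewrite div_mult_cancel; lra. }
    nra. }
  apply (Rlt_not_le _ _ hlt).
  replace (px n mu * py Y n mu)
    with (cx X (ci g n mu) (cj g n mu) K * cy Y (ci g n mu) (cj g n mu) K)
    by (rewrite ex, ey; ring).
  apply (point_lower g X Y _ _ K L); auto using coords_step; try lra.
  rewrite ex. intros E. apply Rmult_integral in E. destruct E as [E|E]; [lra|].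
  rewrite E, Rabs_R0 in h. lra.
Qed.

Definition vertex_x X (k : nat) (i j : bool) := X k + 2 * A (S k) * (if i then 1 else 0) - 2 * (if j then 1 else 0).
Definition vertex_y Y (k : nat) (i j : bool) := Y k - 2 * (if i then 1 else 0) + 2 * A k * (if j then 1 else 0).

Lemma vertex_point g X Y k (i j : bool) : chain g X Y -> X 0%nat = 0 ->
  exists n mu, vertex_x X k i j = Pi k * px n mu /\ py Y n mu = Pi k * vertex_y Y k i j.
Proof.
  intros HC H0.
  destruct (coords_surj g k (if i then 1 else 0)%Z (if j then 1 else 0)%Z) as (n & mu & h).
  exists n, mu. rewrite <- (cx_coords g X Y) by trivial. rewrite (cy_coords g X Y n mu k HC).
  unfold ci, cj, cx, cy. rewrite h. unfold vertex_x, vertex_y. simpl. destruct i, j; split; ring.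
Qed.

Lemma fmin_vertex X Y k : 0 < X k < 2 - 2 * A (S k) -> 0 < Y k < 2 - 2 * A k ->
  exists i j, fmin X Y k = Rabs (vertex_x X k i j * vertex_y Y k i j) /\ Rabs (vertex_y Y k i j) < 2.
Proof.
  intros hX hY. pose proof (A_bounds k). pose proof (A_bounds (S k)). unfold vertex_x, vertex_y.
  destruct (fmin_cases X Y k) as [h|[h|[h|h]]]; rewrite h; unfold S1, S2, S3, S4;
  [exists false, false|exists true, false|exists true, true|exists false, true];
  (split; [|unfold Rabs; destruct Rcase_abs; lra]).
  - rewrite Rabs_right; [ring|nra].
  - rewrite Rabs_left; [ring|nra].
  - rewrite Rabs_right; [ring|nra].
  - rewrite Rabs_left; [ring|nra].
Qed.

Lemma n_large (Y : nat -> R) n mu N : 2 * N + f * (Rabs (py Y n mu) + Rabs (Y 0%nat)) <= Rabs (px n mu) -> N <= IZR (Z.abs n).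
Proof.
  intros h. rewrite (px_py Y n mu) in h. rewrite abs_IZR. assert (0 < e * f) by nra.
  assert (h1 : Rabs (2 * (1 - e * f) * IZR n - f * py Y n mu + f * Y 0%nat)
    <= 2 * Rabs (IZR n) + f * (Rabs (py Y n mu) + Rabs (Y 0%nat))).
  { apply Rle_trans with (1 := Rabs_triang _ _). rewrite (Rabs_mult f (Y 0%nat)), (Rabs_right f) by lra.
    unfold Rminus at 1. pose proof (Rabs_triang (2 * (1 - e * f) * IZR n) (- (f * py Y n mu))) as h2.
    rewrite Rabs_Ropp, !Rabs_mult, (Rabs_right f), (Rabs_right 2), (Rabs_right (1 - e * f)) in h2 by nra.
    pose proof (Rabs_pos (IZR n)). nra. }
  lra.
Qed.

Lemma Zabs_large (N : Z) (x : R) n : IZR N <= x -> x <= IZR (Z.abs n) -> (N <= Z.abs n)%Z.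
Proof. intros. apply le_IZR. lra. Qed.

Lemma small_square (M eps : R) : 0 <= M -> 0 < eps ->
  exists d, 0 < d <= 1 /\ forall y, 0 <= y <= d -> f * (y + M) * y < eps.
Proof.
  intros hM he. exists (Rmin 1 (eps / (2 * f * (1 + M)))).
  assert (h0 : 0 < 2 * f * (1 + M)) by nra.
  assert (h1 : 0 < eps / (2 * f * (1 + M))) by (apply Rdiv_lt_0_compat; lra).
  split; [unfold Rmin; destruct Rle_dec; lra|].
  intros y [hy1 hy2].
  assert (hy3 : y <= 1) by (apply Rle_trans with (1 := hy2), Rmin_l).
  assert (hy4 : y <= eps / (2 * f * (1 + M))) by (apply Rle_trans with (1 := hy2), Rmin_r).
  assert (h2 : y * (2 * f * (1 + M)) <= eps).
  { apply Rmult_le_compat_r with (r := 2 * f * (1 + M)) in hy4; [|lra].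
    rewrite div_mult_cancel in hy4; lra. }
  assert (f * (y + M) * y <= f * (1 + M) * y) by (apply Rmult_le_compat_r; nra).
  nra.
Qed.

(** * The lower limit in terms of vertex products *)

Lemma value_of_chain gamma z g X Y K c L : gamma = IZR z + Y 0%nat / 2 ->
  chain g X Y -> X 0%nat = 0 -> positive K X Y -> 0 < c ->
  (forall k, (K <= k)%nat -> c <= fmin X Y k) -> liminf_nat (fmin X Y) L ->
  is_liminf_Z (Mfun e gamma) (L / (4 * (1 - e * f))).
Proof.
  intros hg HC H0 HP hc Hc HL.
  assert (hD : 0 < 1 - e * f) by nra. assert (hf : 0 < e * f) by nra.
  assert (hLc : c <= L).
  { apply Rnot_lt_le. intros hlt. destruct (proj2 HL (c - L) ltac:(lra) K) as [n [hn1 hn2]].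
    specialize (Hc n hn1). lra. }
  set (y0 := Rabs (Y 0%nat)). assert (hy0 : 0 <= y0) by apply Rabs_pos.
  split; intros eps heps; set (eps' := 4 * (1 - e * f) * eps);
  assert (heps' : 0 < eps') by (unfold eps'; nra).
  (* The second bound keeps L - m positive, as [far_points_lower] requires. *)
  - set (m := Rmin (eps' / 2) (L / 2)).
    assert (hm : 0 < m /\ m <= eps' / 2 /\ m <= L / 2) by (unfold m, Rmin; destruct Rle_dec; lra).
    destruct (proj1 HL m ltac:(lra)) as [K' hK'].
    destruct (far_points_lower g X Y (max K K') (L - m)) as [r [hr Hr]]; trivial; try lra.
    { intros k hk. apply HP. lia. }
    { intros k hk. left. apply hK'. lia. }
    destruct (small_square y0 (eps' / 2)) as [d [hd Hd]]; trivial; try lra.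
    set (N := Rmax (r + f * (1 + y0)) (L / d)).
    exists (up (N / (2 * (1 - e * f)))). intros n hn.
    destruct (dist_py gamma z Y n hg) as [[mu [h1 h2]] _].
    unfold Mfun. rewrite h1. set (y := Rabs (py Y n mu)) in *. assert (hy : 0 <= y) by apply Rabs_pos.
    assert (hN : N <= 2 * (1 - e * f) * IZR (Z.abs n)).
    { apply IZR_le in hn. destruct (archimed (N / (2 * (1 - e * f)))) as [h3 _].
      apply Rle_trans with (2 * (1 - e * f) * (N / (2 * (1 - e * f)))); [right; field; lra|].
      apply Rmult_le_compat_l; lra. }
    assert (hN1 := Rmax_l (r + f * (1 + y0)) (L / d)). assert (hN2 := Rmax_r (r + f * (1 + y0)) (L / d)).
    fold N in hN1, hN2.
    assert (hx : r <= Rabs (px n mu)).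
    { rewrite (px_py Y n mu). apply Rle_trans with (2 * (1 - e * f) * IZR (Z.abs n) - f * (1 + y0)); [lra|].
      replace (2 * (1 - e * f) * IZR (Z.abs n)) with (Rabs (2 * (1 - e * f) * IZR n)).
      2:{ rewrite !Rabs_mult, abs_IZR, (Rabs_right 2), (Rabs_right (1 - e * f)); lra. }
      replace (2 * (1 - e * f) * IZR n - f * py Y n mu + f * Y 0%nat)
        with (2 * (1 - e * f) * IZR n - f * (py Y n mu - Y 0%nat)) by ring.
      apply Rle_trans with (2 := Rabs_triang_inv _ _).
      rewrite (Rabs_mult f), (Rabs_right f) by lra.
      assert (Rabs (py Y n mu - Y 0%nat) <= y + y0).
      { unfold Rminus. apply Rle_trans with (1 := Rabs_triang _ _). rewrite Rabs_Ropp. fold y y0. lra. }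
      nra. }
    specialize (Hr n mu hx).
    apply Rmult_lt_reg_l with (4 * (1 - e * f)); [lra|].
    rewrite Rmult_minus_distr_l. fold eps'.
    replace (4 * (1 - e * f) * (L / (4 * (1 - e * f)))) with L by (field; lra).
    destruct (Rle_dec y d) as [hyd|hyd].
    + pose proof (product_compare Y n mu) as hp. fold y y0 in hp.
      specialize (Hd y (conj hy hyd)).
      pose proof (Rle_abs (Rabs (px n mu * py Y n mu) - 2 * (1 - e * f) * IZR (Z.abs n) * y)). lra.
    + apply Rnot_le_lt in hyd.
      assert (L <= N * d).
      { apply Rmult_le_compat_r with (r := d) in hN2; [|lra]. rewrite div_mult_cancel in hN2; lra. }
      assert (0 <= N). { apply Rle_trans with (2 := hN1). nra. }
      assert (L < 2 * (1 - e * f) * IZR (Z.abs n) * y \/ N = 0) by (destruct (Req_dec N 0); [right; trivial|left; nra]).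
      destruct H2; [lra|]. subst N. nra.
  - intros N.
    destruct (small_square y0 (eps' / 2)) as [d [hd Hd]]; trivial; try lra.
    set (NN := 2 * Rmax 0 (IZR N) + f * (d + y0)).
    assert (hNN : 0 <= NN) by (unfold NN; pose proof (Rmax_l 0 (IZR N)); nra).
    (* In such late cells a vertex has |py| <= d, because its second coordinate is below 2; and
       since its product is at least c, its [px] is at least NN, which makes |n| as large as
       prescribed. *)
    destruct (Pi_small (Rmin (d / 2) (c / 2 / (NN + 1)))) as [k0 Hk0].
    { apply Rmin_glb_lt; [lra|]. apply Rdiv_lt_0_compat; lra. }
    destruct (proj2 HL (eps' / 2) ltac:(lra) (max K k0)) as [k [hk1 hk2]].
    specialize (Hk0 k ltac:(lia)). destruct (HP k ltac:(lia)) as [hX hY].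
    pose proof (Hc k ltac:(lia)) as hck.
    destruct (fmin_vertex X Y k hX hY) as (i & j & hv & hv2).
    destruct (vertex_point g X Y k i j HC H0) as (n & mu & ex & ey).
    assert (hPd : Pi k < d / 2) by (apply Rlt_le_trans with (1 := Hk0), Rmin_l).
    assert (hPc : Pi k * (NN + 1) < c / 2).
    { assert (h : Pi k < c / 2 / (NN + 1)) by (apply Rlt_le_trans with (1 := Hk0), Rmin_r).
      apply Rmult_lt_compat_r with (r := NN + 1) in h; [|lra].
      rewrite div_mult_cancel in h; lra. }
    pose proof (Pi_pos k) as hPi.
    set (y := Rabs (py Y n mu)) in *. assert (hy : 0 <= y) by apply Rabs_pos.
    assert (hyd : y <= d).
    { unfold y. rewrite ey, Rabs_mult, (Rabs_right (Pi k)) by lra. nra. }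
    assert (hprod : Rabs (px n mu * py Y n mu) = fmin X Y k).
    { rewrite hv, ex, ey. f_equal. ring. }
    exists n. split.
    + apply Zabs_large with (Rmax 0 (IZR N)); [apply Rmax_r|].
      apply (n_large Y n mu). fold y y0.
      assert (hvx : c / 2 <= Pi k * Rabs (px n mu)).
      { rewrite <- (Rabs_right (Pi k)), <- Rabs_mult, <- ex by lra.
        rewrite hv, Rabs_mult in hck. pose proof (Rabs_pos (vertex_x X k i j)). nra. }
      apply Rle_trans with NN; [unfold NN; nra|].
      apply Rnot_lt_le. intros hlt. nra.
    + unfold Mfun. destruct (dist_py gamma z Y n hg) as [_ h1]. specialize (h1 mu). fold y in h1.
      apply Rmult_lt_reg_l with (4 * (1 - e * f)); [lra|].
      rewrite Rmult_plus_distr_l. fold eps'.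
      replace (4 * (1 - e * f) * (L / (4 * (1 - e * f)))) with L by (field; lra).
      pose proof (product_compare Y n mu) as hp. fold y y0 in hp. rewrite hprod in hp.
      specialize (Hd y (conj hy hyd)).
      pose proof (Rle_abs (- (fmin X Y k - 2 * (1 - e * f) * IZR (Z.abs n) * y))) as h2. rewrite Rabs_Ropp in h2.
      apply Rle_lt_trans with (2 * (1 - e * f) * IZR (Z.abs n) * y); [|lra].
      assert (0 <= IZR (Z.abs n)) by (apply IZR_le; lia).
      replace (2 * (1 - e * f) * IZR (Z.abs n) * y) with (4 * (1 - e * f) * (IZR (Z.abs n) * (y / 2))) by field.
      apply Rmult_le_compat_l; [lra|]. apply Rmult_le_compat_l; lra.
Qed.

(** A lattice gamma would give a grid point on the axis cy = 0 whose other coordinate tends to 0.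
    But products bounded below keep the origin well inside the cell, away from the grid: the integer
    j would satisfy 0 < j < 1. *)
Lemma chain_not_lattice gamma z g X Y K c : gamma = IZR z + Y 0%nat / 2 ->
  chain g X Y -> X 0%nat = 0 -> positive K X Y -> 0 < c ->
  (forall k, (K <= k)%nat -> c <= fmin X Y k) ->
  ~ exists m n : Z, gamma = IZR m + e * IZR n.
Proof.
  intros hg HC H0 HP hc Hc [m [n hmn]].
  set (mu := (z - m)%Z).
  assert (hpy : py Y n mu = 0). { unfold py, mu. rewrite minus_IZR. lra. }
  destruct (Pi_small (c / 2 / (1 + Rabs (px n mu)))) as [k0 Hk0].
  { apply Rdiv_lt_0_compat; [lra|]. pose proof (Rabs_pos (px n mu)). lra. }
  set (k := max K k0). specialize (Hk0 k ltac:(lia)). destruct (HP k ltac:(lia)) as [hX hY].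
  pose proof (Pi_pos k) as hPi. specialize (Hc k ltac:(lia)).
  destruct (fmin_le X Y k) as (h1 & _ & h3 & _). unfold S1 in h1. unfold S3 in h3.
  pose proof (cx_coords g X Y n mu k HC H0) as ex. pose proof (cy_coords g X Y n mu k HC) as ey.
  rewrite hpy in ey. symmetry in ey. apply Rmult_integral in ey. destruct ey as [ey|ey]; [lra|].
  assert (hx : Rabs (cx X (ci g n mu) (cj g n mu) k) < c / 2).
  { rewrite ex, Rabs_mult, (Rabs_right (Pi k)) by lra. pose proof (Rabs_pos (px n mu)) as hq.
    apply Rmult_lt_compat_r with (r := 1 + Rabs (px n mu)) in Hk0; [|lra].
    rewrite div_mult_cancel in Hk0; nra. }
  apply Rabs_def2 in hx.
  unfold cx in hx. unfold cy in ey. set (j := cj g n mu k) in *. set (i := ci g n mu k) in *.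
  pose proof (A_bounds k). pose proof (A_bounds (S k)).
  pose proof (A_A k) as hA.
  assert (hX1 : c / 2 < X k).
  { apply Rnot_le_lt. intros hle. assert (X k * Y k < X k * 2) by (apply Rmult_lt_compat_l; lra). lra. }
  assert (hX2 : c / 2 < 2 - 2 * A (S k) - X k).
  { apply Rnot_le_lt. intros hle.
    assert ((2 - 2 * A (S k) - X k) * (2 - 2 * A k - Y k) < (2 - 2 * A (S k) - X k) * 2)
      by (apply Rmult_lt_compat_l; lra). lra. }
  assert (hj : X k + A (S k) * Y k - 2 * IZR j * (1 - A k * A (S k)) = X k + 2 * A (S k) * IZR i - 2 * IZR j).
  { replace (IZR i) with ((Y k + 2 * A k * IZR j) / 2) by lra. field. }
  assert (0 < A k * A (S k) < 1) by (rewrite hA; nra).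
  assert (0 < IZR j).
  { apply Rmult_lt_reg_r with (1 - A k * A (S k)); [lra|].
    assert (0 < A (S k) * Y k) by (apply Rmult_lt_0_compat; lra). lra. }
  assert (IZR j < 1).
  { apply Rmult_lt_reg_r with (1 - A k * A (S k)); [lra|].
    assert (A (S k) * Y k < A (S k) * (2 - 2 * A k)) by (apply Rmult_lt_compat_l; lra). lra. }
  apply (lt_IZR 0) in H3. apply (lt_IZR j 1) in H4. lia.
Qed.

(** * Existence of a chain of divided cells *)

Lemma dist_lower gamma : (~ exists m n : Z, gamma = IZR m + e * IZR n) ->
  forall N : nat, exists d, 0 < d /\ forall n, (Z.abs n <= Z.of_nat N)%Z -> d <= dist_Z (IZR n * e - gamma).
Proof.
  intros H.
  assert (H1 : forall n, 0 < dist_Z (IZR n * e - gamma)).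
  { intros n. destruct (dist_Z_attained (IZR n * e - gamma)) as [m [h _]]. rewrite h.
    apply Rabs_pos_lt. intros h0. apply H. exists (- m)%Z, n. rewrite opp_IZR. lra. }
  induction N as [|N [d [hd IH]]].
  - exists (dist_Z (IZR 0 * e - gamma)). split; [apply H1|]. intros n hn.
    replace n with 0%Z by lia. lra.
  - set (x := dist_Z (IZR (Z.of_nat (S N)) * e - gamma)).
    set (y := dist_Z (IZR (- Z.of_nat (S N)) * e - gamma)).
    exists (Rmin d (Rmin x y)). split.
    { apply Rmin_glb_lt; [trivial|apply Rmin_glb_lt; apply H1]. }
    intros n hn.
    destruct (Z.eq_dec n (Z.of_nat (S N))) as [->|h1].
    { fold x. unfold Rmin. repeat destruct Rle_dec; lra. }
    destruct (Z.eq_dec n (- Z.of_nat (S N))) as [->|h2].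
    { fold y. unfold Rmin. repeat destruct Rle_dec; lra. }
    apply Rle_trans with (1 := Rmin_l _ _). apply IH. lia.
Qed.

(** The greedy expansion, with the floor written as [up _ - 1]. By itself it only keeps the
    remainder in [0, 2), which is weaker than [positive]; the rest must come from large vertex
    products. *)
Fixpoint greedyY (y : R) (k : nat) : R :=
  match k with
  | O => y
  | S k' => greedyY y k' / A k' - 2 * IZR (up (greedyY y k' / (2 * A k')) - 1)
  end.
Definition greedy (y : R) (k : nat) : Z := (up (greedyY y k / (2 * A k)) - 1)%Z.

Fixpoint Xof (g : nat -> Z) (k : nat) : R :=
  match k with O => 0 | S k' => A k' * (Xof g k' + 2 * IZR (g k')) end.

Lemma greedy_chain y : chain (greedy y) (Xof (greedy y)) (greedyY y).
Proof.
  intros k. split; [reflexivity|]. simpl. fold (greedy y k).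
  pose proof (A_bounds k). field. lra.
Qed.

Lemma greedy_Y_bounds y k : 0 <= y < 2 -> 0 <= greedyY y k < 2.
Proof.
  intros hy. induction k as [|k IH]; trivial. simpl.
  pose proof (A_bounds k). destruct (archimed (greedyY y k / (2 * A k))) as [h1 h2].
  rewrite minus_IZR. replace (greedyY y k / A k) with (2 * (greedyY y k / (2 * A k))) by (field; lra). lra.
Qed.

(** The second clause is the admissibility rule of greedy digits and carries the induction: [X]
    exceeds 2 - 2 A only after a digit c - 1 followed by digits c - 2, and then the remainder is too
    small for another digit c - 1, which is what would push [X] above 2. *)
Lemma greedy_X_bounds y k : 0 <= y < 2 ->
  0 <= Xof (greedy y) k <= 2 /\
  (Xof (greedy y) k <= 2 - 2 * A (S k) \/ greedyY y k < 2 - 2 * A k).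
Proof.
  intros hy. induction k as [|k [IH1 IH2]].
  { simpl. pose proof (A_bounds 1). split; [lra|left; lra]. }
  pose proof (A_bounds k) as ha. pose proof (A_bounds (S k)) as ha'.
  pose proof (greedy_Y_bounds y k hy) as hY. pose proof (greedy_Y_bounds y (S k) hy) as hY'.
  destruct (greedy_chain y k) as [c1 c2]. rewrite c1.
  set (X := Xof (greedy y) k) in *. set (Y := greedyY y k) in *. set (Y' := greedyY y (S k)) in *.
  set (g := greedy y k) in *. rewrite A_SS.
  pose proof (AC k) as hc. set (AA := A k * A (S k)) in *.
  assert (hAA : 0 < AA < A k) by (unfold AA; nra).
  assert (hgr : A k * (2 * IZR g) < 2) by nra.
  assert (hg0 : 0 <= IZR g).
  { assert (hg : -1 < IZR g) by nra. apply (lt_IZR (-1)) in hg. apply IZR_le. lia. }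
  assert (hg1 : (g <= cq k - 1)%Z).
  { assert (hlt : IZR g < IZR (cq k)). { apply Rmult_lt_reg_l with (A k); lra. }
    apply lt_IZR in hlt. lia. }
  assert (hXm : forall w, X <= w -> A k * X <= A k * w) by (intros; apply Rmult_le_compat_l; lra).
  split; [split|].
  - nra.
  - destruct (Z.eq_dec g (cq k - 1)) as [->|hne].
    + destruct IH2 as [h|h].
      * apply hXm in h. rewrite minus_IZR. fold AA in h. unfold AA in *. lra.
      * exfalso. rewrite minus_IZR in c2. nra.
    + assert (hle : (g <= cq k - 2)%Z) by lia. apply IZR_le in hle. rewrite minus_IZR in hle.
      assert (A k * IZR g <= A k * (IZR (cq k) - 2)) by (apply Rmult_le_compat_l; lra).
      assert (A k * X <= A k * 2) by (apply hXm; lra). lra.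
  - destruct (Z.eq_dec g (cq k - 1)) as [E|hne].
    + right. rewrite E, minus_IZR in c2.
      apply Rmult_lt_reg_l with (A k); [lra|]. unfold AA in hc. lra.
    + destruct IH2 as [h|h].
      * left. assert (hle : (g <= cq k - 2)%Z) by lia. apply IZR_le in hle. rewrite minus_IZR in hle.
        assert (A k * IZR g <= A k * (IZR (cq k) - 2)) by (apply Rmult_le_compat_l; lra).
        apply hXm in h. fold AA in h. unfold AA in *. lra.
      * destruct (Z.eq_dec g (cq k - 2)) as [E|hne'].
        -- right. rewrite E, minus_IZR in c2.
           apply Rmult_lt_reg_l with (A k); [lra|]. unfold AA in hc. lra.
        -- left. assert (hle : (g <= cq k - 3)%Z) by lia. apply IZR_le in hle. rewrite minus_IZR in hle.
           assert (A k * IZR g <= A k * (IZR (cq k) - 3)) by (apply Rmult_le_compat_l; lra).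
           assert (A k * X <= A k * 2) by (apply hXm; lra). lra.
Qed.

(** The arithmetic-geometric mean inequality for p r and q s, whose product is at least d^2. For two
    vertices wrongly in one quadrant the sums are 2 and 2 A, so d <= A <= e; hence the threshold
    must exceed [e]. *)
Lemma cauchy_pair p q r s d : 0 < d -> 0 < p -> 0 < q -> 0 <= r -> 0 <= s ->
  d <= p * s -> d <= q * r -> 4 * d <= (p + q) * (r + s).
Proof.
  intros hd hp hq hr hs h1 h2.
  assert (h3 : d * d <= (p * r) * (q * s)).
  { replace ((p * r) * (q * s)) with ((p * s) * (q * r)) by ring. apply Rmult_le_compat; lra. }
  assert (h4 : 0 <= p * r) by nra. assert (h5 : 0 <= q * s) by nra.
  assert (h6 : 2 * d <= p * r + q * s).
  { set (x := p * r) in *. set (y := q * s) in *. clearbody x y. apply Rnot_lt_le. intros hlt.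
    pose proof (Rle_0_sqr (x - y)) as h7. unfold Rsqr in h7.
    assert (h8 : (x + y) * (x + y) < 2 * d * (2 * d)) by (apply Rmult_le_0_lt_compat; lra). lra. }
  lra.
Qed.

(* Large vertex products force the four vertices of a cell into four different quadrants. *)
Lemma vertices_positive k x y d : 0 <= x <= 2 -> 0 <= y <= 2 -> e < d -> 4 * (e * f) < d ->
  (forall i j, d <= Rabs (vertex_x (fun _ => x) k i j * vertex_y (fun _ => y) k i j)) ->
  0 < x < 2 - 2 * A (S k) /\ 0 < y < 2 - 2 * A k.
Proof.
  intros hx hy hd hd4 H.
  pose proof (A_bounds k) as ha. pose proof (A_bounds (S k)) as ha'.
  assert (hle : A k <= e /\ A (S k) <= e) by (unfold A; rewrite even_S; destruct (Nat.even k); simpl; lra).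
  pose proof (A_A k) as hAA.
  pose proof (H false false) as h1. pose proof (H true false) as h2.
  pose proof (H true true) as h3. pose proof (H false true) as h4.
  unfold vertex_x, vertex_y in *.
  assert (q1 : Rabs ((x + 2 * A (S k) * 0 - 2 * 0) * (y - 2 * 0 + 2 * A k * 0)) = x * y).
  { rewrite Rabs_right; [ring|nra]. }
  assert (q2 : Rabs ((x + 2 * A (S k) * 1 - 2 * 0) * (y - 2 * 1 + 2 * A k * 0)) = (x + 2 * A (S k)) * (2 - y)).
  { rewrite Rabs_left1; [ring|]. nra. }
  assert (q4 : Rabs ((x + 2 * A (S k) * 0 - 2 * 1) * (y - 2 * 0 + 2 * A k * 1)) = (2 - x) * (y + 2 * A k)).
  { rewrite Rabs_left1; [ring|]. nra. }
  rewrite q1 in h1. rewrite q2 in h2. rewrite q4 in h4. clear q1 q2 q4.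
  rewrite Rabs_mult in h3.
  replace (x + 2 * A (S k) * 1 - 2 * 1) with (- (2 - 2 * A (S k) - x)) in h3 by ring.
  replace (y - 2 * 1 + 2 * A k * 1) with (- (2 - 2 * A k - y)) in h3 by ring.
  rewrite !Rabs_Ropp in h3.
  assert (d0 : 0 < d) by lra.
  assert (hx0 : 0 < x) by nra. assert (hy0 : 0 < y) by nra.
  assert (hx2 : 0 < 2 - x) by nra. assert (hy2 : 0 < 2 - y) by nra.
  set (P := 2 - 2 * A (S k) - x) in *. set (Q := 2 - 2 * A k - y) in *.
  destruct (Rlt_dec 0 P) as [hP|hP]; destruct (Rlt_dec 0 Q) as [hQ|hQ].
  - unfold P, Q in *. lra.
  - exfalso. rewrite (Rabs_right P), (Rabs_left1 Q) in h3 by lra.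
    pose proof (cauchy_pair P (x + 2 * A (S k)) (2 - y) (- Q) d). unfold P, Q in *. lra.
  - exfalso. rewrite (Rabs_left1 P), (Rabs_right Q) in h3 by lra.
    pose proof (cauchy_pair Q (y + 2 * A k) (2 - x) (- P) d). unfold P, Q in *. lra.
  - exfalso. rewrite (Rabs_left1 P), (Rabs_left1 Q) in h3 by lra.
    assert (- P * - Q <= 2 * A (S k) * (2 * A k)) by (apply Rmult_le_compat; unfold P, Q in *; lra).
    lra.
Qed.

(** The vertices of late cells are lattice points with tiny [py]. As gamma is off the lattice their
    n is large, so the lower limit bounds every vertex product, and the conditions e <= d and 4 e f
    <= d let [vertices_positive] sort the vertices into quadrants. *)
Lemma spectrum_chain gamma M0 d : (~ exists m n : Z, gamma = IZR m + e * IZR n) ->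
  is_liminf_Z (Mfun e gamma) M0 -> e <= d -> 4 * (e * f) <= d -> d < 4 * (1 - e * f) * M0 ->
  exists z g X Y K d', gamma = IZR z + Y 0%nat / 2 /\ chain g X Y /\ X 0%nat = 0 /\
    (forall k, Rabs (Y k) <= 2) /\
    positive K X Y /\ d < d' /\ forall k, (K <= k)%nat -> d' <= fmin X Y k.
Proof.
  intros Hnl HM hd1 hd2 hdM.
  destruct (archimed gamma) as [hu1 hu2].
  set (z := (up gamma - 1)%Z). set (y := 2 * (gamma - IZR z)).
  assert (hz : 0 <= y < 2) by (unfold y, z; rewrite minus_IZR; lra).
  set (g := greedy y). set (X := Xof g). set (Y := greedyY y).
  assert (hg : gamma = IZR z + Y 0%nat / 2) by (unfold Y, y; simpl; field).
  assert (HC : chain g X Y) by apply greedy_chain.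
  assert (hD : 0 < 1 - e * f) by nra. assert (hf : 0 < e * f) by nra.
  set (q := 4 * (1 - e * f)) in *. assert (hq : 0 < q) by (unfold q; lra).
  set (g1 := (q * M0 - d) / 4). assert (hg1 : 0 < g1) by (unfold g1; lra).
  set (y0 := Rabs (Y 0%nat)). assert (hy0 : 0 <= y0) by apply Rabs_pos.
  destruct (proj1 HM (g1 / q)) as [N HN]; [apply Rdiv_lt_0_compat; lra|].
  destruct (dist_lower gamma Hnl (Z.to_nat N)) as [c [hc Hc]].
  destruct (small_square y0 g1 hy0 hg1) as [t [ht Ht]].
  destruct (Pi_small (Rmin t c / 4)) as [K HK].
  { apply Rdiv_lt_0_compat; [apply Rmin_glb_lt|]; lra. }
  (* Of the total gap 4 g1 between d and the value, one g1 pays for the lower limit and one for the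
     error of [product_compare]. *)
  assert (HV : forall k, (K <= k)%nat -> forall i j, d + 2 * g1 <= Rabs (vertex_x X k i j * vertex_y Y k i j)).
  { intros k hk i j. destruct (vertex_point g X Y k i j HC eq_refl) as (n & mu & ex & ey).
    replace (vertex_x X k i j * vertex_y Y k i j) with (px n mu * py Y n mu) by (rewrite ex, ey; ring).
    specialize (HK k hk). pose proof (Pi_pos k) as hPi.
    assert (hyk : Rabs (vertex_y Y k i j) <= 4).
    { pose proof (greedy_Y_bounds y k hz) as hb. fold Y in hb. pose proof (A_bounds k).
      unfold vertex_y, Rabs. destruct Rcase_abs, i, j; lra. }
    set (yy := Rabs (py Y n mu)). assert (hyy0 : 0 <= yy) by apply Rabs_pos.
    assert (hyy : yy < Rmin t c).
    { unfold yy. rewrite ey, Rabs_mult, (Rabs_right (Pi k)) by lra.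
      apply Rle_lt_trans with (Pi k * 4); [apply Rmult_le_compat_l|]; lra. }
    assert (hyt : yy < t) by (apply Rlt_le_trans with (1 := hyy), Rmin_l).
    assert (hyc : yy < c) by (apply Rlt_le_trans with (1 := hyy), Rmin_r).
    destruct (dist_py gamma z Y n hg) as [_ h1]. specialize (h1 mu). fold yy in h1.
    assert (hn : (N <= Z.abs n)%Z).
    { apply Z.nlt_ge. intros hlt. specialize (Hc n ltac:(lia)). lra. }
    specialize (HN n hn). unfold Mfun in HN.
    assert (h2 : q * M0 - g1 < q * (IZR (Z.abs n) * dist_Z (IZR n * e - gamma))).
    { replace (q * M0 - g1) with (q * (M0 - g1 / q)) by (field; lra). apply Rmult_lt_compat_l; trivial. }
    assert (h3 : q * (IZR (Z.abs n) * dist_Z (IZR n * e - gamma)) <= q * (IZR (Z.abs n) * (yy / 2))).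
    { apply Rmult_le_compat_l; [lra|]. apply Rmult_le_compat_l; [apply IZR_le; lia|trivial]. }
    pose proof (product_compare Y n mu) as hp. fold yy y0 in hp.
    specialize (Ht yy ltac:(lra)).
    pose proof (Rle_abs (- (Rabs (px n mu * py Y n mu) - 2 * (1 - e * f) * IZR (Z.abs n) * yy))) as h4.
    rewrite Rabs_Ropp in h4.
    replace (q * (IZR (Z.abs n) * (yy / 2))) with (2 * (1 - e * f) * IZR (Z.abs n) * yy) in h3 by (unfold q; field).
    unfold g1 in *. lra. }
  assert (HP : positive K X Y).
  { intros k hk. apply (vertices_positive k (X k) (Y k) (d + 2 * g1)); try lra.
    - apply (greedy_X_bounds y k hz).
    - pose proof (greedy_Y_bounds y k hz). fold Y in H. lra.
    - intros i j. apply (HV k hk i j). }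
  exists z, g, X, Y, K, (d + 2 * g1).
  split; [trivial|]. split; [trivial|]. split; [reflexivity|]. split.
  { intros k. pose proof (greedy_Y_bounds y k hz) as hb. fold Y in hb. rewrite Rabs_right; lra. }
  split; [trivial|]. split; [lra|].
  intros k hk. destruct (HP k hk) as [hX hY].
  destruct (fmin_vertex X Y k hX hY) as (i & j & h & _). rewrite h. now apply HV.
Qed.

(** * Expansions that agree from some digit on *)

Lemma contract_tends (w : nat -> R) : (forall k, w (S k) = A k * w k) ->
  forall eps, 0 < eps -> exists N, forall k, (N <= k)%nat -> Rabs (w k) < eps.
Proof.
  intros Hw eps heps.
  assert (H : forall k, w k = Pi k * w 0%nat).
  { induction k as [|k IH]; simpl; [ring|]. rewrite Hw, IH. ring. }
  destruct (Pi_small (eps / (Rabs (w 0%nat) + 1))) as [N HN].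
  { apply Rdiv_lt_0_compat; [lra|]. pose proof (Rabs_pos (w 0%nat)). lra. }
  exists N. intros k hk. specialize (HN k hk). pose proof (Pi_pos k). pose proof (Rabs_pos (w 0%nat)).
  rewrite H, Rabs_mult, (Rabs_right (Pi k)) by lra.
  apply Rmult_lt_compat_r with (r := Rabs (w 0%nat) + 1) in HN; [|lra].
  rewrite div_mult_cancel in HN by lra. nra.
Qed.

Lemma A_shift K k : A (2 * K + k) = A k.
Proof.
  unfold A. rewrite Nat.even_add. replace (Nat.even (2 * K)) with true; [now destruct (Nat.even k)|].
  symmetry. rewrite Nat.even_mul. reflexivity.
Qed.

(** Right tails see only the digits ahead and therefore coincide, while left tails forget their past
    geometrically. The shift is even because the weights [A] have period two. *)
Lemma tails_agree g X Y g' X' Y' K M : chain g X Y -> chain g' X' Y' ->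
  (forall k, Rabs (Y k) <= M) -> (forall k, Rabs (Y' k) <= M) ->
  (forall k, g (2 * K + k)%nat = g' k) ->
  (forall k, Y (2 * K + k)%nat = Y' k) /\
  forall eps, 0 < eps -> exists N, forall k, (N <= k)%nat -> Rabs (X (2 * K + k)%nat - X' k) < eps.
Proof.
  intros HC HC' hM hM' hg. split.
  - intros k. apply Rminus_diag_uniq.
    apply (contract_zero (fun k => Y (2 * K + k)%nat - Y' k) (2 * M)).
    + intros k'. destruct (HC (2 * K + k')%nat) as [_ h], (HC' k') as [_ h'].
      replace (Y (2 * K + k')%nat - Y' k') with (A k' * (Y (2 * K + S k')%nat - Y' (S k'))).
      2:{ rewrite h, h', A_shift, hg. replace (2 * K + S k')%nat with (S (2 * K + k')) by lia. ring. }
      pose proof (A_bounds k'). rewrite Rabs_mult, (Rabs_right (A k')) by lra.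
      apply Rmult_le_compat_r; [apply Rabs_pos|lra].
    + intros k'. unfold Rminus. apply Rle_trans with (1 := Rabs_triang _ _). rewrite Rabs_Ropp.
      specialize (hM (2 * K + k')%nat). specialize (hM' k'). lra.
  - apply contract_tends. intros k. destruct (HC (2 * K + k)%nat) as [h _], (HC' k) as [h' _].
    replace (2 * K + S k)%nat with (S (2 * K + k)) by lia. rewrite h, h', A_shift, hg. ring.
Qed.

Lemma Rmin_close a1 b1 a2 b2 d : Rabs (a1 - a2) < d -> Rabs (b1 - b2) < d -> Rabs (Rmin a1 b1 - Rmin a2 b2) < d.
Proof.
  intros h1 h2. apply Rabs_def2 in h1, h2. apply Rabs_def1; unfold Rmin; repeat destruct Rle_dec; lra.
Qed.

Lemma fmin_close g X Y g' X' Y' K M : chain g X Y -> chain g' X' Y' ->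
  (forall k, Rabs (Y k) <= M) -> (forall k, Rabs (Y' k) <= M) ->
  (forall k, g (2 * K + k)%nat = g' k) ->
  forall eps, 0 < eps -> exists N, forall k, (N <= k)%nat ->
    Rabs (fmin X Y (2 * K + k) - fmin X' Y' k) < eps.
Proof.
  intros HC HC' hM hM' hg eps heps.
  destruct (tails_agree g X Y g' X' Y' K M HC HC' hM hM' hg) as [hY hX].
  assert (hM0 : 0 <= M) by (apply Rle_trans with (2 := hM 0%nat), Rabs_pos).
  destruct (hX (eps / (M + 3))) as [N HN]; [apply Rdiv_lt_0_compat; lra|].
  exists N. intros k hk. specialize (HN k hk). specialize (hM' k).
  assert (H : forall c, Rabs c <= M + 3 -> Rabs ((X (2 * K + k)%nat - X' k) * c) < eps).
  { intros c hc. rewrite Rabs_mult. pose proof (Rabs_pos (X (2 * K + k)%nat - X' k)).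
    apply Rmult_lt_compat_r with (r := M + 3) in HN; [|lra]. rewrite div_mult_cancel in HN by lra.
    apply Rle_lt_trans with (2 := HN). apply Rmult_le_compat_l; lra. }
  pose proof (A_bounds k) as ha. pose proof (Rle_abs (Y' k)). pose proof (Rle_abs (- Y' k)).
  rewrite Rabs_Ropp in *.
  unfold fmin, S1, S2, S3, S4. rewrite hY.
  replace (S (2 * K + k)) with (2 * K + S k)%nat by lia. rewrite !A_shift.
  repeat apply Rmin_close.
  - rewrite <- Rmult_minus_distr_r. apply H. apply Rabs_le. lra.
  - rewrite <- Rmult_minus_distr_r. replace (X (2 * K + k)%nat + 2 * A (S k) - (X' k + 2 * A (S k)))
      with (X (2 * K + k)%nat - X' k) by ring. apply H. apply Rabs_le. lra.
  - rewrite <- Rmult_minus_distr_r. replace (2 - 2 * A (S k) - X (2 * K + k)%nat - (2 - 2 * A (S k) - X' k))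
      with (- (X (2 * K + k)%nat - X' k)) by ring. rewrite <- Ropp_mult_distr_l, Rabs_Ropp.
    apply H. apply Rabs_le. lra.
  - rewrite <- Rmult_minus_distr_r. replace (2 - X (2 * K + k)%nat - (2 - X' k))
      with (- (X (2 * K + k)%nat - X' k)) by ring. rewrite <- Ropp_mult_distr_l, Rabs_Ropp.
    apply H. apply Rabs_le. lra.
Qed.

Lemma fmin_neg X Y k : fmin (negX X) (negY Y) k = fmin X Y k.
Proof.
  unfold fmin. rewrite (Rmin_comm (Rmin (S1 X Y k) _)). unfold S1, S2, S3, S4, negX, negY.
  f_equal; f_equal; ring.
Qed.

Lemma liminf_close (u w : nat -> R) (K : nat) L :
  (forall eps, 0 < eps -> exists N, forall k, (N <= k)%nat -> Rabs (u (K + k)%nat - w k) < eps) ->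
  liminf_nat w L -> liminf_nat u L.
Proof.
  intros H [h1 h2]. split; intros eps heps; destruct (H (eps / 2) ltac:(lra)) as [N HN].
  - destruct (h1 (eps / 2) ltac:(lra)) as [N' HN'].
    exists (K + max N N')%nat. intros k hk. specialize (HN (k - K)%nat ltac:(lia)).
    specialize (HN' (k - K)%nat ltac:(lia)). replace (K + (k - K))%nat with k in HN by lia.
    apply Rabs_def2 in HN. lra.
  - intros N0. destruct (h2 (eps / 2) ltac:(lra) (max N N0)) as [k [hk1 hk2]].
    exists (K + k)%nat. split; [lia|]. specialize (HN k ltac:(lia)). apply Rabs_def2 in HN. lra.
Qed.

(** Products at least c with factors below 2 keep [X'] at distance c / 2 from both ends of its
    interval, so every left tail that approaches [X'] becomes admissible too. *)
Lemma positive_close g X Y X' c : chain g X Y -> chain g X' Y -> positive 0 X' Y -> 0 < c ->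
  (forall k, c <= fmin X' Y k) -> exists K, positive K X Y /\ forall k, (K <= k)%nat -> c / 2 <= fmin X Y k.
Proof.
  intros HC HC' HP hc Hc.
  assert (hY : forall k, Rabs (Y k) <= 2).
  { intros k. destruct (HP k ltac:(lia)) as [_ h]. pose proof (A_bounds k). rewrite Rabs_right; lra. }
  destruct (tails_agree g X Y g X' Y 0 2 HC HC' hY hY) as [_ hX]; [reflexivity|].
  destruct (hX (c / 2) ltac:(lra)) as [N1 HN1].
  destruct (fmin_close g X Y g X' Y 0 2 HC HC' hY hY ltac:(reflexivity) (c / 2) ltac:(lra)) as [N2 HN2].
  exists (max N1 N2). split.
  - intros k hk. specialize (HN1 k ltac:(lia)). simpl in HN1. apply Rabs_def2 in HN1.
    destruct (HP k ltac:(lia)) as [h1 h2]. specialize (Hc k).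
    destruct (fmin_le X' Y k) as (q1 & _ & q3 & _). unfold S1 in q1. unfold S3 in q3.
    pose proof (A_bounds k). pose proof (A_bounds (S k)).
    assert (c / 2 <= X' k) by nra. assert (c / 2 <= 2 - 2 * A (S k) - X' k) by nra. lra.
  - intros k hk. specialize (HN2 k ltac:(lia)). simpl in HN2. apply Rabs_def2 in HN2.
    specialize (Hc k). lra.
Qed.

(** * Blocks of two cells in centred coordinates *)

Definition interleave {V : Type} (F G : nat -> V) (k : nat) : V :=
  if Nat.even k then F (Nat.div2 k) else G (Nat.div2 k).

Lemma interleave_even V (F G : nat -> V) i : interleave F G (2 * i) = F i.
Proof. unfold interleave. now rewrite Nat.div2_double, Nat.even_mul. Qed.

Lemma interleave_odd V (F G : nat -> V) i : interleave F G (S (2 * i)) = G i.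
Proof. unfold interleave. now rewrite Nat.div2_succ_double, even_S, Nat.even_mul. Qed.

Lemma A_even i : A (2 * i) = e.
Proof. unfold A. now rewrite Nat.even_mul. Qed.

Lemma A_odd i : A (S (2 * i)) = f.
Proof. unfold A. now rewrite even_S, Nat.even_mul. Qed.

Lemma cq_even i : cq (2 * i) = a.
Proof. unfold cq. now rewrite Nat.even_mul. Qed.

Lemma cq_odd i : cq (S (2 * i)) = b.
Proof. unfold cq. now rewrite even_S, Nat.even_mul. Qed.

Lemma nat_parity k : exists i, k = (2 * i)%nat \/ k = S (2 * i).
Proof. destruct (Nat.Even_or_Odd k) as [[i h]|[i h]]; exists i; lia. Qed.

Lemma S_S_double i : S (S (2 * i)) = (2 * S i)%nat.
Proof. lia. Qed.

(** The four vertex products of a cell with X = 1 - B + u and Y = 1 - A + v. In these coordinates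
    the half turn is (u, v) -> (-u, -v): it exchanges the first product with the third and the
    second with the fourth. *)
Definition cell (B A u v : R) : R :=
  Rmin (Rmin ((1 - B + u) * (1 - A + v)) ((1 + B + u) * (1 + A - v)))
       (Rmin ((1 - B - u) * (1 - A - v)) ((1 + B - u) * (1 + A + v))).

(** The two cells on either side of an eta-digit. With tau in the middle the value is symmetric in p
    and r, so that reading a word backwards changes nothing. *)
Definition block_value (tau : Z) (p r : R) : R :=
  Rmin (cell f e p (e * (IZR tau + r))) (cell e f (e * (IZR tau + p)) r).

Definition block_ok (d : R) (tau : Z) (p r : R) : Prop :=
  (-(1 - f) < p < 1 - f /\ -(1 - f) < r < 1 - f /\
   -(1 - e) < e * (IZR tau + p) < 1 - e /\ -(1 - e) < e * (IZR tau + r) < 1 - e) /\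
  d <= block_value tau p r.

Definition block_traj (tau T : nat -> Z) (p r : nat -> R) : Prop :=
  forall i, p (S i) = f * (IZR (T i) + e * (IZR (tau i) + p i)) /\
            r i = f * (IZR (T i) + e * (IZR (tau (S i)) + r (S i))).

(* [g] lists the digits of [gamma], so that the blocks A_t, A'_t, C_t, C'_t have
   (tau, T) = (0, t), (0, -t), (-2, t), (2, -t). *)
Definition represents (gamma : R) (tau T : nat -> Z) (p r : nat -> R) : Prop :=
  exists z g X Y M, gamma = IZR z + Y 0%nat / 2 /\ chain g X Y /\ X 0%nat = 0 /\
    (forall k, Rabs (Y k) <= M) /\
    forall i, tau i = (2 * g (2 * i)%nat - a + 2)%Z /\ T i = (2 * g (S (2 * i)) - b + 2)%Z /\
      p i = X (2 * i)%nat - 1 + f /\ r i = Y (S (2 * i)) - 1 + f.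

Definition block_X (tau : nat -> Z) (p : nat -> R) : nat -> R :=
  interleave (fun i => 1 - f + p i) (fun i => 1 - e + e * (IZR (tau i) + p i)).
Definition block_Y (tau : nat -> Z) (r : nat -> R) : nat -> R :=
  interleave (fun i => 1 - e + e * (IZR (tau i) + r i)) (fun i => 1 - f + r i).

Lemma block_chain g tau T p r :
  (forall i, tau i = (2 * g (2 * i)%nat - a + 2)%Z /\ T i = (2 * g (S (2 * i)) - b + 2)%Z) ->
  block_traj tau T p r -> chain g (block_X tau p) (block_Y tau r).
Proof.
  intros Hg HT k. destruct (nat_parity k) as [i [->| ->]]; unfold block_X, block_Y;
  destruct (Hg i) as [h1 h2]; destruct (HT i) as [h3 h4].
  - rewrite !interleave_odd, !interleave_even, A_even, h1.
    rewrite plus_IZR, minus_IZR, mult_IZR. split; lra.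
  - rewrite S_S_double, !interleave_odd, !interleave_even, A_odd, h3, h4, h2.
    rewrite plus_IZR, minus_IZR, mult_IZR. split; lra.
Qed.

Lemma represents_chain gamma tau T p r : represents gamma tau T p r ->
  exists z g X Y M, gamma = IZR z + Y 0%nat / 2 /\ chain g X Y /\ X 0%nat = 0 /\
    (forall k, Rabs (Y k) <= M) /\ block_traj tau T p r /\
    (forall i, tau i = (2 * g (2 * i)%nat - a + 2)%Z /\ T i = (2 * g (S (2 * i)) - b + 2)%Z) /\
    (forall k, X k = block_X tau p k) /\ (forall k, Y k = block_Y tau r k).
Proof.
  intros (z & g & X & Y & M & hz & HC & H0 & hM & H).
  assert (He : forall i, X (S (2 * i)) = 1 - e + e * (IZR (tau i) + p i) /\
                         Y (2 * i)%nat = 1 - e + e * (IZR (tau i) + r i)).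
  { intros i. destruct (H i) as (h1 & h2 & h3 & h4). destruct (HC (2 * i)%nat) as [c1 c2].
    rewrite c1, c2, A_even, h1, h3, h4, plus_IZR, minus_IZR, mult_IZR. lra. }
  assert (Ho : forall i, X (2 * S i)%nat = f * (X (S (2 * i)) + 2 * IZR (g (S (2 * i)))) /\
                         Y (S (2 * i)) = f * (2 * IZR (g (S (2 * i))) + Y (2 * S i)%nat)).
  { intros i. destruct (HC (S (2 * i))) as [c1 c2]. rewrite A_odd, S_S_double in *. auto. }
  exists z, g, X, Y, M. repeat (split; trivial).
  - destruct (H i) as (h1 & h2 & h3 & h4). destruct (H (S i)) as (h1' & h2' & h3' & h4').
    rewrite h3', h2, plus_IZR, minus_IZR, mult_IZR. destruct (Ho i) as [o1 _]. rewrite o1.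
    destruct (He i) as [e1 _]. rewrite e1. lra.
  - destruct (H i) as (h1 & h2 & h3 & h4).
    rewrite h4, h2, plus_IZR, minus_IZR, mult_IZR. destruct (Ho i) as [_ o1]. rewrite o1.
    destruct (He (S i)) as [_ e1]. rewrite e1. lra.
  - now destruct (H i) as (h1 & h2 & h3 & h4).
  - now destruct (H i) as (h1 & h2 & h3 & h4).
  - intros k. destruct (nat_parity k) as [i [->| ->]]; unfold block_X.
    + rewrite interleave_even. destruct (H i) as (_ & _ & h3 & _). lra.
    + rewrite interleave_odd. apply He.
  - intros k. destruct (nat_parity k) as [i [->| ->]]; unfold block_Y.
    + rewrite interleave_even. apply He.
    + rewrite interleave_odd. destruct (H i) as (_ & _ & _ & h4). lra.
Qed.

Lemma fmin_even tau p r i : fmin (block_X tau p) (block_Y tau r) (2 * i) = cell f e (p i) (e * (IZR (tau i) + r i)).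
Proof.
  unfold fmin, S1, S2, S3, S4, cell, block_X, block_Y. rewrite !interleave_even, A_even, A_odd.
  f_equal; f_equal; ring.
Qed.

Lemma fmin_odd tau p r i : fmin (block_X tau p) (block_Y tau r) (S (2 * i)) = cell e f (e * (IZR (tau i) + p i)) (r i).
Proof.
  unfold fmin, S1, S2, S3, S4, cell, block_X, block_Y. rewrite !interleave_odd, A_SS, A_even, A_odd.
  f_equal; f_equal; ring.
Qed.

Lemma block_value_fmin tau p r i : block_value (tau i) (p i) (r i) =
  Rmin (fmin (block_X tau p) (block_Y tau r) (2 * i)) (fmin (block_X tau p) (block_Y tau r) (S (2 * i))).
Proof. now rewrite fmin_even, fmin_odd. Qed.

Lemma block_ok_iff d tau p r K :
  (forall i, (K <= i)%nat -> block_ok d (tau i) (p i) (r i)) <->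
  positive (2 * K) (block_X tau p) (block_Y tau r) /\
  forall k, (2 * K <= k)%nat -> d <= fmin (block_X tau p) (block_Y tau r) k.
Proof.
  split.
  - intros H. split; intros k hk; destruct (nat_parity k) as [i [->| ->]];
      destruct (H i ltac:(lia)) as [h1 h2]; rewrite (block_value_fmin tau p r i) in h2 || idtac.
    + unfold block_X, block_Y. rewrite !interleave_even, A_even, A_odd. lra.
    + unfold block_X, block_Y. rewrite !interleave_odd, A_SS, A_even, A_odd. lra.
    + apply Rle_trans with (1 := h2), Rmin_l.
    + apply Rle_trans with (1 := h2), Rmin_r.
  - intros [H1 H2] i hi. split.
    + destruct (H1 (2 * i)%nat ltac:(lia)) as [h1 h2].
      destruct (H1 (S (2 * i))%nat ltac:(lia)) as [h3 h4]. unfold block_X, block_Y in *.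
      rewrite !interleave_even, ?interleave_odd, ?A_SS, ?A_even, ?A_odd in *. lra.
    + rewrite (block_value_fmin tau p r i). apply Rmin_glb; apply H2; lia.
Qed.

Lemma liminf_interleave (u : nat -> R) L :
  liminf_nat (fun i => Rmin (u (2 * i)%nat) (u (S (2 * i)))) L <-> liminf_nat u L.
Proof.
  assert (M : forall x y : R, Rmin x y <= x /\ Rmin x y <= y) by (split; [apply Rmin_l|apply Rmin_r]).
  split; intros [h1 h2]; split; intros eps heps.
  - destruct (h1 eps heps) as [N HN]. exists (2 * N)%nat. intros k hk.
    destruct (nat_parity k) as [i [->| ->]]; specialize (HN i ltac:(lia));
    destruct (M (u (2 * i)%nat) (u (S (2 * i)))); lra.
  - intros N. destruct (h2 eps heps N) as [i [hi1 hi2]].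
    unfold Rmin in hi2. destruct Rle_dec; [exists (2 * i)%nat|exists (S (2 * i))]; split; trivial; lia.
  - destruct (h1 eps heps) as [N HN]. exists N. intros i hi.
    unfold Rmin. destruct Rle_dec; apply HN; lia.
  - intros N. destruct (h2 eps heps (2 * N)%nat) as [k [hk1 hk2]].
    destruct (nat_parity k) as [i [->| ->]]; exists i; (split; [lia|]);
    destruct (M (u (2 * i)%nat) (u (S (2 * i)))); lra.
Qed.

Lemma spectrum_blocks gamma M0 d : (~ exists m n : Z, gamma = IZR m + e * IZR n) ->
  is_liminf_Z (Mfun e gamma) M0 -> e <= d -> 4 * (e * f) <= d -> d < 4 * (1 - e * f) * M0 ->
  exists tau T p r K d', represents gamma tau T p r /\ d < d' /\
    forall i, (K <= i)%nat -> block_ok d' (tau i) (p i) (r i).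
Proof.
  intros h1 h2 h3 h4 h5.
  destruct (spectrum_chain gamma M0 d h1 h2 h3 h4 h5)
    as (z & g & X & Y & K & d' & hz & HC & H0 & hM & HP & hd & Hd).
  set (tau := fun i : nat => (2 * g (2 * i)%nat - a + 2)%Z).
  set (T := fun i : nat => (2 * g (S (2 * i)) - b + 2)%Z).
  set (p := fun i : nat => X (2 * i)%nat - 1 + f). set (r := fun i : nat => Y (S (2 * i)) - 1 + f).
  assert (HR : represents gamma tau T p r).
  { exists z, g, X, Y, 2. repeat (split; trivial). }
  exists tau, T, p, r, K, d'. split; [trivial|]. split; [trivial|].
  assert (hX : forall k, X k = block_X tau p k /\ Y k = block_Y tau r k).
  { assert (E : forall i, IZR (tau i) = 2 * IZR (g (2 * i)%nat) - IZR a + 2)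
      by (intros i; unfold tau; now rewrite plus_IZR, minus_IZR, mult_IZR).
    intros k. destruct (nat_parity k) as [i [->| ->]]; unfold block_X, block_Y;
    rewrite ?interleave_even, ?interleave_odd, ?E; unfold p, r;
    destruct (HC (2 * i)%nat) as [c1 c2]; rewrite A_even in *; split; lra. }
  apply block_ok_iff. split.
  - intros k hk. destruct (hX k) as [<- <-]. apply HP. lia.
  - intros k hk. specialize (Hd k ltac:(lia)). destruct (hX k) as [e1 e2], (hX (S k)) as [e3 e4].
    unfold fmin, S1, S2, S3, S4 in *. now rewrite <- e1, <- e2.
Qed.

Lemma fmin_ext X Y X' Y' : (forall k, X k = X' k) -> (forall k, Y k = Y' k) -> forall k, fmin X Y k = fmin X' Y' k.
Proof. intros h1 h2 k. unfold fmin, S1, S2, S3, S4. now rewrite h1, h2. Qed.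

(* The left tail of a represented gamma may be replaced by any other solution of the
   recursion, such as a periodic one. *)
Lemma word_value gamma tau T p r p' c L : represents gamma tau T p r -> block_traj tau T p' r ->
  0 < c -> (forall i, block_ok c (tau i) (p' i) (r i)) ->
  liminf_nat (fun i => block_value (tau i) (p' i) (r i)) L ->
  is_liminf_Z (Mfun e gamma) (L / (4 * (1 - e * f))) /\ ~ exists m n : Z, gamma = IZR m + e * IZR n.
Proof.
  intros HR HT hc Hok HL.
  destruct (represents_chain _ _ _ _ _ HR) as (z & g & X & Y & M & hz & HC & H0 & hM & HT' & Hg & hX & hY).
  pose proof (block_chain g tau T p' r Hg HT) as HC'.
  assert (Hok' : forall i, (0 <= i)%nat -> block_ok c (tau i) (p' i) (r i)) by auto.
  apply block_ok_iff in Hok'. destruct Hok' as [HP Hc]. simpl in HP, Hc.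
  set (X' := block_X tau p') in *.
  assert (HCY : chain g X' Y). { intros k. rewrite !hY. apply HC'. }
  assert (HPY : positive 0 X' Y). { intros k hk. rewrite hY. auto. }
  assert (HcY : forall k, c <= fmin X' Y k).
  { intros k. rewrite (fmin_ext X' Y X' (block_Y tau r)); auto. apply Hc. lia. }
  destruct (positive_close g X Y X' c HC HCY HPY hc HcY) as [K [HK1 HK2]].
  assert (HLk : liminf_nat (fmin X Y) L).
  { apply (liminf_close _ (fmin X' Y) 0).
    - apply (fmin_close g X Y g X' Y 0 M); auto.
    - apply liminf_interleave. destruct HL as [l1 l2].
      assert (E : forall i, Rmin (fmin X' Y (2 * i)) (fmin X' Y (S (2 * i))) = block_value (tau i) (p' i) (r i)).
      { intros i. rewrite block_value_fmin. f_equal; apply fmin_ext; auto. }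
      split; intros eps heps.
      + destruct (l1 eps heps) as [N HN]. exists N. intros i hi. rewrite E. auto.
      + intros N. destruct (l2 eps heps N) as [i hi]. exists i. now rewrite E. }
  split.
  - apply (value_of_chain gamma z g X Y K (c / 2) L); auto. lra.
  - apply (chain_not_lattice gamma z g X Y K (c / 2)); auto. lra.
Qed.

(** The periodic left tail p'' serves as reference: its vertex products are bounded below from the
    first block on, whereas p' starts from [X 0 = 0]. Both expansions approach it, the first one
    after a half turn when s = -1. *)
Lemma matching_values gamma tau T p r K c gamma' tau' T' p' r' p'' c' s :
  represents gamma tau T p r -> represents gamma' tau' T' p' r' -> block_traj tau' T' p'' r' ->
  0 < c -> (forall i, (K <= i)%nat -> block_ok c (tau i) (p i) (r i)) ->
  0 < c' -> (forall i, block_ok c' (tau' i) (p'' i) (r' i)) ->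
  (s = 1 \/ s = -1)%Z ->
  (forall i, tau (K + i)%nat = (s * tau' i)%Z /\ T (K + i)%nat = (s * T' i)%Z) ->
  exists L, is_liminf_Z (Mfun e gamma) L /\ is_liminf_Z (Mfun e gamma') L.
Proof.
  intros HR HR' HT'' hc Hok hc' Hok' hs Hm.
  destruct (represents_chain _ _ _ _ _ HR) as (z & g & X & Y & M & hz & HC & H0 & hM & HT & Hg & hX & hY).
  destruct (represents_chain _ _ _ _ _ HR') as (z' & g' & X' & Y' & M' & hz' & HC' & H0' & hM' & HT' & Hg' & hX' & hY').
  apply block_ok_iff in Hok. destruct Hok as [HP Hc].
  assert (Hv : exists L, liminf_nat (fun i => block_value (tau' i) (p'' i) (r' i)) L).
  { apply (liminf_nat_exists _ 0 c' 4). intros k _. destruct (Hok' k) as [h1 h2]. split; [trivial|].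
    unfold block_value. apply Rle_trans with (1 := Rmin_l _ _). unfold cell.
    apply Rle_trans with (1 := Rmin_l _ _). apply Rle_trans with (1 := Rmin_l _ _). nra. }
  destruct Hv as [L HL]. exists (L / (4 * (1 - e * f))).
  split; [|now apply (word_value gamma' tau' T' p' r' p'' c')].
  assert (Hok0 : forall i, (0 <= i)%nat -> block_ok c' (tau' i) (p'' i) (r' i)) by auto.
  apply block_ok_iff in Hok0. destruct Hok0 as [HP' Hc'].
  set (X'' := block_X tau' p'') in *. set (Y'' := block_Y tau' r') in *.
  assert (HC'' : chain g' X'' Y'') by now apply block_chain with T'.
  assert (HL'' : liminf_nat (fmin X'' Y'') L).
  { apply liminf_interleave. destruct HL as [l1 l2]. split; intros eps heps.
    - destruct (l1 eps heps) as [N HN]. exists N. intros i hi. specialize (HN i hi).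
      now rewrite (block_value_fmin tau' p'' r' i) in HN.
    - intros N. destruct (l2 eps heps N) as [i [hi1 hi2]]. exists i. split; trivial.
      now rewrite (block_value_fmin tau' p'' r' i) in hi2. }
  assert (hM'' : forall k, Rabs (Y'' k) <= 2).
  { intros k. destruct (HP' k ltac:(lia)) as [_ h]. pose proof (A_bounds k). rewrite Rabs_right; lra. }
  assert (HLg : liminf_nat (fmin X Y) L).
  { destruct hs as [->| ->].
    - apply (liminf_close _ (fmin X'' Y'') (2 * K)); trivial.
      apply (fmin_close g X Y g' X'' Y'' K (M + 2)); trivial.
      + intros k. specialize (hM k). lra.
      + intros k. specialize (hM'' k). pose proof (Rabs_pos (Y 0%nat)). specialize (hM 0%nat). lra.
      + intros k. destruct (nat_parity k) as [i [->| ->]].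
        * destruct (Hm i) as [h _], (Hg (K + i)%nat) as [h1 _], (Hg' i) as [h2 _].
          replace (2 * K + 2 * i)%nat with (2 * (K + i))%nat by lia. lia.
        * destruct (Hm i) as [_ h], (Hg (K + i)%nat) as [_ h1], (Hg' i) as [_ h2].
          replace (2 * K + S (2 * i))%nat with (S (2 * (K + i)))%nat by lia. lia.
    - apply (liminf_close _ (fmin (negX X'') (negY Y'')) (2 * K)).
      2:{ destruct HL'' as [l1 l2]. split; intros eps heps.
          - destruct (l1 eps heps) as [N HN]. exists N. intros i hi. rewrite fmin_neg. auto.
          - intros N. destruct (l2 eps heps N) as [i hi]. exists i. now rewrite fmin_neg. }
      apply (fmin_close g X Y (neg_digit g') (negX X'') (negY Y'') K (M + 2)); trivial.
      + now apply neg_chain.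
      + intros k. specialize (hM k). lra.
      + intros k. pose proof (Rabs_pos (Y 0%nat)). specialize (hM 0%nat). destruct (HP' k ltac:(lia)) as [_ h].
        pose proof (A_bounds k). unfold negY. rewrite Rabs_right; lra.
      + intros k. unfold neg_digit. destruct (nat_parity k) as [i [->| ->]].
        * destruct (Hm i) as [h _], (Hg (K + i)%nat) as [h1 _], (Hg' i) as [h2 _].
          replace (2 * K + 2 * i)%nat with (2 * (K + i))%nat by lia. rewrite cq_even. lia.
        * destruct (Hm i) as [_ h], (Hg (K + i)%nat) as [_ h1], (Hg' i) as [_ h2].
          replace (2 * K + S (2 * i))%nat with (S (2 * (K + i)))%nat by lia. rewrite cq_odd. lia. }
  apply (value_of_chain gamma z g X Y (2 * K) c L); auto.
  - intros k hk. rewrite hX, hY. auto.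
  - intros k hk. rewrite (fmin_ext X Y (block_X tau p) (block_Y tau r)); auto.
Qed.

(** * Expansions given by sequences of blocks *)

Definition block_term (blk : nat -> Z * Z) (i : nat) : R :=
  (IZR (fst (blk i)) * e + IZR (snd (blk i)) * (e * f)) * (e * f) ^ i.

Lemma blocks_represent (blk : nat -> Z * Z) (m : Z) :
  (forall i, Z.abs (fst (blk i)) <= m /\ Z.abs (snd (blk i)) <= m)%Z ->
  exists gamma p r, infinite_sum (block_term blk) gamma /\
    represents gamma (fun i => 2 * fst (blk i) - a + 2)%Z (fun i => 2 * snd (blk i) - b + 2)%Z p r.
Proof.
  intros Hm. assert (hD : 0 < e * f < 1) by nra.
  set (c := IZR m * (e + e * f)).
  assert (Hterm : forall s i, Rabs (block_term (fun j => blk (s + j)%nat) i) <= c * (e * f) ^ i).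
  { intros s i. unfold block_term. rewrite Rabs_mult. rewrite (Rabs_right ((e * f) ^ i)) by (apply Rle_ge, pow_le; lra).
    apply Rmult_le_compat_r; [apply pow_le; lra|]. destruct (Hm (s + i)%nat) as [h1 h2].
    apply IZR_le in h1, h2. rewrite abs_IZR in h1, h2.
    apply Rle_trans with (1 := Rabs_triang _ _). rewrite !Rabs_mult, (Rabs_right e), (Rabs_right f) by lra.
    unfold c. nra. }
  assert (Hg : ex_series (fun i => c * (e * f) ^ i)).
  { apply (ex_series_scal_l c (fun i => (e * f) ^ i)). apply ex_series_geom. rewrite Rabs_right; lra. }
  assert (Hex : forall s, ex_series (block_term (fun j => blk (s + j)%nat))).
  { intros s. apply (ex_series_le (block_term (fun j => blk (s + j)%nat)) (fun i => c * (e * f) ^ i)); [|trivial].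
    intros i. apply Hterm. }
  (* The value of the expansion that starts at block s; twice this number is the right tail in cell
     2 s. It is bounded by a geometric series, uniformly in s. *)
  set (E := fun s => Series (block_term (fun j => blk (s + j)%nat))).
  assert (HE : forall s, E s = IZR (fst (blk s)) * e + IZR (snd (blk s)) * (e * f) + e * f * E (S s)).
  { intros s. unfold E. rewrite Series_incr_1 by apply Hex. unfold block_term at 1. rewrite Nat.add_0_r. simpl pow.
    rewrite Rmult_1_r. f_equal. rewrite <- Series_scal_l. apply Series_ext. intros i.
    unfold block_term. replace (s + S i)%nat with (S s + i)%nat by lia. simpl. ring. }
  assert (HB : forall s, Rabs (E s) <= Series (fun i => c * (e * f) ^ i)).
  { intros s. unfold E. apply Rle_trans with (Series (fun i => Rabs (block_term (fun j => blk (s + j)%nat) i))).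
    - apply Series_Rabs. apply (ex_series_le (fun i => Rabs (block_term (fun j => blk (s + j)%nat) i)) (fun i => c * (e * f) ^ i)); trivial.
      intros i. unfold norm; simpl. unfold abs; simpl. rewrite Rabs_Rabsolu. apply Hterm.
    - apply Series_le; trivial. intros i. split; [apply Rabs_pos|apply Hterm]. }
  set (B := Series (fun i => c * (e * f) ^ i)) in *.
  set (g := interleave (fun i => fst (blk i)) (fun i => snd (blk i))).
  set (Y := interleave (fun i => 2 * E i) (fun i => 2 * E i / e - 2 * IZR (fst (blk i)))).
  set (X := Xof g).
  assert (HC : chain g X Y).
  { intros k. split; [reflexivity|]. unfold g, Y. destruct (nat_parity k) as [i [->| ->]].
    - rewrite !interleave_odd, !interleave_even, A_even. field. lra.
    - rewrite S_S_double, !interleave_odd, !interleave_even, A_odd. rewrite (HE i). field. lra. }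
  exists (E 0%nat), (fun i => X (2 * i)%nat - 1 + f), (fun i => Y (S (2 * i)) - 1 + f). split.
  { apply is_series_Reals. unfold E. apply Series_correct. apply (Hex 0%nat). }
  assert (hB : 0 <= B) by (apply Rle_trans with (2 := HB 0%nat), Rabs_pos).
  assert (hm : 0 <= IZR m). { apply IZR_le. destruct (Hm 0%nat). lia. }
  exists 0%Z, g, X, Y, (2 * B / e + 2 * B + 2 * IZR m).
  split; [|split; [trivial|split; [reflexivity|split]]].
  - unfold Y. rewrite (interleave_even R _ _ 0). field.
  - intros k. assert (h0 : 0 <= 2 * B / e) by (unfold Rdiv; apply Rmult_le_pos; [lra|left; apply Rinv_0_lt_compat; lra]).
    unfold Y. destruct (nat_parity k) as [i [->| ->]].
    + rewrite interleave_even, Rabs_mult, (Rabs_right 2) by lra. specialize (HB i). lra.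
    + rewrite interleave_odd. unfold Rminus. apply Rle_trans with (1 := Rabs_triang _ _).
      rewrite Rabs_Ropp. unfold Rdiv. rewrite !Rabs_mult, (Rabs_right 2), (Rabs_right (/ e)) by (try lra; apply Rle_ge; left; apply Rinv_0_lt_compat; lra).
      destruct (Hm i) as [h1 _]. apply IZR_le in h1. rewrite abs_IZR in h1.
      specialize (HB i). assert (2 * Rabs (E i) * / e <= 2 * B * / e).
      { apply Rmult_le_compat_r; [left; apply Rinv_0_lt_compat|]; lra. }
      unfold Rdiv in *. lra.
  - intros i. unfold g. rewrite interleave_even, interleave_odd. repeat split; ring.
Qed.

(* Two bounded solutions of the right recursion differ by a sequence contracted by [D]. *)
Lemma represents_tail gamma tau T p r p0 r0 M0 : represents gamma tau T p r -> block_traj tau T p0 r0 ->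
  (forall i, Rabs (r0 i) <= M0) -> forall i, r i = r0 i.
Proof.
  intros HR HB0 hM0 i.
  destruct (represents_chain _ _ _ _ _ HR) as (z & g & X & Y & M & hz & HC & H0 & hM & HB & Hg & hX & hY).
  assert (hD : 0 < e * f < 3 / 10) by nra.
  apply Rminus_diag_uniq. revert i. apply (contract_zero (fun i => r i - r0 i) (M + 1 + M0)).
  - intros i. destruct (HB i) as [_ h1], (HB0 i) as [_ h2].
    replace (r i - r0 i) with (e * f * (r (S i) - r0 (S i))) by (rewrite h1, h2; ring).
    rewrite Rabs_mult, (Rabs_right (e * f)) by lra. apply Rmult_le_compat_r; [apply Rabs_pos|lra].
  - intros i. specialize (hM (S (2 * i))). rewrite hY in hM. unfold block_Y in hM. rewrite interleave_odd in hM.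
    specialize (hM0 i). apply Rabs_le_between in hM, hM0. apply Rabs_le. lra.
Qed.

Lemma cyclic_traj N (tau T : nat -> Z) (p r : nat -> R) : (1 <= N)%nat ->
  tau N = tau 0%nat -> p N = p 0%nat -> r N = r 0%nat ->
  (forall m, (m < N)%nat -> p (S m) = f * (IZR (T m) + e * (IZR (tau m) + p m)) /\
     r m = f * (IZR (T m) + e * (IZR (tau (S m)) + r (S m)))) ->
  block_traj (fun i => tau (i mod N)%nat) (fun i => T (i mod N)%nat)
    (fun i => p (i mod N)%nat) (fun i => r (i mod N)%nat).
Proof.
  intros hN h1 h2 h3 H i.
  assert (hm : (i mod N < N)%nat) by (apply Nat.mod_upper_bound; lia). specialize (H _ hm).
  assert (E : (S i mod N = if S (i mod N) =? N then 0 else S (i mod N))%nat).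
  { pose proof (Nat.div_mod_eq i N) as Hd. destruct (Nat.eqb_spec (S (i mod N)) N) as [hs|hs]; symmetry.
    - apply Nat.mod_unique with (S (i / N)); [lia|]. rewrite Nat.mul_succ_r. lia.
    - apply Nat.mod_unique with (i / N)%nat; lia. }
  simpl. rewrite E. destruct (Nat.eqb_spec (S (i mod N)) N) as [hs|hs]; [|trivial].
  rewrite hs, h1, h2, h3 in H. trivial.
Qed.

End Cells.

(** * The size of eta and beta *)

Section EtaBeta.

Context (a b : Z) (Ha : (4 <= a)%Z) (Hab : (a < b)%Z) (Hea : Z.Even a) (Heb : Z.Even b).

Lemma eta_beta_facts : 0 < beta a b /\ beta a b < eta a b /\ 4 * eta a b <= 1 + eta a b * beta a b /\
  eta a b < 3 / 10 /\ IZR a * eta a b = 1 + eta a b * beta a b /\ IZR b * beta a b = 1 + eta a b * beta a b.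
Proof.
  assert (hb : (a + 2 <= b)%Z). { destruct Hea as [x ->], Heb as [y ->]. lia. }
  apply IZR_le in Ha as ha, hb. rewrite plus_IZR in hb.
  set (x := IZR a) in *. set (y := IZR b) in *.
  assert (hxy : 24 <= x * y) by nra.
  set (s := sqrt (x * y * (x * y) - 4 * (x * y))).
  assert (hs0 : 0 <= s) by apply sqrt_pos.
  assert (hs2 : s * s = x * y * (x * y) - 4 * (x * y)) by (apply sqrt_sqrt; nra).
  assert (h1 : sqrt (y ^ 2 - 4 * y / x) = s / x).
  { apply Rsqr_inj; [apply sqrt_pos|apply Rmult_le_pos; [lra|left; apply Rinv_0_lt_compat; lra]|].
    unfold Rsqr. rewrite sqrt_sqrt.
    - replace (s / x * (s / x)) with (s * s / (x * x)) by (field; lra). rewrite hs2. field. lra.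
    - replace (y ^ 2 - 4 * y / x) with (y * (x * y - 4) / x) by (field; lra).
      apply Rmult_le_pos; [nra|left; apply Rinv_0_lt_compat; lra]. }
  assert (h2 : sqrt (x ^ 2 - 4 * x / y) = s / y).
  { apply Rsqr_inj; [apply sqrt_pos|apply Rmult_le_pos; [lra|left; apply Rinv_0_lt_compat; lra]|].
    unfold Rsqr. rewrite sqrt_sqrt.
    - replace (s / y * (s / y)) with (s * s / (y * y)) by (field; lra). rewrite hs2. field. lra.
    - replace (x ^ 2 - 4 * x / y) with (x * (x * y - 4) / y) by (field; lra).
      apply Rmult_le_pos; [nra|left; apply Rinv_0_lt_compat; lra]. }
  assert (hs3 : s < x * y) by nra.
  assert (hs4 : x * y - 22 / 10 < s) by nra.
  unfold eta, beta. fold x y. rewrite h1, h2.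
  (* h will be 1 + D: with s^2 = x y (x y - 4) it satisfies h^2 = x y (h - 1), while eta = h / a and
     beta = h / b. *)
  set (h := (x * y - s) / 2).
  assert (he : (y - s / x) / 2 = h / x) by (unfold h; field; lra).
  assert (hf : (x - s / y) / 2 = h / y) by (unfold h; field; lra).
  rewrite he, hf. assert (hh : h * h = x * y * (h - 1)) by (unfold h; nra).
  assert (hD : h / x * (h / y) = h - 1).
  { replace (h / x * (h / y)) with (h * h / (x * y)) by (field; lra). rewrite hh. field. lra. }
  rewrite hD. assert (hh0 : 0 < h < 11 / 10) by (unfold h; lra).
  assert (hix : 0 < / x <= / 4) by (split; [apply Rinv_0_lt_compat; lra|apply Rinv_le_contravar; lra]).
  repeat split.
  - apply Rdiv_lt_0_compat; lra.
  - apply Rmult_lt_compat_l; [lra|]. apply Rinv_lt_contravar; nra.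
  - unfold Rdiv. nra.
  - unfold Rdiv. nra.
  - field. lra.
  - field. lra.
Qed.

End EtaBeta.

(** * Tails with large values *)

Section Combinatorics.

Context (e f : R) (f_pos : 0 < f) (fe : f < e) (e_small : 4 * e <= 1 + e * f) (e_lt : e < 3 / 10).

(* The eight inequalities are the vertex conditions at the two cells of a block. *)
Record ok8 (d t p r : R) : Prop := {
  ok_p : -(1 - f) < p < 1 - f; ok_r : -(1 - f) < r < 1 - f;
  ok_tp : -(1 - e) < e * (t + p) < 1 - e; ok_tr : -(1 - e) < e * (t + r) < 1 - e;
  ok_1 : d <= (1 - f + p) * (1 - e + e * (t + r)); ok_1' : d <= (1 - f + r) * (1 - e + e * (t + p));
  ok_2 : d <= (1 + f + p) * (1 + e - e * (t + r)); ok_2' : d <= (1 + f + r) * (1 + e - e * (t + p));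
  ok_3 : d <= (1 - f - p) * (1 - e - e * (t + r)); ok_3' : d <= (1 - f - r) * (1 - e - e * (t + p));
  ok_4 : d <= (1 + f - p) * (1 + e + e * (t + r)); ok_4' : d <= (1 + f - r) * (1 + e + e * (t + p)) }.

Lemma Rmin4 x y z w d : d <= Rmin (Rmin x y) (Rmin z w) <-> d <= x /\ d <= y /\ d <= z /\ d <= w.
Proof.
  split.
  - unfold Rmin. repeat destruct Rle_dec; lra.
  - intros (h1 & h2 & h3 & h4). unfold Rmin. repeat destruct Rle_dec; lra.
Qed.

Lemma block_ok8 d tau p r : block_ok e f d tau p r <-> ok8 d (IZR tau) p r.
Proof.
  assert (Hm : forall x y, d <= Rmin x y <-> d <= x /\ d <= y).
  { intros x y. split; [|intros [h1 h2]; now apply Rmin_glb].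
    pose proof (Rmin_l x y). pose proof (Rmin_r x y). lra. }
  unfold block_ok, block_value, cell. rewrite Hm, !Rmin4. split.
  - intros [(h1 & h2 & h3 & h4) ((q1 & q2 & q3 & q4) & (q5 & q6 & q7 & q8))]. constructor; lra.
  - intros []. repeat split; lra.
Qed.

Lemma ok8_swap d t p r : ok8 d t p r -> ok8 d t r p.
Proof. intros []; constructor; trivial. Qed.

Lemma ok8_neg d t p r : ok8 d t p r -> ok8 d (- t) (- p) (- r).
Proof. intros []; constructor; lra. Qed.

(** Let M be the larger of |p| and |r|. According to its sign, the first or the third vertex product
    is at most (1 - f - M)(1 - e + e M), which decreases in M and has fallen below (1 - e)(1 - 3 f)
    at M = 10/3 f. *)
Lemma ok8_zero_bound d p r : (1 - e) * (1 - 3 * f) <= d -> ok8 d 0 p r -> Rabs p < 10 / 3 * f /\ Rabs r < 10 / 3 * f.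
Proof.
  assert (H : forall M, 0 <= M < 1 - f -> (1 - e) * (1 - 3 * f) <= (1 - f - M) * (1 - e + e * M) -> M < 10 / 3 * f).
  { intros M hM h. apply Rnot_le_lt. intros hle.
    assert (h1 : (1 - f - M) * (1 - e + e * M) <= (1 - 13 / 3 * f) * (1 - e + 10 / 3 * (e * f))).
    { set (s := M - 10 / 3 * f). replace M with (10 / 3 * f + s) by (unfold s; ring). assert (0 <= s) by (unfold s; lra).
      assert (0 <= s * (1 - 2 * e + e * f + 20 / 3 * (e * f) + e * s)) by (apply Rmult_le_pos; nra). nra. }
    assert (h2 : (1 - 13 / 3 * f) * (1 - e + 10 / 3 * (e * f)) < (1 - e) * (1 - 3 * f)).
    { assert (0 < f * (4 * (1 - e) - 10 * e * (1 - 13 / 3 * f))) by (apply Rmult_lt_0_compat; nra). nra. }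
    lra. }
  assert (G : forall p r, ok8 d 0 p r -> (1 - e) * (1 - 3 * f) <= d -> Rabs r <= Rabs p -> Rabs p < 10 / 3 * f).
  { intros p' r' [kp kr ktp ktr k1 k1' k2 k2' k3 k3' k4 k4'] hd hpr. apply H; [split; [apply Rabs_pos|apply Rabs_def1; lra]|].
    apply Rle_trans with (1 := hd). rewrite !Rplus_0_l in *.
    apply Rabs_le_between in hpr. revert hpr. unfold Rabs. destruct (Rcase_abs p'); intros hpr.
    - apply Rle_trans with (1 := k1). apply Rmult_le_compat; try lra. nra.
    - apply Rle_trans with (1 := k3). apply Rmult_le_compat; try lra. nra. }
  intros hd ho. destruct (Rle_dec (Rabs r) (Rabs p)) as [h|h].
  - pose proof (G p r ho hd h). lra.
  - pose proof (G r p (ok8_swap _ _ _ _ ho) hd ltac:(lra)). lra.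
Qed.

(** * Blocks with nonzero tau when 2a <= b *)

Lemma no_four_right q : 2 * f <= e -> (1 + f - q) * (1 - 3 * e + e * q) < (1 - e) * (1 - 3 * f) \/ q < 0.
Proof.
  intros hef. destruct (Rlt_dec q 0); [now right|left].
  assert (0 <= q * (1 + e * f - 4 * e)) by (apply Rmult_le_pos; lra).
  assert (0 <= e * ((q - f) * (q - f))) by (apply Rmult_le_pos; [lra|apply Rle_0_sqr]).
  assert (0 < f * e) by (apply Rmult_lt_0_compat; lra).
  assert (0 < f * e * (6 - f)) by (apply Rmult_lt_0_compat; lra). lra.
Qed.

(** The smaller tail decides: if it is at most 0 the second vertex product is too small, and if it
    is positive the third. *)
Lemma ok8_no_four d t p r : 2 * f <= e -> (1 - e) * (1 - 3 * f) <= d -> 4 <= t -> ok8 d t p r -> False.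
Proof.
  intros hef hd ht.
  assert (G : forall p r, ok8 d t p r -> p <= r -> False).
  { clear p r. intros p r [kp kr ktp ktr k1 k1' k2 k2' k3 k3' k4 k4'] hpr.
    assert (hr : e * r >= e * p) by (apply Rmult_ge_compat_l; lra).
    assert (het : e * t >= e * 4) by (apply Rmult_ge_compat_l; lra).
    destruct (no_four_right (- p) hef) as [h|h].
    - assert (h1 : (1 + f + p) * (1 + e - e * (t + r)) <= (1 + f + p) * (1 - 3 * e + e * - p)).
      { apply Rmult_le_compat_l; lra. }
      lra.
    - assert (h4 : 0 <= 1 - e - e * (t + r) <= 1 - 5 * e).
      { assert (0 < e * p) by (apply Rmult_lt_0_compat; lra). lra. }
      assert ((1 - f - p) * (1 - e - e * (t + r)) <= (1 - f) * (1 - 5 * e)) by (apply Rmult_le_compat; lra).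
      assert (0 < e * f) by (apply Rmult_lt_0_compat; lra). lra. }
  intros ho. destruct (Rle_dec p r); [apply (G p r)|apply (G r p)]; auto using ok8_swap. lra.
Qed.

(** As 1 + D = a e = b f, this says a >= 6 or (a, b) = (4, 8). *)
Definition eta_sixth_or_48 := 6 * e <= 1 + e * f \/ (4 * e = 1 + e * f /\ e = 2 * f).

Lemma six_e : eta_sixth_or_48 -> 6 * e < 1 + 20 * (e * f).
Proof.
  intros [h|[h1 h2]].
  - assert (0 < e * f) by (apply Rmult_lt_0_compat; lra). lra.
  - assert (1 / 8 <= f) by (assert (0 < e * f) by (apply Rmult_lt_0_compat; lra); lra).
    assert (2 / 8 * (1 / 8) <= e * f) by (apply Rmult_le_compat; lra). lra.
Qed.

Lemma two_upper M : eta_sixth_or_48 -> (1 - e) * (1 - 3 * f) <= (1 + f - M) * (1 - e + e * M) -> M < 5 * f.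
Proof.
  intros hA h. apply six_e in hA. apply Rnot_le_lt. intros hle.
  set (s := M - 5 * f). assert (hs : 0 <= s) by (unfold s; lra).
  replace M with (5 * f + s) in h by (unfold s; ring).
  assert (0 < f * (1 + 20 * (e * f) - 6 * e)) by (apply Rmult_lt_0_compat; lra).
  assert (0 < e * f) by (apply Rmult_lt_0_compat; lra).
  assert (0 <= s * (1 - 2 * e + 9 * (e * f))) by (apply Rmult_le_pos; lra).
  assert (0 <= e * (s * s)) by (apply Rmult_le_pos; [lra|apply Rle_0_sqr]). lra.
Qed.

Lemma two_lower P Q : 2 * f <= e -> 0 <= 1 - f + P -> Q < 5 * f ->
  (1 - e) * (1 - 3 * f) <= (1 - f + P) * (1 - 3 * e + e * Q) -> 2 * f + 10 / 3 * (e * f * f) < P.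
Proof.
  intros hef hP hQ h. apply Rnot_le_lt. intros hle.
  assert (hf : f < 15 / 100) by lra.
  assert (0 < e * f) by (apply Rmult_lt_0_compat; lra).
  assert (h0 : e * Q <= e * (5 * f)) by (apply Rmult_le_compat_l; lra).
  assert (h1 : (1 - f + P) * (1 - 3 * e + e * Q) <= (1 - f + P) * (1 - 3 * e + 5 * (e * f))) by (apply Rmult_le_compat_l; lra).
  assert (h2 : (1 - f + P) * (1 - 3 * e + 5 * (e * f)) <= (1 + f + 10 / 3 * (e * f * f)) * (1 - 3 * e + 5 * (e * f))).
  { apply Rmult_le_compat_r; lra. }
  assert (h3 : 0 < 1 - 5 * f - 10 / 3 * (f * (1 - 3 * e + 5 * (e * f)))).
  { assert (0 <= f * ((e - 2 * f) * (3 - 5 * f))) by (apply Rmult_le_pos; [lra|apply Rmult_le_pos; lra]).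
    assert (0 < (15 / 100 - f) * (f * f)) by (repeat apply Rmult_lt_0_compat; lra).
    pose proof (Rle_0_sqr (15 / 100 - f)) as h3. unfold Rsqr in h3. lra. }
  assert (h4 : 0 < e * f * (1 - 5 * f - 10 / 3 * (f * (1 - 3 * e + 5 * (e * f))))) by (apply Rmult_lt_0_compat; lra).
  lra.
Qed.

(** The second vertex bounds the larger of -p and -r, hence both, from above; with that bound the
    third vertex forces the lower one. The term 10/3 e f f is exactly what a neighbouring block with
    tau = 0, whose tail is below 10/3 f, can contribute. *)
Lemma ok8_two_bound d p r : 2 * f <= e -> eta_sixth_or_48 -> (1 - e) * (1 - 3 * f) <= d -> ok8 d 2 p r ->
  2 * f + 10 / 3 * (e * f * f) < - p < 5 * f /\ 2 * f + 10 / 3 * (e * f * f) < - r < 5 * f.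
Proof.
  intros hef hA hd.
  assert (G : forall p r, ok8 d 2 p r -> p <= r -> - p < 5 * f).
  { clear p r. intros p r [kp kr ktp ktr k1 k1' k2 k2' k3 k3' k4 k4'] hpr.
    apply two_upper; trivial. apply Rle_trans with (1 := hd). apply Rle_trans with (1 := k2).
    assert (e * p <= e * r) by (apply Rmult_le_compat_l; lra). apply Rle_trans with ((1 + f + p) * (1 - e + e * - p)).
    - apply Rmult_le_compat_l; lra.
    - lra. }
  assert (G' : forall p r, ok8 d 2 p r -> - p < 5 * f).
  { clear p r. intros p r ho. destruct (Rle_dec p r) as [h|h]; [now apply (G p r)|].
    pose proof (G r p (ok8_swap _ _ _ _ ho)). lra. }
  assert (H : forall p r, ok8 d 2 p r -> 2 * f + 10 / 3 * (e * f * f) < - p < 5 * f).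
  { clear p r. intros p r ho. split; [|now apply (G' p r)]. apply (two_lower (- p) (- r)); trivial.
    - destruct ho; lra.
    - apply (G' r p). now apply ok8_swap.
    - apply Rle_trans with (1 := hd). destruct ho as [kp kr ktp ktr k1 k1' k2 k2' k3 k3' k4 k4']. lra. }
  intros ho. split; [now apply (H p r)|]. apply (H r p). now apply ok8_swap.
Qed.

Definition linked (T tau tau' : Z) (p r p' r' : R) :=
  r = f * (IZR T + e * (IZR tau' + r')) /\ p' = f * (IZR T + e * (IZR tau + p)).

Lemma linked_sym T tau tau' p r p' r' : linked T tau tau' p r p' r' -> linked T tau' tau r' p' r p.
Proof. intros [h1 h2]. split; trivial. Qed.

Lemma even_cases (x : Z) : Z.Even x -> ((x <= -4)%Z \/ x = -2 \/ x = 0 \/ x = 2 \/ 4 <= x)%Z.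
Proof. intros [y ->]. lia. Qed.

Lemma tau_cases d tau p r : 2 * f <= e -> (1 - e) * (1 - 3 * f) <= d -> Z.Even tau -> ok8 d (IZR tau) p r ->
  (tau = -2 \/ tau = 0 \/ tau = 2)%Z.
Proof.
  intros hef hd he ho. destruct (even_cases tau he) as [h|[h|[h|[h|h]]]]; auto; exfalso.
  - apply ok8_neg in ho. apply IZR_le in h. apply (ok8_no_four d (- IZR tau) (- p) (- r)); trivial. lra.
  - apply IZR_le in h. apply (ok8_no_four d (IZR tau) p r); trivial.
Qed.

(** The bounds confine r / f = T + e (tau' + r') to a short interval. If tau' = 0, the lower bound
    on -r excludes T = -2, and T <= -4 pushes p' below -10/3 f; if tau' = -2, then T <= -2 gives p'
    the wrong sign. *)
Lemma two_neighbour d T tau' p r p' r' : 2 * f <= e -> eta_sixth_or_48 -> (1 - e) * (1 - 3 * f) <= d ->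
  Z.Even T -> Z.Even tau' -> linked T 2 tau' p r p' r' -> ok8 d 2 p r -> ok8 d (IZR tau') p' r' ->
  (T = -4 /\ tau' = 2)%Z.
Proof.
  intros hef hA hd hT ht [l1 l2] ho ho'.
  destruct (ok8_two_bound d p r hef hA hd ho) as [hp hr].
  assert (0 < e * f) by (apply Rmult_lt_0_compat; lra).
  assert (hf : f < 15 / 100) by lra.
  assert (hep : e * (- p) > 0) by (apply Rmult_lt_0_compat; [lra|]; assert (0 < e * f * f) by (apply Rmult_lt_0_compat; lra); lra).
  assert (hTs : IZR T < 0 -> (T <= -2)%Z).
  { intros h. apply lt_IZR in h. destruct hT as [x ->]. lia. }
  destruct (tau_cases d tau' p' r' hef hd ht ho') as [E|[E|E]]; subst tau'.
  - exfalso. apply ok8_neg in ho'. replace (- IZR (-2)) with 2 in ho' by (rewrite <- opp_IZR; reflexivity).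
    destruct (ok8_two_bound d _ _ hef hA hd ho') as [hp' hr']. rewrite Ropp_involutive in *.
    assert (IZR T < 0).
    { apply Rmult_lt_reg_l with f; [lra|]. assert (0 < f * e * r') by (repeat apply Rmult_lt_0_compat; nra).
      rewrite l1 in hr. assert (f * e < f) by nra. nra. }
    apply hTs, IZR_le in H0. rewrite l2 in hp'. nra.
  - exfalso. destruct (ok8_zero_bound d p' r' hd ho') as [hp' hr']. apply Rabs_def2 in hp', hr'.
    assert (e * (- r') < e * (10 / 3 * f)) by (apply Rmult_lt_compat_l; lra).
    assert (h2 : IZR T < -2).
    { apply Rmult_lt_reg_l with f; [lra|]. rewrite l1 in hr.
      assert (f * (e * - r') < f * (e * (10 / 3 * f))) by (apply Rmult_lt_compat_l; lra). lra. }
    apply (lt_IZR T (-2)) in h2. assert (h3 : (T <= -4)%Z) by (destruct hT as [x ->]; lia).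
    apply IZR_le in h3. rewrite l2 in hp'.
    assert (f * (IZR T + e * (2 + p)) < f * (- 10 / 3)) by (apply Rmult_lt_compat_l; lra). lra.
  - split; trivial. destruct (ok8_two_bound d _ _ hef hA hd ho') as [hp' hr'].
    assert (h1 : e * (- r') < 2 * e) by (rewrite (Rmult_comm 2); apply Rmult_lt_compat_l; lra).
    assert (h2 : IZR T < -2).
    { apply Rmult_lt_reg_l with f; [lra|]. rewrite l1 in hr.
      assert (f * (e * - r') < f * (2 * e)) by (apply Rmult_lt_compat_l; lra).
      assert (0 < e * f * f) by (apply Rmult_lt_0_compat; lra). lra. }
    assert (h3 : -6 < IZR T).
    { apply Rmult_lt_reg_l with f; [lra|]. rewrite l1 in hr.
      assert (0 < f * (e * - r')).
      { repeat apply Rmult_lt_0_compat; try lra. assert (0 < e * f * f) by (apply Rmult_lt_0_compat; lra). lra. }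
      assert (f * (2 * e) < f * 1) by (apply Rmult_lt_compat_l; lra). lra. }
    apply (lt_IZR T (-2)) in h2. apply (lt_IZR (-6)) in h3. destruct hT as [x ->]. lia.
Qed.

(** The case a = 4, b >= 10. With m the larger of -p and -r, the second vertex fails for m >=
    517/1000 and the third for smaller m; 517/1000 is a convenient point where the two ranges
    overlap. *)
Lemma a4_no_two d p r : 4 * e = 1 + e * f -> 10 * f <= 1 + e * f -> (1 - e) * (1 - 3 * f) <= d -> ok8 d 2 p r -> False.
Proof.
  intros h4 h10 hd.
  assert (hef : 0 < e * f) by (apply Rmult_lt_0_compat; lra).
  assert (hf : f < 1027 / 10000) by nra. assert (he : e < 2567 / 10000) by nra.
  assert (G : forall p r, ok8 d 2 p r -> p <= r -> False).
  { clear p r. intros p r [kp kr ktp ktr k1 k1' k2 k2' k3 k3' k4 k4'] hpr.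
    assert (he' : e * p <= e * r) by (apply Rmult_le_compat_l; lra).
    set (m := - p). destruct (Rle_dec (517 / 1000) m) as [hm|hm].
    - assert (h1 : (1 - e) * (1 - 3 * f) <= (1 + f - m) * (1 - e + e * m)).
      { apply Rle_trans with (1 := hd). apply Rle_trans with (1 := k2). unfold m.
        apply Rle_trans with ((1 + f + p) * (1 - e + e * - p)); [apply Rmult_le_compat_l|]; lra. }
      set (s := m - 517 / 1000). assert (hs : 0 <= s) by (unfold s; lra).
      replace m with (517 / 1000 + s) in h1 by (unfold s; ring).
      assert (0 <= s * (1 - 2 * e + 34 / 1000 * e - e * f + e + e * s)).
      { apply Rmult_le_pos; [lra|]. assert (0 <= e * s) by (apply Rmult_le_pos; lra). lra. }
      assert (0 <= (1027 / 10000 - f) * (4 - 3483 / 1000 * e)) by (apply Rmult_le_pos; lra). lra.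
    - assert (h1 : (1 - e) * (1 - 3 * f) <= (1 - f + m) * (1 - 3 * e + e * m)).
      { apply Rle_trans with (1 := hd). apply Rle_trans with (1 := k3). unfold m.
        apply Rle_trans with ((1 - f + - p) * (1 - 3 * e + e * - p)); [|lra].
        replace (1 - f + - p) with (1 - f - p) by ring. apply Rmult_le_compat_l; lra. }
      assert (h2 : (1 - f + m) * (1 - 3 * e + e * m) <= (1 - f + 517 / 1000) * (1 - 3 * e + e * (517 / 1000))).
      { apply Rmult_le_compat; unfold m in *; try lra.
        assert (e * - p <= e * (517 / 1000)) by (apply Rmult_le_compat_l; lra). lra. }
      assert (0 <= f * (e - 1 / 4)) by (apply Rmult_le_pos; lra). lra. }
  intros ho. destruct (Rle_dec p r); [apply (G p r)|apply (G r p)]; auto using ok8_swap. lra.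
Qed.

Definition delta_inf : R := (1 - e + 2 * (e * f) ^ 2 / (1 + e * f)) * (1 - f - 2 * f / (1 + e * f)).

Lemma delta_inf_lower : (1 - e) * (1 - 3 * f) <= delta_inf.
Proof.
  assert (hef : 0 < e * f) by (apply Rmult_lt_0_compat; lra).
  assert (hi : 0 < / (1 + e * f) <= 1).
  { split; [apply Rinv_0_lt_compat; lra|]. rewrite <- Rinv_1. apply Rinv_le_contravar; lra. }
  unfold delta_inf, Rdiv. apply Rmult_le_compat; try lra.
  - assert (0 <= 2 * (e * f) ^ 2 * / (1 + e * f)); [|lra]. apply Rmult_le_pos; [|lra].
    assert (0 < (e * f) ^ 2) by (apply pow_lt; lra). lra.
  - assert (2 * f * / (1 + e * f) <= 2 * f * 1) by (apply Rmult_le_compat_l; lra). lra.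
Qed.

(** The leading part of the difference is 2 e - 6 f + 10 D. It is at least 2 D because 3 f - e <= 4
    D, which is the range b >= 3 a - 4. *)
Lemma c4_excluded P Q : 2 * f <= e -> (3 * f - e) <= 4 * (e * f) -> 6 * e <= 1 + e * f ->
  P <= 4 * f - 2 * (e * f) + 5 * f * (e * f) -> Q <= 4 * f - 2 * (e * f) + 5 * f * (e * f) ->
  0 <= 1 - f + P -> 0 <= 1 - 3 * e + e * Q ->
  (1 - f + P) * (1 - 3 * e + e * Q) < (1 - e) * (1 - 3 * f).
Proof.
  intros hef h3 h6 hP hQ h1 h2.
  assert (hD : 0 < e * f) by (apply Rmult_lt_0_compat; lra).
  assert (he : e < 172 / 1000) by nra.
  set (D := e * f) in *. set (m := 4 * f - 2 * D + 5 * f * D) in *.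
  assert (hm : e * Q <= e * m) by (apply Rmult_le_compat_l; lra).
  assert (h4 : (1 - f + P) * (1 - 3 * e + e * Q) <= (1 - f + m) * (1 - 3 * e + e * m)) by (apply Rmult_le_compat; lra).
  assert (h5 : (1 - e) * (1 - 3 * f) - (1 - f + m) * (1 - 3 * e + e * m)
    = 2 * e - 6 * f + 10 * D - 17 * f * D - 4 * e * D + 24 * D * D - 35 * f * D * D - 4 * e * D * D + 20 * D * D * D - 25 * f * D * D * D)
    by (unfold m, D; ring).
  assert (hD2 : D <= 172 / 1000 * f) by (unfold D; apply Rmult_le_compat_r; lra).
  assert (g1 : 0 < D * (2 - 17 * f - 4 * e + 20 * D)) by (apply Rmult_lt_0_compat; lra).
  assert (g2 : 0 < D * D * (4 - 35 * f - 4 * e)) by (repeat apply Rmult_lt_0_compat; lra).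
  assert (g3 : 0 < D * D * D * (20 - 25 * f)) by (repeat apply Rmult_lt_0_compat; lra).
  lra.
Qed.

(** For (4, 8) the margin is small: the tails are bounded one step further than in [c4_excluded],
    and f, a root of f^2 = 4 f - 1/2, is located to eight decimals. *)
Lemma c4_excluded_48 P Q : 4 * e = 1 + e * f -> e = 2 * f ->
  P <= 4 * f - 2 * (e * f) + e * f * (4 * f - 2 * (e * f) + 5 * f * (e * f)) ->
  Q <= 4 * f - 2 * (e * f) + e * f * (4 * f - 2 * (e * f) + 5 * f * (e * f)) ->
  0 <= 1 - f + P -> 0 <= 1 - 3 * e + e * Q ->
  (1 - f + P) * (1 - 3 * e + e * Q) < delta_inf.
Proof.
  intros h4 he hP hQ h1 h2.
  assert (hff : e * f = 8 * f - 1) by lra.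
  assert (hsq : f * f = 4 * f - 1 / 2) by (rewrite he in hff; lra).
  assert (hf : 12917130 / 100000000 < f < 12917131 / 100000000) by (split; nra).
  rewrite hff in *. rewrite he in h2 |- *.
  assert (hm : 4 * f - 2 * (8 * f - 1) + (8 * f - 1) * (4 * f - 2 * (8 * f - 1) + 5 * f * (8 * f - 1)) <= 46570 / 100000).
  { replace (4 * f - 2 * (8 * f - 1) + (8 * f - 1) * (4 * f - 2 * (8 * f - 1) + 5 * f * (8 * f - 1)))
      with (320 * f * (f * f) - 176 * (f * f) + 21 * f) by ring.
    rewrite hsq. replace (320 * f * (4 * f - 1 / 2)) with (1280 * (f * f) - 160 * f) by field. rewrite hsq. lra. }
  set (m := 46570 / 100000) in *.
  assert (hq : 2 * f * Q <= 2 * f * m) by (apply Rmult_le_compat_l; lra).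
  apply Rle_lt_trans with ((1 - f + m) * (1 - 3 * (2 * f) + 2 * f * m)); [apply Rmult_le_compat; lra|].
  unfold delta_inf. rewrite hff, he.
  replace (1 + (8 * f - 1)) with (8 * f) by ring.
  replace (2 * f / (8 * f)) with (1 / 4) by (field; lra).
  replace ((8 * f - 1) ^ 2) with (64 * (f * f) - 16 * f + 1) by ring. rewrite hsq.
  assert (hi : / (12917131 / 100000000) <= / f) by (apply Rinv_le_contravar; lra).
  apply Rlt_le_trans with ((1 - 2 * f + 2 * (64 * (4 * f - 1 / 2) - 16 * f + 1) / 8 * / (12917131 / 100000000)) * (1 - f - 1 / 4)).
  - unfold m. assert (f * f > 12917130 / 100000000 * (12917130 / 100000000)) by nra. nra.
  - apply Rmult_le_compat_r; [lra|]. apply Rplus_le_compat_l.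
    replace (2 * (64 * (4 * f - 1 / 2) - 16 * f + 1) / (8 * f)) with (2 * (64 * (4 * f - 1 / 2) - 16 * f + 1) / 8 * / f) by (field; lra).
    apply Rmult_le_compat_l; lra.
Qed.

Definition tail_ok (d : R) (K : nat) (tau T : nat -> Z) (p r : nat -> R) : Prop :=
  (forall i, Z.Even (tau i)) /\ (forall i, Z.Even (T i)) /\ block_traj e f tau T p r /\
  forall i, (K <= i)%nat -> ok8 d (IZR (tau i)) (p i) (r i).

Definition zneg (s : nat -> Z) (i : nat) : Z := (- s i)%Z.
Definition rneg (s : nat -> R) (i : nat) : R := - s i.

Lemma even_opp x : Z.Even x -> Z.Even (- x).
Proof. intros [y ->]. exists (- y)%Z. lia. Qed.

Lemma tail_ok_neg d K tau T p r : tail_ok d K tau T p r -> tail_ok d K (zneg tau) (zneg T) (rneg p) (rneg r).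
Proof.
  intros (h1 & h2 & h3 & h4). unfold tail_ok, zneg, rneg. split; [|split; [|split]].
  - intros i. now apply even_opp.
  - intros i. now apply even_opp.
  - intros i. destruct (h3 i) as [q1 q2]. rewrite !opp_IZR. split; [rewrite q1|rewrite q2]; ring.
  - intros i hi. rewrite opp_IZR. apply ok8_neg. auto.
Qed.

Lemma tail_ok_linked d K tau T p r i : tail_ok d K tau T p r ->
  linked (T i) (tau i) (tau (S i)) (p i) (r i) (p (S i)) (r (S i)).
Proof. intros (_ & _ & h & _). destruct (h i). split; trivial. Qed.

Lemma two_stays d K tau T p r i : 2 * f <= e -> eta_sixth_or_48 -> (1 - e) * (1 - 3 * f) <= d ->
  tail_ok d K tau T p r -> (K <= i)%nat -> tau i = 2%Z -> forall j, (i <= j)%nat -> tau j = 2%Z /\ T j = (-4)%Z.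
Proof.
  intros hef hA hd HT hi h2.
  assert (Hstep : forall j, (K <= j)%nat -> tau j = 2%Z -> T j = (-4)%Z /\ tau (S j) = 2%Z).
  { intros j hj E. pose proof (tail_ok_linked _ _ _ _ _ _ j HT) as hl. destruct HT as (e1 & e2 & _ & ho).
    rewrite E in hl.
    apply (two_neighbour d (T j) (tau (S j)) (p j) (r j) (p (S j)) (r (S j))); auto.
    pose proof (ho j hj) as hh. rewrite E in hh. exact hh. }
  assert (H : forall j, (i <= j)%nat -> tau j = 2%Z).
  { induction 1 as [|j hj IH]; trivial. apply Hstep; trivial. lia. }
  intros j hj. split; [auto|]. apply Hstep; [lia|auto].
Qed.

Lemma two_classify d K tau T p r i : 2 * f <= e -> delta_inf < d ->
  6 * e <= 1 + e * f \/ (4 * e = 1 + e * f /\ (e = 2 * f \/ 10 * f <= 1 + e * f)) ->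
  6 * (e * f) <= (3 * f - e) * (1 + e * f) \/ (3 * f - e) * (1 + e * f) <= 4 * (e * f) ->
  tail_ok d K tau T p r -> (K <= i)%nat -> tau i = 2%Z ->
  (forall j, (i <= j)%nat -> tau j = 2%Z /\ T j = (-4)%Z) /\
  6 * e <= 1 + e * f /\ 6 * (e * f) <= (3 * f - e) * (1 + e * f).
Proof.
  intros hef hd hA hB HT hi h2.
  assert (hD : 0 < e * f) by (apply Rmult_lt_0_compat; lra).
  pose proof delta_inf_lower as hdl.
  assert (hd' : (1 - e) * (1 - 3 * f) <= d) by lra.
  pose proof HT as (e1 & e2 & HB & ho).
  assert (h10 : ~ (4 * e = 1 + e * f /\ 10 * f <= 1 + e * f)).
  { intros [q1 q2]. pose proof (ho i hi) as hh. rewrite h2 in hh. now apply (a4_no_two d (p i) (r i)). }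
  assert (hA' : eta_sixth_or_48) by (unfold eta_sixth_or_48; tauto).
  pose proof (two_stays d K tau T p r i hef hA' hd' HT hi h2) as Hst.
  split; trivial.
  assert (Hb : forall j, (i <= j)%nat -> 0 <= - p j <= 5 * f /\ 0 <= - r j <= 5 * f).
  { intros j hj. destruct (Hst j hj) as [t1 t2]. pose proof (ho j ltac:(lia)) as hh. rewrite t1 in hh.
    destruct (ok8_two_bound d _ _ hef hA' hd' hh). assert (0 < e * f * f) by (apply Rmult_lt_0_compat; lra). lra. }
  assert (Hp : forall j, (i <= j)%nat -> - p (S j) = 4 * f - 2 * (e * f) + e * f * - p j).
  { intros j hj. destruct (HB j) as [q _]. destruct (Hst j hj) as [t1 t2]. rewrite q, t1, t2. ring. }
  assert (Hr : forall j, (i <= j)%nat -> - r j = 4 * f - 2 * (e * f) + e * f * - r (S j)).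
  { intros j hj. destruct (HB j) as [_ q]. destruct (Hst j hj) as [t1 t2]. destruct (Hst (S j) ltac:(lia)) as [t3 t4].
    rewrite q, t3, t2. ring. }
  assert (Hc : forall j, (i <= j)%nat -> d <= (1 - f + - p j) * (1 - 3 * e + e * - r j) /\
                0 <= 1 - f + - p j /\ 0 <= 1 - 3 * e + e * - r j).
  { intros j hj. destruct (Hst j hj) as [t1 t2]. pose proof (ho j ltac:(lia)) as hh. rewrite t1 in hh.
    destruct hh as [kp kr ktp ktr k1 k1' k2 k2' k3 k3' k4 k4']. lra. }
  (* One step of the recursion applied to the crude bound 5 f. This suffices for a >= 6; for (4, 8)
     it is applied a second time. *)
  set (m1 := 4 * f - 2 * (e * f) + 5 * f * (e * f)).
  assert (Hm1 : forall j, (S i <= j)%nat -> - p j <= m1 /\ - r j <= m1).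
  { intros j hj. destruct j as [|j]; [lia|]. rewrite Hp by lia. rewrite (Hr (S j)) by lia.
    destruct (Hb j ltac:(lia)) as [b1 _]. destruct (Hb (S (S j)) ltac:(lia)) as [_ b2].
    assert (e * f * - p j <= e * f * (5 * f)) by (apply Rmult_le_compat_l; lra).
    assert (e * f * - r (S (S j)) <= e * f * (5 * f)) by (apply Rmult_le_compat_l; lra). unfold m1. lra. }
  destruct hA as [hA|[hA1 [hA2|hA2]]]; [| |exfalso; auto].
  - split; trivial. destruct hB as [hB|hB]; trivial. exfalso.
    assert (h34 : 3 * f - e <= 4 * (e * f)).
    { destruct (Rle_dec (3 * f - e) 0); [lra|].
      assert (0 <= (3 * f - e) * (e * f)) by (apply Rmult_le_pos; lra). lra. }
    destruct (Hm1 (S i) ltac:(lia)) as [m2 m3]. destruct (Hc (S i) ltac:(lia)) as (c1 & c2 & c3).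
    pose proof (c4_excluded (- p (S i)) (- r (S i)) hef h34 hA m2 m3 c2 c3). lra.
  - exfalso. destruct (Hm1 (S i) ltac:(lia)) as [m2 _]. destruct (Hm1 (S (S (S i))) ltac:(lia)) as [_ m3].
    destruct (Hc (S (S i)) ltac:(lia)) as (c1 & c2 & c3).
    assert (m4 : - p (S (S i)) <= 4 * f - 2 * (e * f) + e * f * m1).
    { rewrite Hp by lia. apply Rplus_le_compat_l. apply Rmult_le_compat_l; lra. }
    assert (m5 : - r (S (S i)) <= 4 * f - 2 * (e * f) + e * f * m1).
    { rewrite Hr by lia. apply Rplus_le_compat_l. apply Rmult_le_compat_l; lra. }
    pose proof (c4_excluded_48 (- p (S (S i))) (- r (S (S i))) hA1 hA2 m4 m5 c2 c3). lra.
Qed.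

(* The conditions on a tail with [tau = 0] throughout; [u = p / f] and [w = r / f] are
   expansions of [T] in base [D]. *)
Definition zero_tail (d : R) (K : nat) (T : nat -> Z) (u w : nat -> R) : Prop :=
  (forall i, (K <= i)%nat -> T i = -2 \/ T i = 0 \/ T i = 2)%Z /\
  (forall i, (K <= i)%nat -> u (S i) = IZR (T i) + e * f * u i /\ w i = IZR (T i) + e * f * w (S i)) /\
  (forall i, (K <= i)%nat -> Rabs (u i) < 10 / 3 /\ Rabs (w i) < 10 / 3) /\
  forall i, (K <= i)%nat ->
    d <= (1 - f - f * u i) * (1 - e - e * f * w i) /\ d <= (1 - f - f * w i) * (1 - e - e * f * u i) /\
    d <= (1 - f + f * u i) * (1 - e + e * f * w i) /\ d <= (1 - f + f * w i) * (1 - e + e * f * u i).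

Lemma tail_zero_tail d K tau T p r : (1 - e) * (1 - 3 * f) <= d -> tail_ok d K tau T p r ->
  (forall i, (K <= i)%nat -> tau i = 0%Z) -> zero_tail d K T (fun i => p i / f) (fun i => r i / f).
Proof.
  intros hd (h1 & h2 & HB & ho) H0.
  assert (hD : 0 < e * f < 9 / 100) by (split; nra).
  assert (Hr : forall i, (K <= i)%nat -> p (S i) / f = IZR (T i) + e * f * (p i / f) /\ r i / f = IZR (T i) + e * f * (r (S i) / f)).
  { intros i hi. destruct (HB i) as [q1 q2]. rewrite q1, q2, (H0 i), (H0 (S i)) by lia. split; field; lra. }
  assert (ho0 : forall i, (K <= i)%nat -> ok8 d 0 (p i) (r i)).
  { intros i hi. specialize (ho i hi). rewrite H0 in ho by trivial. exact ho. }
  assert (hb : forall i, (K <= i)%nat -> Rabs (p i / f) < 10 / 3 /\ Rabs (r i / f) < 10 / 3).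
  { intros i hi. destruct (ok8_zero_bound d (p i) (r i) hd (ho0 i hi)) as [b1 b2].
    unfold Rdiv. rewrite !Rabs_mult, !(Rabs_right (/ f)) by (apply Rle_ge; left; apply Rinv_0_lt_compat; lra).
    split; apply Rmult_lt_reg_r with f; try lra; rewrite Rmult_assoc, Rinv_l; lra. }
  split; [|split; [trivial|split; [trivial|]]].
  - intros i hi. destruct (Hr i hi) as [q _]. destruct (hb i hi) as [b1 _]. destruct (hb (S i) ltac:(lia)) as [b2 _].
    assert (h3 : e * f * Rabs (p i / f) <= 9 / 100 * (10 / 3)) by (apply Rmult_le_compat; try lra; apply Rabs_pos).
    rewrite <- (Rabs_right (e * f)), <- Rabs_mult in h3 by lra. apply Rabs_le_between in h3. apply Rabs_def2 in b2.
    assert (g1 : -4 < IZR (T i)) by lra. assert (g2 : IZR (T i) < 4) by lra. apply (lt_IZR (-4)) in g1. apply (lt_IZR _ 4) in g2.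
    destruct (h2 i) as [x hx]. lia.
  - intros i hi. destruct (ho0 i hi) as [kp kr ktp ktr k1 k1' k2 k2' k3 k3' k4 k4'].
    replace (f * (p i / f)) with (p i) by (field; lra). replace (f * (r i / f)) with (r i) by (field; lra).
    replace (e * f * (p i / f)) with (e * p i) by (field; lra). replace (e * f * (r i / f)) with (e * r i) by (field; lra).
    rewrite !Rplus_0_l in *. lra.
Qed.

Lemma zero_tail_neg d K T u w : zero_tail d K T u w -> zero_tail d K (zneg T) (rneg u) (rneg w).
Proof.
  intros (h1 & h2 & h3 & h4). unfold zero_tail, zneg, rneg. split; [|split; [|split]]; intros i hi.
  - specialize (h1 i hi). lia.
  - destruct (h2 i hi) as [q1 q2]. rewrite opp_IZR. lra.
  - rewrite !Rabs_Ropp. auto.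
  - specialize (h4 i hi). lra.
Qed.

Definition alt_word (i : nat) : Z := if Nat.even i then 2%Z else (-2)%Z.
(** The letters T of A_0 (A_2 A'_2)^k repeated; [alt_word] is the same for A_2 A'_2. *)
Definition gap_word (k i : nat) : Z :=
  let m := (i mod (2 * k + 1))%nat in
  if Nat.eqb m 0 then 0%Z else if Nat.odd m then 2%Z else (-2)%Z.

Lemma least_nat (P : nat -> Prop) : (exists n, P n) -> exists n, P n /\ forall m, (m < n)%nat -> ~ P m.
Proof.
  intros [n hn]. revert hn. induction n as [n IH] using lt_wf_ind. intros hn.
  destruct (classic (exists m, (m < n)%nat /\ P m)) as [[m [h1 h2]]|h].
  - now apply (IH m).
  - exists n. split; trivial. intros m hm hP. apply h. now exists m.
Qed.

(** * Words with tau = 0: alternating runs between isolated zeros *)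

Section ZeroTail.

Context (f18 : f < 18 / 100) (e32 : 3 * f <= 2 * e).

Let D := e * f.
(** The fixed point of t -> 2 - D t, that is, the tail of the alternating word in units of f. *)
Let w0 := 2 / (1 + D).

Lemma D_facts : 0 < D /\ D < 48 / 1000 /\ e < 264 / 1000 /\ D = e * f.
Proof.
  assert (0 < D) by (apply Rmult_lt_0_compat; lra). assert (he : e < 264 / 1000) by (unfold D in *; nra).
  repeat split; trivial. unfold D. nra.
Qed.

Lemma w0_facts : w0 * (1 + D) = 2 /\ 19 / 10 < w0 < 2.
Proof.
  destruct D_facts as (h & h1 & _). assert (E : w0 * (1 + D) = 2) by (unfold w0; field; lra).
  split; trivial. nra.
Qed.

Lemma delta_inf_w0 : delta_inf = (1 - f - f * w0) * (1 - e + D * D * w0).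
Proof. unfold delta_inf, w0. fold D. field. destruct D_facts. lra. Qed.

(** Between two equal letters both tails are close to 2 with the same sign, so the third vertex
    product is about (1 - 3 f)(1 - e - 2 D), below the lower bound (1 - e)(1 - 3 f) of
    [delta_inf]. *)
Lemma zero_no_double d K T u w i : delta_inf < d -> zero_tail d K T u w -> (K <= i)%nat ->
  T i = 2%Z -> T (S i) = 2%Z -> False.
Proof.
  intros hd (h1 & h2 & h3 & h4) hi t1 t2. destruct D_facts as (D0 & D1 & he & _).
  destruct (h2 i hi) as [q1 _]. destruct (h2 (S i) ltac:(lia)) as [_ q2].
  destruct (h3 i hi) as [b1 _]. destruct (h3 (S (S i)) ltac:(lia)) as [_ b2].
  destruct (h4 (S i) ltac:(lia)) as [c _]. rewrite t1 in q1. rewrite t2 in q2. fold D in q1, q2, c.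
  apply Rabs_def2 in b1, b2.
  assert (hu : 2 - 10 / 3 * D <= u (S i)) by nra. assert (hw : 2 - 10 / 3 * D <= w (S i)) by nra.
  pose proof delta_inf_lower as hl.
  assert (hDw : D * (2 - 10 / 3 * D) <= D * w (S i)) by (apply Rmult_le_compat_l; lra).
  assert (hfu : f * (2 - 10 / 3 * D) <= f * u (S i)) by (apply Rmult_le_compat_l; lra).
  assert (hDw' : D * w (S i) <= D * (10 / 3)).
  { apply Rmult_le_compat_l; [lra|]. destruct (h3 (S i) ltac:(lia)) as [_ b3]. apply Rabs_def2 in b3. lra. }
  assert (c2 : (1 - f - f * u (S i)) * (1 - e - D * w (S i)) <= (1 - 3 * f + 10 / 3 * (f * D)) * (1 - e - 2 * D + 10 / 3 * D * D)).
  { apply Rle_trans with ((1 - 3 * f + 10 / 3 * (f * D)) * (1 - e - D * w (S i))).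
    - apply Rmult_le_compat_r; lra.
    - apply Rmult_le_compat_l; [|lra]. assert (0 <= f * D) by (apply Rmult_le_pos; lra). lra. }
  assert (g : 0 < D * ((1 - 3 * f) * (2 - 10 / 3 * D) - 10 / 3 * f * (1 - e))).
  { apply Rmult_lt_0_compat; [lra|].
    assert ((1 - 3 * f) * (2 - 10 / 3 * D) >= 46 / 100 * (184 / 100)).
    { apply Rle_ge, Rmult_le_compat; lra. }
    assert (f * (1 - e) <= 18 / 100 * 1) by (apply Rmult_le_compat; lra). lra. }
  assert (0 <= f * D * (D * (2 - 10 / 3 * D))).
  { repeat apply Rmult_le_pos; lra. }
  lra.
Qed.

(** At the zero the right tail is -2 D or so when the next letter is -2, but at least -10/3 D^2
    otherwise. The resulting loss is only of order D^2, so the tails and [delta_inf] are expanded up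
    to third order in D. *)
Lemma zero_then_opposite d K T u w n : delta_inf < d -> zero_tail d K T u w -> (K + 2 <= n)%nat ->
  T n = 2%Z -> T (S n) = 0%Z -> T (S (S n)) = (-2)%Z.
Proof.
  intros hd HZ hn t1 t2. pose proof HZ as (h1 & h2 & h3 & h4). destruct D_facts as (D0 & D1 & he & _).
  destruct (h1 (S (S n)) ltac:(lia)) as [t|t]; trivial. exfalso.
  assert (ht : 0 <= IZR (T (S (S n)))) by (apply IZR_le; lia).
  assert (hDD : 0 < D * D < 48 / 1000 * D) by nra.
  (* If the letter before n is -2, the one before that is not, by [zero_no_double]; looking back two
     letters is why n >= K + 2. *)
  assert (hu : - 2 - 10 / 3 * (D * D) <= u n).
  { destruct n as [|m]; [lia|]. destruct (h2 m ltac:(lia)) as [q _]. destruct (h3 m ltac:(lia)) as [b _].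
    apply Rabs_def2 in b. fold D in q.
    destruct (h1 m ltac:(lia)) as [tm|tm].
    - destruct m as [|l]; [lia|]. destruct (h2 l ltac:(lia)) as [q' _]. destruct (h3 l ltac:(lia)) as [b' _].
      apply Rabs_def2 in b'. fold D in q'.
      assert (htl : 0 <= IZR (T l)).
      { apply IZR_le. destruct (h1 l ltac:(lia)) as [tl|tl]; [exfalso|lia].
        apply (zero_no_double d K (zneg T) (rneg u) (rneg w) l hd (zero_tail_neg _ _ _ _ _ HZ)); unfold zneg; lia. }
      rewrite q, tm. nra.
    - rewrite q. assert (0 <= IZR (T m)) by (apply IZR_le; lia). nra. }
  destruct (h2 n ltac:(lia)) as [q1 _]. destruct (h2 (S n) ltac:(lia)) as [_ q2].
  destruct (h2 (S (S n)) ltac:(lia)) as [_ q3]. destruct (h3 (S (S (S n))) ltac:(lia)) as [_ b].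
  apply Rabs_def2 in b. rewrite t1 in q1. rewrite t2 in q2. fold D in q1, q2, q3.
  destruct (h4 (S n) ltac:(lia)) as [c _]. fold D in c.
  assert (hu' : 2 - 2 * D - 10 / 3 * (D * D * D) <= u (S n)) by nra.
  assert (hw : - (10 / 3) * (D * D) <= w (S n)) by nra.
  assert (hfu : f * (2 - 2 * D - 10 / 3 * (D * D * D)) <= f * u (S n)) by (apply Rmult_le_compat_l; lra).
  assert (hDw : D * (- (10 / 3) * (D * D)) <= D * w (S n)) by (apply Rmult_le_compat_l; lra).
  set (D3 := D * D * D) in *.
  assert (hD3 : 0 < D3 < 48 / 1000 * (D * D)).
  { unfold D3. split; [repeat apply Rmult_lt_0_compat; lra|].
    rewrite (Rmult_comm (D * D)). apply Rmult_lt_compat_r; lra. }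
  assert (hfD3 : 0 < f * D3 < 18 / 100 * D3).
  { split; [apply Rmult_lt_0_compat|apply Rmult_lt_compat_r]; lra. }
  assert (c2 : (1 - f - f * u (S n)) * (1 - e - D * w (S n)) <=
    (1 - 3 * f + 2 * (f * D) + 10 / 3 * (f * D3)) * (1 - e + 10 / 3 * D3)).
  { destruct (h3 (S n) ltac:(lia)) as [b3 b4]. apply Rabs_def2 in b3, b4.
    assert (f * u (S n) <= f * (10 / 3)) by (apply Rmult_le_compat_l; lra).
    assert (D * w (S n) <= D * (10 / 3)) by (apply Rmult_le_compat_l; lra).
    fold D3 in hDw. unfold D3 in *.
    apply Rmult_le_compat; lra. }
  assert (hlow : (1 - 3 * f + 2 * (f * D) - 2 * (f * (D * D))) * (1 - e + 2 * (D * D) - 2 * D3) <= delta_inf).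
  { destruct w0_facts as [E1 E2]. rewrite delta_inf_w0.
    assert (e0 : w0 = 2 - D * w0) by lra.
    assert (e1 : w0 = 2 - 2 * D + 2 * (D * D) - D3 * w0).
    { rewrite e0 at 1. replace (D * w0) with (D * (2 - D * (2 - D * w0))) by (rewrite <- e0; rewrite <- e0; reflexivity).
      unfold D3. ring. }
    assert (0 < D3 * w0) by (apply Rmult_lt_0_compat; lra).
    assert (f * w0 <= f * (2 - 2 * D + 2 * (D * D))) by (apply Rmult_le_compat_l; lra).
    assert (D3 * w0 <= D3 * 2) by (apply Rmult_le_compat_l; lra).
    assert (2 - 2 * D <= w0) by lra.
    assert (D * D * (2 - 2 * D) <= D * D * w0) by (apply Rmult_le_compat_l; lra).
    assert (0 <= f * D) by (apply Rmult_le_pos; lra).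
    assert (f * (D * D) <= 18 / 100 * (D * D)) by (apply Rmult_le_compat_r; lra).
    apply Rmult_le_compat; unfold D3 in *; lra. }
  assert (hB : 46 / 100 <= 1 - 3 * f + 2 * (f * D)) by (assert (0 <= f * D) by (apply Rmult_le_pos; lra); lra).
  set (B := 1 - 3 * f + 2 * (f * D)) in *.
  assert (g1 : B * (2 * (D * D) - 16 / 3 * D3) >= 46 / 100 * (2 * (D * D) - 16 / 3 * D3)) by (apply Rle_ge, Rmult_le_compat_r; lra).
  assert (g2 : (1 - e) * (2 * (f * (D * D)) + 10 / 3 * (f * D3)) <= 1 * (2 * (f * (D * D)) + 10 / 3 * (f * D3))).
  { apply Rmult_le_compat_r; [|lra]. assert (0 <= f * (D * D)) by (apply Rmult_le_pos; lra). lra. }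
  assert (g3 : f * (D * D) <= 18 / 100 * (D * D)) by (apply Rmult_le_compat_r; lra).
  assert (g4 : 2 * (f * (D * D)) * (2 * (D * D) - 2 * D3) <= 2 * (18 / 100 * (D * D)) * (1 / 100)).
  { assert (0 <= f * (D * D)) by (apply Rmult_le_pos; lra). apply Rmult_le_compat; lra. }
  assert (g5 : (10 / 3 * (f * D3)) * (10 / 3 * D3) <= (10 / 3 * (18 / 100 * D3)) * (1 / 100)).
  { apply Rmult_le_compat; lra. }
  assert (0 < D * D) by lra. lra.
Qed.

(** X and Y are the deviations of the two tails from [w0]. Expanded, the inequalities bound D^2 Y al
    by about f X ga, and symmetrically. As D^2 is small against f, neither deviation can be
    nonpositive; and since D^2 / f = e D and ga <= 2 al, each exceeds e D / 2 times the other. *)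
Lemma deviation_bounds d X Y : delta_inf < d -> X < w0 -> Y < w0 -> - 2 < X -> - 2 < Y ->
  d <= (1 - f - f * (w0 - X)) * (1 - e + D * D * (w0 - Y)) ->
  d <= (1 - f - f * (w0 - Y)) * (1 - e + D * D * (w0 - X)) ->
  0 < X /\ 0 < Y /\ 1 / 2 * (e * D) * Y < X /\ 1 / 2 * (e * D) * X < Y.
Proof.
  intros hd hX hY hX' hY' c1 c2. destruct D_facts as (D0 & D1 & he & eD). destruct w0_facts as [E1 E2].
  rewrite delta_inf_w0 in hd.
  set (al := 1 - f - f * w0) in *. set (ga := 1 - e + D * D * w0) in *.
  assert (hDD : 0 < D * D < 3 / 1000).
  { split; [apply Rmult_lt_0_compat; lra|]. apply Rle_lt_trans with (48 / 1000 * (48 / 1000)); [|lra].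
    apply Rmult_le_compat; lra. }
  assert (hDe : D * D < e).
  { apply Rle_lt_trans with (D * 1); [apply Rmult_le_compat_l; lra|]. rewrite Rmult_1_r, eD.
    apply Rlt_le_trans with (e * 1); [apply Rmult_lt_compat_l|]; lra. }
  assert (hfw : 0 < f * w0 <= f * 2) by (split; [apply Rmult_lt_0_compat|apply Rmult_le_compat_l]; lra).
  assert (hDw : 0 < D * D * w0 <= D * D * 2) by (split; [apply Rmult_lt_0_compat|apply Rmult_le_compat_l]; lra).
  assert (hal : 0 < al < 1) by (unfold al; lra).
  assert (hga : 7 / 10 < ga < 1).
  { unfold ga. assert (D * D * 2 < e); [|lra]. rewrite eD at 1.
    replace (e * f * D * 2) with (e * (f * D * 2)) by ring. rewrite <- (Rmult_1_r e) at 2.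
    apply Rmult_lt_compat_l; [lra|]. assert (f * D <= 1 * D) by (apply Rmult_le_compat_r; lra). lra. }
  assert (hag : ga <= 2 * al).
  { unfold al, ga. assert (f * w0 <= f * 2) by (apply Rmult_le_compat_l; lra).
    assert (D * D * w0 <= D * D * 2) by (apply Rmult_le_compat_l; lra). lra. }
  replace (1 - f - f * (w0 - X)) with (al + f * X) in c1 by (unfold al; ring).
  replace (1 - f - f * (w0 - Y)) with (al + f * Y) in c2 by (unfold al; ring).
  replace (1 - e + D * D * (w0 - Y)) with (ga - D * D * Y) in c1 by (unfold ga; ring).
  replace (1 - e + D * D * (w0 - X)) with (ga - D * D * X) in c2 by (unfold ga; ring).
  assert (hDDf : D * D < f * e).
  { rewrite eD at 1. replace (e * f * D) with (f * e * D) by ring. rewrite <- (Rmult_1_r (f * e)) at 2.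
    apply Rmult_lt_compat_l; [apply Rmult_lt_0_compat|]; lra. }
  assert (key : forall X Y, X < w0 -> Y < w0 -> -2 < X -> -2 < Y -> al * ga < (al + f * X) * (ga - D * D * Y) ->
     D * D * Y * al < f * X * (ga - D * D * Y) /\ 0 < ga - D * D * Y).
  { clear - hDD hga D0 E2. intros X Y h1 h2 h3 h4 h. split; [lra|].
    assert (D * D * Y <= D * D * 2) by (apply Rmult_le_compat_l; lra). lra. }
  destruct (key X Y hX hY hX' hY' ltac:(lra)) as [k1 k2].
  destruct (key Y X hY hX hY' hX' ltac:(lra)) as [k3 k4]. clear key.
  assert (pos_one : 0 < X -> 0 < Y).
  { intros h. assert (0 < D * D * X * al) by (repeat apply Rmult_lt_0_compat; lra).
    apply Rnot_le_lt. intros hle. assert (0 <= f * - Y * (ga - D * D * X)) by (repeat apply Rmult_le_pos; lra). lra. }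
  assert (hXp : 0 < X).
  { apply Rnot_le_lt. intros hle.
    assert (hYn : Y < 0).
    { apply Rnot_le_lt. intros h. assert (0 <= D * D * Y * al) by (repeat apply Rmult_le_pos; lra).
      assert (0 <= f * - X * (ga - D * D * Y)) by (repeat apply Rmult_le_pos; lra). lra. }
    assert (q1 : f * - X * ga <= D * D * - Y * al).
    { assert (0 <= f * - X * (D * D * - Y)) by (repeat apply Rmult_le_pos; lra). lra. }
    assert (q2 : f * - Y * ga <= D * D * - X * al).
    { assert (0 <= f * - Y * (D * D * - X)) by (repeat apply Rmult_le_pos; lra). lra. }
    assert (q3 : D * D * al < f * ga).
    { assert (D * D * al <= D * D * 1) by (apply Rmult_le_compat_l; lra).
      assert (f * (7 / 10) < f * ga) by (apply Rmult_lt_compat_l; lra).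
      assert (f * e <= f * (264 / 1000)) by (apply Rmult_le_compat_l; lra). lra. }
    assert (0 < (f * ga - D * D * al) * (- X + - Y)) by (apply Rmult_lt_0_compat; lra). lra. }
  specialize (pos_one hXp).
  assert (fin : forall X Y, 0 < X -> 0 < Y -> D * D * Y * al < f * X * (ga - D * D * Y) -> 1 / 2 * (e * D) * Y < X).
  { clear k1 k2 k3 k4 c1 c2. intros X' Y' h1 h2 h.
    assert (0 < f * X' * (D * D * Y')) by (repeat apply Rmult_lt_0_compat; lra).
    assert (h3 : D * D * Y' * (ga / 2) <= D * D * Y' * al) by (apply Rmult_le_compat_l; [repeat apply Rmult_le_pos|]; lra).
    assert (h4 : (f * ga) * (1 / 2 * (e * D) * Y') < (f * ga) * X').
    { replace (f * ga * (1 / 2 * (e * D) * Y')) with (D * D * Y' * (ga / 2)) by (rewrite eD at 1; field). lra. }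
    apply Rmult_lt_reg_l with (2 := h4). apply Rmult_lt_0_compat; lra. }
  auto.
Qed.

Lemma zero_next d K T u w n s : delta_inf < d -> zero_tail d K T u w -> (K + 2 <= n)%nat ->
  (s = 1 \/ s = -1)%Z -> T n = (2 * s)%Z ->
  T (S n) = (-2 * s)%Z \/ (T (S n) = 0%Z /\ T (S (S n)) = (-2 * s)%Z).
Proof.
  intros hd HZ hn hs hT.
  assert (G : forall T u w, zero_tail d K T u w -> T n = 2%Z -> T (S n) = (-2)%Z \/ (T (S n) = 0%Z /\ T (S (S n)) = (-2)%Z)).
  { clear HZ hT. clear T u w. intros T u w HZ hT. pose proof HZ as (h1 & _).
    destruct (h1 (S n) ltac:(lia)) as [t|[t|t]]; auto.
    - right. split; trivial. now apply (zero_then_opposite d K T u w n).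
    - exfalso. apply (zero_no_double d K T u w n); trivial. lia. }
  destruct hs as [-> | ->].
  - apply (G T u w HZ hT).
  - assert (hz : zneg T n = 2%Z) by (unfold zneg; lia).
    specialize (G _ _ _ (zero_tail_neg _ _ _ _ _ HZ) hz). unfold zneg in G. lia.
Qed.

(** [sg n] is the sign of the next nonzero letter from n on, and x, y are the tails measured with
    that sign. Every nonzero letter then acts as t -> 2 - D t and every zero as t -> D t, on x
    forwards and on y backwards. *)
Definition alternating (d : R) (N : nat) (T sg : nat -> Z) (x y : nat -> R) : Prop :=
  forall n, (N <= n)%nat ->
    (sg n = 1 \/ sg n = -1)%Z /\
    ((T n = 0%Z /\ T (S n) <> 0%Z /\ sg (S n) = sg n /\ x (S n) = D * x n /\ y n = D * y (S n)) \/
     (T n = (2 * sg n)%Z /\ sg (S n) = (- sg n)%Z /\ x (S n) = 2 - D * x n /\ y n = 2 - D * y (S n))) /\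
    Rabs (x n) < 10 / 3 /\ Rabs (y n) < 10 / 3 /\
    (T n = 0%Z -> d <= (1 - f - f * x n) * (1 - e + D * (D * y (S n))) /\
                 d <= (1 - f - f * y (S n)) * (1 - e + D * (D * x n))).

Lemma alternating_exists d K T u w n0 : delta_inf < d -> zero_tail d K T u w -> (K + 2 <= n0)%nat ->
  T n0 <> 0%Z -> exists sg x y, alternating d (S n0) T sg x y.
Proof.
  intros hd HZ hn h0. pose proof HZ as (h1 & h2 & h3 & h4).
  assert (hs0 : exists s, (s = 1 \/ s = -1)%Z /\ T n0 = (2 * s)%Z).
  { destruct (h1 n0 ltac:(lia)) as [t|[t|t]]; [exists (-1)%Z|contradiction|exists 1%Z]; lia. }
  destruct hs0 as (s0 & hs0 & hT0).
  (* The sign flips at every nonzero letter; it starts at -s0 because letter n0 itself has sign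
     s0. *)
  set (q := fix q (i : nat) : Z := match i with O => (- s0)%Z | S i' => if (T (S n0 + i')%nat =? 0)%Z then q i' else (- q i')%Z end).
  set (sg := fun n => q (n - S n0)%nat).
  assert (hsg : forall n, (S n0 <= n)%nat -> sg (S n) = if (T n =? 0)%Z then sg n else (- sg n)%Z).
  { intros n h. unfold sg. replace (S n - S n0)%nat with (S (n - S n0)) by lia. simpl.
    replace (S (n0 + (n - S n0)))%nat with n by lia. reflexivity. }
  assert (hpm : forall n, (S n0 <= n)%nat -> (sg n = 1 \/ sg n = -1)%Z).
  { induction 1 as [|n hle IH].
    - unfold sg. rewrite Nat.sub_diag. simpl. lia.
    - rewrite hsg by trivial. destruct (T n =? 0)%Z; lia. }
  assert (HP : forall n, (S n0 <= n)%nat -> T n = (2 * sg n)%Z \/ (T n = 0%Z /\ T (S n) = (2 * sg n)%Z)).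
  { induction 1 as [|n hle IH].
    - unfold sg. rewrite Nat.sub_diag. simpl q.
      destruct (zero_next d K T u w n0 s0 hd HZ hn hs0 hT0); lia.
    - rewrite hsg by trivial. destruct IH as [IH|[IH1 IH2]].
      + specialize (hpm n hle). destruct (Z.eqb_spec (T n) 0); [lia|].
        destruct (zero_next d K T u w n (sg n) hd HZ ltac:(lia) hpm IH); lia.
      + rewrite IH1. simpl. now left. }
  exists sg, (fun n => - IZR (sg n) * u n), (fun n => IZR (sg n) * w n).
  intros n hle. specialize (hpm n hle). split; trivial. specialize (hsg n hle).
  destruct (h2 n ltac:(lia)) as [q1 q2]. destruct (h2 (S n) ltac:(lia)) as [q3 q4].
  destruct (h3 n ltac:(lia)) as [b1 b2]. fold D in q1, q2, q3, q4.
  assert (hsq : IZR (sg n) * IZR (sg n) = 1) by (destruct hpm as [-> | ->]; lra).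
  assert (hab : Rabs (- IZR (sg n)) = 1 /\ Rabs (IZR (sg n)) = 1).
  { destruct hpm as [-> | ->]; split; unfold Rabs; destruct Rcase_abs; lra. }
  split; [|split; [|split]].
  - destruct (HP n hle) as [E|[E1 E2]].
    + right. destruct (Z.eqb_spec (T n) 0); [lia|]. rewrite E, mult_IZR in q1, q2.
      split; [trivial|]. split; [trivial|]. rewrite hsg, opp_IZR. split.
      * rewrite q1. replace (- - IZR (sg n) * (2 * IZR (sg n) + D * u n)) with (2 * (IZR (sg n) * IZR (sg n)) - D * (- IZR (sg n) * u n)) by ring.
        rewrite hsq. ring.
      * rewrite q2. replace (IZR (sg n) * (2 * IZR (sg n) + D * w (S n))) with (2 * (IZR (sg n) * IZR (sg n)) - D * (- IZR (sg n) * w (S n))) by ring.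
        rewrite hsq. ring.
    + left. rewrite E1 in *. simpl in hsg. rewrite hsg. split; [trivial|]. split; [lia|]. split; [trivial|].
      rewrite q1, q2. split; ring.
  - rewrite Rabs_mult, (proj1 hab). lra.
  - rewrite Rabs_mult, (proj2 hab). lra.
  - intros E. rewrite E in *. simpl in hsg. rewrite hsg.
    destruct (h4 n ltac:(lia)) as (c1 & c2 & c3 & c4). destruct (h4 (S n) ltac:(lia)) as (c5 & c6 & c7 & c8).
    fold D in c1, c2, c3, c4, c5, c6, c7, c8. rewrite Rplus_0_l in q1, q2. rewrite q2 in c1, c3. rewrite q1 in c6, c8.
    destruct hpm as [-> | ->]; lra.
Qed.

Definition altsgn (m : nat) : Z := if Nat.even m then 1%Z else (-1)%Z.

Lemma altsgn_S m : altsgn (S m) = (- altsgn m)%Z.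
Proof. unfold altsgn. rewrite Nat.even_succ, <- Nat.negb_even. now destruct (Nat.even m). Qed.

Section Runs.

Context (d : R) (N : nat) (T sg : nat -> Z) (x y : nat -> R)
  (hd : delta_inf < d) (HA : alternating d N T sg x y).

(** The map t -> 2 - D t multiplies deviations from its fixed point [w0] by -D. *)
Lemma run_structure n l : (N <= n)%nat -> (forall m, (m < l)%nat -> T (n + m)%nat <> 0%Z) ->
  sg (n + l)%nat = (sg n * altsgn l)%Z /\ w0 - x (n + l)%nat = (- D) ^ l * (w0 - x n) /\
  w0 - y n = (- D) ^ l * (w0 - y (n + l)%nat).
Proof.
  intros hn. destruct w0_facts as [E _]. induction l as [|l IH]; intros H.
  - rewrite Nat.add_0_r. unfold altsgn; simpl. repeat split; ring.
  - destruct IH as (i1 & i2 & i3); [intros m hm; apply H; lia|].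
    destruct (HA (n + l)%nat ltac:(lia)) as (_ & [(q & _)|(q1 & q2 & q3 & q4)] & _); [destruct (H l ltac:(lia) q)|].
    replace (n + S l)%nat with (S (n + l)) by lia. rewrite q2, i1, altsgn_S. split; [ring|].
    simpl pow. rewrite i3. split.
    + rewrite q3. replace (w0 - (2 - D * x (n + l)%nat)) with (- D * (w0 - x (n + l)%nat)) by lra. rewrite i2. ring.
    + rewrite q4. replace (w0 - (2 - D * y (S (n + l)))) with (- D * (w0 - y (S (n + l)))) by lra. ring.
Qed.

(** Zeros are isolated, so both letters next to z are nonzero and the two tails lie between 0 and 3;
    this puts them in the range where [deviation_bounds] applies. *)
Lemma zero_deviation z : (S N <= z)%nat -> T z = 0%Z ->
  0 < w0 - x z < w0 /\ 0 < w0 - y (S z) < w0 /\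
  1 / 2 * (e * D) * (w0 - y (S z)) < w0 - x z /\ 1 / 2 * (e * D) * (w0 - x z) < w0 - y (S z).
Proof.
  intros hz h0. destruct D_facts as (D0 & D1 & he & eD). destruct w0_facts as [E1 E2].
  assert (hx : 0 < x z < 3).
  { destruct z as [|z]; [lia|].
    destruct (HA z ltac:(lia)) as (_ & [(q1 & q2 & _)|(_ & _ & q & _)] & b & _); [contradiction|].
    apply Rabs_def2 in b. rewrite q.
    assert (D * x z < D * (10 / 3)) by (apply Rmult_lt_compat_l; lra).
    assert (D * - (10 / 3) < D * x z) by (apply Rmult_lt_compat_l; lra). lra. }
  assert (hy : 0 < y (S z) < 3).
  { destruct (HA z ltac:(lia)) as (_ & [(q1 & q2 & _)|(q & _)] & _).
    2:{ destruct (HA z ltac:(lia)) as (hp & _). lia. }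
    destruct (HA (S z) ltac:(lia)) as (_ & [(q3 & _)|(_ & _ & _ & q)] & _ & _ & _); [contradiction|].
    destruct (HA (S (S z)) ltac:(lia)) as (_ & _ & _ & b & _). apply Rabs_def2 in b. rewrite q.
    assert (D * y (S (S z)) < D * (10 / 3)) by (apply Rmult_lt_compat_l; lra).
    assert (D * - (10 / 3) < D * y (S (S z))) by (apply Rmult_lt_compat_l; lra). lra. }
  destruct (HA z ltac:(lia)) as (_ & _ & _ & _ & c). destruct (c h0) as [c1 c2].
  assert (H : 0 < w0 - x z /\ 0 < w0 - y (S z) /\ 1 / 2 * (e * D) * (w0 - y (S z)) < w0 - x z /\
              1 / 2 * (e * D) * (w0 - x z) < w0 - y (S z)).
  { apply (deviation_bounds d); trivial; lra. }
  lra.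
Qed.

Definition next_zero (z l : nat) : Prop :=
  T z = 0%Z /\ T (S z + l)%nat = 0%Z /\ forall m, (m < l)%nat -> T (S z + m)%nat <> 0%Z.

(** After a run of length l the deviation is (-D)^l times a positive number between w0 (1 - D) and
    w0. It must be positive by [zero_deviation], so l is even; it is not 0 because zeros are
    isolated. *)
Lemma gap_values z l : (S N <= z)%nat -> next_zero z l -> exists k, l = (2 * k)%nat /\ (1 <= k)%nat /\
  (D * D) ^ k * (w0 * (1 - D)) <= w0 - x (S z + l)%nat <= (D * D) ^ k * w0 /\
  (D * D) ^ k * (w0 * (1 - D)) <= w0 - y (S z) <= (D * D) ^ k * w0.
Proof.
  intros hz (h0 & h1 & h2). destruct D_facts as (D0 & D1 & he & eD). destruct w0_facts as [E1 E2].
  destruct (run_structure (S z) l ltac:(lia) h2) as (_ & rx & ry).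
  destruct (zero_deviation z hz h0) as (a1 & a2 & _). destruct (zero_deviation (S z + l)%nat ltac:(lia) h1) as (a3 & a4 & _).
  assert (hx : x (S z) = D * x z).
  { destruct (HA z ltac:(lia)) as (hp & [(_ & _ & _ & q & _)|(q & _)] & _); [trivial|lia]. }
  assert (hy : y (S z + l)%nat = D * y (S (S z + l))).
  { destruct (HA (S z + l)%nat ltac:(lia)) as (hp & [(_ & _ & _ & _ & q)|(q & _)] & _); [trivial|lia]. }
  rewrite hx in rx. rewrite hy in ry.
  assert (b1 : w0 * (1 - D) <= w0 - D * x z <= w0).
  { assert (D * x z <= D * w0) by (apply Rmult_le_compat_l; lra). assert (0 <= D * x z) by (apply Rmult_le_pos; lra). lra. }
  assert (b2 : w0 * (1 - D) <= w0 - D * y (S (S z + l)) <= w0).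
  { assert (D * y (S (S z + l)) <= D * w0) by (apply Rmult_le_compat_l; lra).
    assert (0 <= D * y (S (S z + l))) by (apply Rmult_le_pos; lra). lra. }
  assert (hpos : 0 < w0 * (1 - D)) by (apply Rmult_lt_0_compat; lra).
  destruct (Nat.Even_or_Odd l) as [[k hk]|[k hk]]; subst l.
  - exists k. split; [trivial|]. rewrite pow_mult in rx, ry. replace ((- D) ^ 2) with (D * D) in rx, ry by ring.
    assert (hq : 0 < (D * D) ^ k) by (apply pow_lt, Rmult_lt_0_compat; lra).
    rewrite rx, ry. split.
    { destruct k as [|k]; [|lia]. exfalso. destruct (HA z ltac:(lia)) as (hp & [(_ & q & _)|(q & _)] & _); [|lia].
      apply q. replace (S z) with (S z + 2 * 0)%nat by lia. trivial. }
    repeat split; apply Rmult_le_compat_l; lra.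
  - exfalso. rewrite pow_add, pow_mult in rx. replace ((- D) ^ 2) with (D * D) in rx by ring.
    assert (hq : 0 < (D * D) ^ k) by (apply pow_lt, Rmult_lt_0_compat; lra).
    assert (0 < (D * D) ^ k * D * (w0 - D * x z)) by (repeat apply Rmult_lt_0_compat; lra).
    rewrite pow_1 in rx. lra.
Qed.

(** If one run were longer, the deviations on the two sides of the zero would have a ratio of at
    most D^2 / (1 - D). This is less than the e D / 2 of [zero_deviation], because f < (1 - D) /
    2. *)
Lemma gaps_equal z l l' : (S N <= z)%nat -> next_zero z l -> next_zero (S z + l) l' -> l' = l.
Proof.
  intros hz n1 n2. destruct D_facts as (D0 & D1 & he & eD). destruct w0_facts as [E1 E2].
  destruct (gap_values z l hz n1) as (k & -> & _ & bx & _).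
  destruct (gap_values (S z + 2 * k) l' ltac:(lia) n2) as (k' & -> & _ & _ & by_).
  destruct (zero_deviation (S z + 2 * k)%nat ltac:(lia) (proj1 n2)) as (_ & _ & c1 & c2).
  set (X := w0 - x (S z + 2 * k)%nat) in *. set (Y := w0 - y (S (S z + 2 * k))) in *.
  set (q := D * D) in *. assert (hq : 0 < q < 1)
    by (unfold q; split; [apply Rmult_lt_0_compat; lra|]; apply Rle_lt_trans with (D * 1); [apply Rmult_le_compat_l; lra|lra]).
  assert (G : forall k k' X Y, q ^ k * (w0 * (1 - D)) <= X <= q ^ k * w0 -> q ^ k' * (w0 * (1 - D)) <= Y <= q ^ k' * w0 ->
    1 / 2 * (e * D) * Y < X -> (k <= k')%nat).
  { clear - hq D0 D1 he eD E2 f18 f_pos e_lt fe. clearbody w0. intros k k' X Y hX hY h. apply Nat.nlt_ge. intros hlt.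
    assert (hp : 0 < q ^ k') by (apply pow_lt; lra).
    assert (hkk : q ^ k <= q ^ k' * q).
    { replace (q ^ k' * q) with (q ^ (S k')) by (simpl; ring). replace k with (S k' + (k - S k'))%nat by lia. rewrite pow_add. rewrite <- (Rmult_1_r (q ^ S k')) at 2.
      apply Rmult_le_compat_l; [apply pow_le; lra|]. rewrite <- (pow1 (k - S k')). apply pow_incr. lra. }
    assert (h1 : X <= q ^ k' * q * w0).
    { apply Rle_trans with (q ^ k * w0); [lra|]. apply Rmult_le_compat_r; lra. }
    assert (h2 : 1 / 2 * (e * D) * (q ^ k' * (w0 * (1 - D))) <= 1 / 2 * (e * D) * Y).
    { apply Rmult_le_compat_l; [|lra]. repeat apply Rmult_le_pos; lra. }
    assert (h3 : 0 < e * D * (q ^ k') * w0) by (repeat apply Rmult_lt_0_compat; lra).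
    assert (h4 : e * D * (q ^ k') * w0 * (1 / 2 * (1 - D)) < e * D * (q ^ k') * w0 * f).
    { apply Rle_lt_trans with (1 / 2 * (e * D) * Y); [lra|]. apply Rlt_le_trans with (1 := h). apply Rle_trans with (1 := h1).
      assert (hqe : e * f * D = q) by (unfold q, D; ring).
      right. rewrite <- hqe at 2. ring. }
    apply Rmult_lt_reg_l in h4; lra. }
  f_equal. apply Nat.le_antisymm.
  - apply (G k' k Y X); trivial.
  - apply (G k k' X Y); trivial.
Qed.

Lemma gap_matches z : (S N <= z)%nat -> T z = 0%Z -> (forall n, exists m, (n <= m)%nat /\ T m = 0%Z) ->
  exists k s, (1 <= k)%nat /\ (s = 1 \/ s = -1)%Z /\ forall i, T (z + i)%nat = (s * gap_word k i)%Z.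
Proof.
  intros hz h0 Hinf.
  assert (Hnext : forall z, T z = 0%Z -> exists l, next_zero z l).
  { clear - Hinf. intros z h0. destruct (least_nat (fun l => T (S z + l)%nat = 0%Z)) as [l [h1 h2]].
    - destruct (Hinf (S z)) as [m [hm1 hm2]]. exists (m - S z)%nat. now replace (S z + (m - S z))%nat with m by lia.
    - exists l. split; [trivial|]. split; trivial. }
  destruct (Hnext z h0) as [l hl]. destruct (gap_values z l hz hl) as (k & hk & hk1 & _).
  assert (Hall : forall n, next_zero (z + n * S l) l).
  { induction n as [|n IH]; [now rewrite Nat.add_0_r|].
    replace (z + S n * S l)%nat with (S (z + n * S l) + l)%nat by (simpl; lia).
    destruct (Hnext (S (z + n * S l) + l)%nat) as [l' hl']; [apply IH|].
    assert (E : l' = l) by (apply (gaps_equal (z + n * S l)); [lia|trivial|trivial]). now subst l'. }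
  (* Runs have even length, so every run starts with the same sign. *)
  assert (Hsg : forall n, sg (S (z + n * S l)) = sg (S z)).
  { induction n as [|n IH]; [now rewrite Nat.add_0_r|].
    destruct (Hall n) as (q1 & q2 & q3). destruct (run_structure (S (z + n * S l)) l ltac:(lia) q3) as (r & _).
    replace (z + S n * S l)%nat with (S (z + n * S l) + l)%nat by (simpl; lia).
    destruct (HA (S (z + n * S l) + l)%nat ltac:(lia)) as (hp & [(_ & _ & t & _)|(t & _)] & _); [|lia].
    rewrite t, r, IH, hk. unfold altsgn. rewrite Nat.even_mul. simpl. lia. }
  exists k, (sg (S z)). split; [trivial|]. split; [apply HA; lia|].
  intros i. unfold gap_word.
  assert (hL : (2 * k + 1 = S l)%nat) by lia. rewrite hL.
  pose proof (Nat.div_mod i (S l) ltac:(lia)) as hdm. set (n := (i / S l)%nat) in *. set (m := (i mod S l)%nat) in *.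
  pose proof (Nat.mod_upper_bound i (S l) ltac:(lia)) as hm. fold m in hm.
  destruct (Hall n) as (q1 & q2 & q3).
  destruct (Nat.eqb_spec m 0) as [E|E].
  - replace (z + i)%nat with (z + n * S l)%nat by nia. rewrite q1. lia.
  - destruct m as [|m']; [lia|].
    replace (z + i)%nat with (S (z + n * S l) + m')%nat by nia.
    destruct (run_structure (S (z + n * S l)) m' ltac:(lia)) as (r & _); [intros j hj; apply q3; lia|].
    destruct (HA (S (z + n * S l) + m')%nat ltac:(lia)) as (hp & [(t & _)|(t & _)] & _).
    { exfalso. apply (q3 m'); [lia|trivial]. }
    rewrite t, r, Hsg. unfold altsgn. rewrite Nat.odd_succ. destruct (Nat.even m'); lia.
Qed.

Lemma alt_matches n1 : (N <= n1)%nat -> (forall n, (n1 <= n)%nat -> T n <> 0%Z) ->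
  exists s, (s = 1 \/ s = -1)%Z /\ forall i, T (n1 + i)%nat = (s * alt_word i)%Z.
Proof.
  intros hn H. exists (sg n1). split; [apply HA; lia|]. intros i.
  destruct (run_structure n1 i hn) as (r & _); [intros m _; apply H; lia|].
  destruct (HA (n1 + i)%nat ltac:(lia)) as (hp & [(t & _)|(t & _)] & _).
  { exfalso. apply (H (n1 + i)%nat); [lia|trivial]. }
  rewrite t, r. unfold altsgn, alt_word. destruct (Nat.even i); lia.
Qed.

End Runs.

Lemma zero_tail_classify d K T u w : delta_inf < d -> zero_tail d K T u w ->
  exists n s, (K <= n)%nat /\ (s = 1 \/ s = -1)%Z /\
    ((forall i, T (n + i)%nat = 0%Z) \/ (forall i, T (n + i)%nat = (s * alt_word i)%Z) \/
     exists k, (1 <= k)%nat /\ forall i, T (n + i)%nat = (s * gap_word k i)%Z).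
Proof.
  intros hd HZ.
  destruct (classic (exists n, (K + 2 <= n)%nat /\ T n <> 0%Z)) as [[n0 [hn0 h0]]|hno].
  2:{ exists (K + 2)%nat, 1%Z. split; [lia|]. split; [lia|]. left. intros i. apply NNPP. intros h. apply hno.
      exists (K + 2 + i)%nat. split; [lia|trivial]. }
  destruct (alternating_exists d K T u w n0 hd HZ hn0 h0) as (sg & x & y & HA).
  destruct (classic (forall n, exists m, (n <= m)%nat /\ T m = 0%Z)) as [hinf|hfin].
  - destruct (hinf (S (S n0))) as [z [hz hz0]].
    destruct (gap_matches d (S n0) T sg x y hd HA z hz hz0 hinf) as (k & s & hk & hs & H).
    exists z, s. split; [lia|]. split; [trivial|]. right; right. now exists k.
  - apply not_all_ex_not in hfin. destruct hfin as [n1 hn1].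
    destruct (alt_matches d (S n0) T sg x y HA (max (S n0) n1)) as (s & hs & H); [lia| |].
    { intros n hn h. apply hn1. exists n. split; [lia|trivial]. }
    exists (max (S n0) n1), s. split; [lia|]. split; trivial. right; now left.
Qed.

End ZeroTail.

(** * The pair (4, 6): admissible blocks *)

Section FourSix.

Context (h4 : 4 * e = 1 + e * f) (h6 : 6 * f = 1 + e * f).

Lemma four_six_numbers : 17425 / 100000 < f < 17426 / 100000 /\ 261375 / 1000000 < e < 26139 / 100000 /\
  455 / 10000 < e * f < 456 / 10000 /\ 3656 / 10000 <= delta_inf.
Proof.
  assert (he : e = 3 / 2 * f) by lra.
  assert (hff : f * f = 4 * f - 2 / 3) by (rewrite he in h6; lra).
  assert (hf : 17425 / 100000 < f < 17426 / 100000) by (split; nra).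
  assert (hD : 455 / 10000 < e * f < 456 / 10000) by lra.
  repeat split; try lra.
  unfold delta_inf. set (D := e * f) in *.
  assert (hi : 956388 / 1000000 <= / (1 + D) <= 956481 / 1000000).
  { split; apply Rmult_le_reg_r with (1 + D); try lra; rewrite Rinv_l; lra. }
  unfold Rdiv. set (v := / (1 + D)) in *.
  assert (g1 : 2 * D ^ 2 * v >= 2 * (455 / 10000) ^ 2 * (956388 / 1000000)).
  { apply Rle_ge, Rmult_le_compat; try lra. assert (455 / 10000 * (455 / 10000) <= D * D) by (apply Rmult_le_compat; lra). simpl. lra. }
  assert (g2 : 2 * f * v <= 2 * (17426 / 100000) * (956481 / 1000000)) by (apply Rmult_le_compat; lra).
  apply Rle_trans with ((1 - e + 395 / 100000) * (1 - f - 33336 / 100000)); [|apply Rmult_le_compat; lra].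
  apply Rle_trans with ((1 - 26139 / 100000 + 395 / 100000) * (1 - 17426 / 100000 - 33336 / 100000)); [lra|].
  apply Rmult_le_compat; lra.
Qed.

Lemma ff_no_four d t p r : 3656 / 10000 <= d -> 4 <= t -> ok8 d t p r -> False.
Proof.
  intros hd ht ho. destruct four_six_numbers as (nf & ne & nD & _).
  assert (G : forall p r, ok8 d t p r -> p <= r -> False).
  { clear p r ho. intros p r [kp kr ktp ktr k1 k1' k2 k2' k3 k3' k4 k4'] hpr.
    assert (e * p <= e * r) by (apply Rmult_le_compat_l; lra).
    assert (e * 4 <= e * t) by (apply Rmult_le_compat_l; lra).
    assert (c : d <= (1 + f + p) * (1 - 3 * e - e * p)).
    { apply Rle_trans with (1 := k2). apply Rmult_le_compat_l; lra. }
    (* Arithmetic-geometric mean: e (1 + f + p) and 1 - 3 e - e p have a sum independent of p. *)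
    assert (sq := Rle_0_sqr (e * (1 + f + p) - (1 - 3 * e - e * p))). unfold Rsqr in sq.
    assert (c2 : 4 * e * ((1 + f + p) * (1 - 3 * e - e * p)) <= (1 - 2 * e + e * f) * (1 - 2 * e + e * f)) by lra.
    assert (c3 : (1 - 2 * e + e * f) * (1 - 2 * e + e * f) <= (523 / 1000) * (523 / 1000)) by (apply Rmult_le_compat; lra).
    assert (4 * e * d <= 4 * e * ((1 + f + p) * (1 - 3 * e - e * p))) by (apply Rmult_le_compat_l; lra).
    assert (4 * e * (3656 / 10000) <= 4 * e * d) by (apply Rmult_le_compat_l; lra). lra. }
  destruct (Rle_dec p r); [apply (G p r)|apply (G r p)]; auto using ok8_swap. lra.
Qed.

(** Each bound feeds the next: the second vertex gives -p <= 79/100, then the third makes the tails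
    negative, the first improves the upper bound to 537/1000, and the third again gives the lower
    bound 2/10. *)
Lemma ff_two_bound d p r : 3656 / 10000 <= d -> ok8 d 2 p r -> 2 / 10 < - p < 54 / 100 /\ 2 / 10 < - r < 54 / 100.
Proof.
  intros hd. destruct four_six_numbers as (nf & ne & nD & _).
  assert (U : forall p r, ok8 d 2 p r -> p <= r -> - p <= 79 / 100).
  { clear p r. intros p r [kp kr ktp ktr k1 k1' k2 k2' k3 k3' k4 k4'] hpr.
    apply Rnot_lt_le. intros hlt. set (q := - p - 79 / 100). assert (0 < q) by (unfold q; lra).
    assert (e * p <= e * r) by (apply Rmult_le_compat_l; lra).
    assert (c : d <= (1 + f + p) * (1 - e - e * p)).
    { apply Rle_trans with (1 := k2). apply Rmult_le_compat_l; lra. }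
    replace p with (- (q + 79 / 100)) in c by (unfold q; ring).
    assert (0 <= q * (1 - e + 2 * (79 / 100) * e - e - e * f)) by (apply Rmult_le_pos; lra).
    assert (0 <= e * (q * q)) by (repeat apply Rmult_le_pos; lra).
    assert ((1 + f - 79 / 100) * (1 - e + 79 / 100 * e) <= (38426 / 100000) * (9452 / 10000)) by (apply Rmult_le_compat; lra).
    lra. }
  assert (U' : forall p r, ok8 d 2 p r -> - p <= 79 / 100).
  { clear p r. intros p r ho. destruct (Rle_dec p r) as [h|h]; [now apply (U p r)|].
    pose proof (U r p (ok8_swap _ _ _ _ ho)). lra. }
  assert (L : forall p r m, ok8 d 2 p r -> - r <= m -> 1 - 3 * e + e * m > 0 -> d <= (1 - f - p) * (1 - 3 * e + e * m)).
  { clear p r. intros p r m [kp kr ktp ktr k1 k1' k2 k2' k3 k3' k4 k4'] hm hm0.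
    assert (e * - r <= e * m) by (apply Rmult_le_compat_l; lra).
    apply Rle_trans with (1 := k3). apply Rmult_le_compat_l; lra. }
  assert (L0 : forall p r, ok8 d 2 p r -> p < 0).
  { clear p r. intros p r ho. apply Rnot_le_lt. intros hle.
    pose proof (L p r (79 / 100) ho (U' r p (ok8_swap _ _ _ _ ho)) ltac:(lra)) as c.
    assert ((1 - f - p) * (1 - 3 * e + e * (79 / 100)) <= (82575 / 100000) * (42238 / 100000)).
    { apply Rmult_le_compat; destruct ho; lra. }
    lra. }
  assert (V : forall p r, ok8 d 2 p r -> - p < 537 / 1000).
  { clear p r. intros p r ho. apply Rnot_le_lt. intros hle. pose proof (L0 r p (ok8_swap _ _ _ _ ho)) as hr.
    destruct ho as [kp kr ktp ktr k1 k1' k2 k2' k3 k3' k4 k4'].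
    assert (e * r < 0) by (assert (0 < e * - r) by (apply Rmult_lt_0_compat; lra); lra).
    assert ((1 - f + p) * (1 - e + e * (2 + r)) <= (28876 / 100000) * (12614 / 10000)) by (apply Rmult_le_compat; lra).
    lra. }
  assert (W : forall p r, ok8 d 2 p r -> 2 / 10 < - p).
  { clear p r. intros p r ho. apply Rnot_le_lt. intros hle. pose proof (V r p (ok8_swap _ _ _ _ ho)) as hr.
    pose proof (L p r (537 / 1000) ho ltac:(lra) ltac:(lra)) as c.
    assert ((1 - f - p) * (1 - 3 * e + e * (537 / 1000)) <= (102576 / 100000) * (35625 / 100000)).
    { apply Rmult_le_compat; destruct ho; lra. }
    lra. }
  intros ho. pose proof (ok8_swap _ _ _ _ ho) as ho'.
  pose proof (V p r ho). pose proof (V r p ho'). pose proof (W p r ho). pose proof (W r p ho'). lra.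
Qed.

Lemma ff_cases d tau p r : delta_inf < d -> Z.Even tau -> ok8 d (IZR tau) p r ->
  (tau = (-2)%Z /\ 2 / 10 < p < 54 / 100 /\ 2 / 10 < r < 54 / 100) \/
  (tau = 0%Z /\ -581 / 1000 < p < 581 / 1000 /\ -581 / 1000 < r < 581 / 1000) \/
  (tau = 2%Z /\ 2 / 10 < - p < 54 / 100 /\ 2 / 10 < - r < 54 / 100).
Proof.
  intros hd he ho. destruct four_six_numbers as (nf & ne & nD & nd).
  destruct (even_cases tau he) as [h|[h|[h|[h|h]]]].
  - exfalso. apply ok8_neg in ho. apply IZR_le in h. apply (ff_no_four d (- IZR tau) (- p) (- r)); trivial; lra.
  - left. split; [trivial|]. subst tau. apply ok8_neg in ho. replace (- IZR (-2)) with 2 in ho by lra.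
    pose proof (ff_two_bound d _ _ ltac:(lra) ho). lra.
  - right; left. split; [trivial|]. subst tau. pose proof delta_inf_lower.
    destruct (ok8_zero_bound d p r ltac:(lra) ho) as [q1 q2]. apply Rabs_def2 in q1, q2. lra.
  - right; right. split; [trivial|]. subst tau. apply (ff_two_bound d); trivial. lra.
  - exfalso. apply IZR_le in h. apply (ff_no_four d (IZR tau) p r); trivial; lra.
Qed.

(** Here f is so large that T = -4 would make -r exceed 54/100; hence T = -2, in contrast to the
    case 2a <= b. Then p' < 0, which rules out tau' = -2. *)
Lemma ff_link d T tau' p r p' r' : delta_inf < d -> Z.Even T -> Z.Even tau' -> linked T 2 tau' p r p' r' ->
  ok8 d 2 p r -> ok8 d (IZR tau') p' r' -> T = (-2)%Z /\ (tau' = 0 \/ tau' = 2)%Z /\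
  - r <= 3751 / 10000 /\ (tau' = 2%Z -> - r < 283 / 1000).
Proof.
  intros hd hT ht [l1 l2] ho ho'. destruct four_six_numbers as (nf & ne & nD & nd).
  destruct (ff_two_bound d p r ltac:(lra) ho) as [bp br].
  assert (hb : -681 / 1000 < e * (IZR tau' + r') < 681 / 1000).
  { destruct (ff_cases d tau' p' r' hd ht ho') as [[E [b1 b2]]|[[E [b1 b2]]|[E [b1 b2]]]]; rewrite E;
    (assert (q1 : e * r' < e * (581 / 1000)) by (apply Rmult_lt_compat_l; lra));
    (assert (q2 : e * - (581 / 1000) < e * r') by (apply Rmult_lt_compat_l; lra)); lra. }
  set (z := e * (IZR tau' + r')) in *.
  assert (hT2 : T = (-2)%Z).
  { assert (h1 : -4 < IZR T).
    { apply Rmult_lt_reg_l with f; [lra|]. assert (f * z <= f * (681 / 1000)) by (apply Rmult_le_compat_l; lra). lra. }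
    assert (h2 : IZR T < 0).
    { apply Rmult_lt_reg_l with f; [lra|]. assert (f * - (681 / 1000) <= f * z) by (apply Rmult_le_compat_l; lra). lra. }
    apply (lt_IZR (-4)) in h1. apply (lt_IZR _ 0) in h2. destruct hT as [x ->]. lia. }
  split; [trivial|]. rewrite hT2 in l1, l2.
  assert (hp' : p' < 0).
  { rewrite l2. assert (e * - p > 0) by (apply Rmult_lt_0_compat; lra).
    assert (f * (-2 + e * (2 + p)) < f * 0) by (apply Rmult_lt_compat_l; lra). lra. }
  destruct (ff_cases d tau' p' r' hd ht ho') as [[E [b1 b2]]|[[E [b1 b2]]|[E [b1 b2]]]].
  - lra.
  - split; [now left|]. split; [|lia]. unfold z in l1. rewrite E in l1.
    assert (e * f * - r' <= e * f * (581 / 1000)) by (apply Rmult_le_compat_l; lra).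
    assert (e * f * (581 / 1000) <= 456 / 10000 * (581 / 1000)) by (apply Rmult_le_compat_r; lra). lra.
  - split; [now right|]. unfold z in l1. rewrite E in l1.
    assert (e * f * - r' <= e * f * (54 / 100)) by (apply Rmult_le_compat_l; lra).
    split; [|intros _]; lra.
Qed.

(** A neighbour with tau = 2 on either side shortens the corresponding tail to less than 283/1000,
    and the third vertex fails. *)
Lemma ff_middle d T0 T1 tau0 tau2 p0 r0 p1 r1 p2 r2 : delta_inf < d -> Z.Even T0 -> Z.Even T1 -> Z.Even tau0 -> Z.Even tau2 ->
  linked T0 tau0 2 p0 r0 p1 r1 -> linked T1 2 tau2 p1 r1 p2 r2 ->
  ok8 d (IZR tau0) p0 r0 -> ok8 d 2 p1 r1 -> ok8 d (IZR tau2) p2 r2 ->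
  (T0 = -2 /\ T1 = -2 /\ tau0 = 0 /\ tau2 = 0)%Z.
Proof.
  intros hd e1 e2 e3 e4 l1 l2 o0 o1 o2. destruct four_six_numbers as (nf & ne & nD & nd).
  destruct (ff_link d T1 tau2 p1 r1 p2 r2) as (q1 & q2 & q3 & q4); trivial.
  destruct (ff_link d T0 tau0 r1 p1 r0 p0) as (q5 & q6 & q7 & q8); trivial.
  { now apply linked_sym. } { now apply ok8_swap. } { now apply ok8_swap. }
  destruct o1 as [kp kr ktp ktr k1 k1' k2 k2' k3 k3' k4 k4'].
  assert (G : forall x y, - x < 283 / 1000 -> - y <= 3751 / 10000 -> 0 < 1 - f - x -> 0 < 1 - e - e * (2 + y) ->
    (1 - f - x) * (1 - e - e * (2 + y)) < d).
  { intros x y hx hy h1 h2. assert (e * - y <= e * (3751 / 10000)) by (apply Rmult_le_compat_l; lra).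
    assert ((1 - f - x) * (1 - e - e * (2 + y)) <= (110876 / 100000) * (31394 / 100000)) by (apply Rmult_le_compat; lra). lra. }
  repeat split; trivial.
  - destruct q6 as [->|h]; trivial. exfalso. specialize (q8 h). pose proof (G p1 r1 q8 q3 ltac:(lra) ltac:(lra)). lra.
  - destruct q2 as [->|h]; trivial. exfalso. specialize (q4 h). pose proof (G r1 p1 q4 q7 ltac:(lra) ltac:(lra)). lra.
Qed.

(** The first vertex at the two neighbours keeps their outer tails above -302/1000; the third vertex
    at the block itself then forces the tail [rh] below -6/100, and T = -2 followed by tau = 2 is
    the only continuation that produces such a tail. *)
Lemma ff_step d K tau T p r i : delta_inf < d -> tail_ok d K tau T p r -> (S K <= i)%nat -> tau i = 2%Z ->
  (T i = -2 /\ tau (S i) = 0 /\ T (S i) = -2 /\ tau (S (S i)) = 2)%Z.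
Proof.
  intros hd HT hi h2. destruct i as [|i]; [lia|]. destruct four_six_numbers as (nf & ne & nD & nd).
  pose proof HT as (e1 & e2 & HB & ho).
  pose proof (tail_ok_linked _ _ _ _ _ _ i HT) as l0. pose proof (tail_ok_linked _ _ _ _ _ _ (S i) HT) as l1.
  pose proof (tail_ok_linked _ _ _ _ _ _ (S (S i)) HT) as l2.
  pose proof (ho i ltac:(lia)) as o0. pose proof (ho (S i) ltac:(lia)) as o1. pose proof (ho (S (S i)) ltac:(lia)) as o2.
  pose proof (ho (S (S (S i))) ltac:(lia)) as o3. rewrite h2 in *.
  destruct (ff_middle d (T i) (T (S i)) (tau i) (tau (S (S i))) (p i) (r i) (p (S i)) (r (S i)) (p (S (S i))) (r (S (S i))))
    as (t0 & t1 & s0 & s2); auto.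
  rewrite t0, s0 in *. rewrite t1, s2 in *.
  destruct (ff_two_bound d _ _ ltac:(lra) o1) as [bp br].
  set (P := - p (S i)) in *. set (Q := - r (S i)) in *.
  set (la := p i) in *. set (rh := r (S (S i))) in *.
  destruct l0 as [l01 l02]. destruct l1 as [l11 l12].
  assert (EP : P = 2 * f - e * f * la) by (unfold P; rewrite l02; ring).
  assert (EQ : Q = 2 * f - e * f * rh) by (unfold Q; rewrite l11; ring).
  assert (bla : -581 / 1000 < la < 581 / 1000 /\ -581 / 1000 < rh < 581 / 1000).
  { destruct (ff_cases d 0 _ _ hd ltac:(now exists 0%Z) o0) as [[E _]|[[_ [b1 b2]]|[E _]]]; [lia| |lia].
    destruct (ff_cases d 0 _ _ hd ltac:(now exists 0%Z) o2) as [[E _]|[[_ [b3 b4]]|[E _]]]; [lia| |lia].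
    split; trivial. }
  assert (mul : forall v, -581 / 1000 < v < 581 / 1000 -> -265 / 10000 < e * f * v < 265 / 10000).
  { intros v [v1 v2]. split.
    - apply Rle_lt_trans with (e * f * (- 581 / 1000)); [lra|]. apply Rmult_lt_compat_l; lra.
    - apply Rlt_le_trans with (e * f * (581 / 1000)); [|lra]. apply Rmult_lt_compat_l; lra. }
  pose proof (mul la (proj1 bla)) as mla. pose proof (mul rh (proj2 bla)) as mrh.
  assert (low : forall x y v, x = - 2 * f + 2 * (e * f) - e * f * y -> 3219 / 10000 < y -> d <= (1 - f + x) * (1 - e + e * v) ->
    0 < 1 - f + x -> - 302 / 1000 < v).
  { intros x y v hx hy hc hp. apply Rnot_le_lt. intros hle.
    assert (e * f * (3219 / 10000) <= e * f * y) by (apply Rmult_le_compat_l; lra).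
    assert (e * v <= e * (- 302 / 1000)) by (apply Rmult_le_compat_l; lra).
    assert ((1 - f + x) * (1 - e + e * v) <= (1 - f + x) * (6597 / 10000)) by (apply Rmult_le_compat_l; lra).
    assert ((1 - f + x) * (6597 / 10000) <= 5538 / 10000 * (6597 / 10000)) by (apply Rmult_le_compat_r; lra). lra. }
  assert (hla : -302 / 1000 < la).
  { destruct o0 as [kp kr ktp ktr k1 k1' k2 k2' k3 k3' k4 k4'].
    apply (low (r i) Q); try lra. rewrite l01. unfold Q. ring. }
  assert (hrh : -302 / 1000 < rh).
  { destruct o2 as [kp kr ktp ktr k1 k1' k2 k2' k3 k3' k4 k4'].
    apply (low (p (S (S i))) P); try lra. rewrite l12. unfold P. ring. }
  assert (hrh2 : rh < - 6 / 100).
  { apply Rnot_le_lt. intros hle. destruct o1 as [kp kr ktp ktr k1 k1' k2 k2' k3 k3' k4 k4'].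
    assert (e * f * (-302 / 1000) <= e * f * la) by (apply Rmult_le_compat_l; lra).
    assert (e * f * (- 6 / 100) <= e * f * rh) by (apply Rmult_le_compat_l; lra).
    assert (hQ : Q <= 35126 / 100000) by lra. assert (hP : P <= 36230 / 100000) by lra.
    assert (e * Q <= e * (35126 / 100000)) by (apply Rmult_le_compat_l; lra).
    assert ((1 - f - p (S i)) * (1 - e - e * (2 + r (S i))) <= 118805 / 100000 * (30769 / 100000)).
    { unfold P, Q in *. apply Rmult_le_compat; lra. }
    lra. }
  destruct l2 as [l21 _]. fold rh in l21.
  split; [trivial|]. split; [trivial|].
  pose proof (e2 (S (S i))) as ev. set (T2 := T (S (S i))) in *.
  assert (hz : - 1734 / 1000 < IZR T2 + e * (IZR (tau (S (S (S i)))) + r (S (S (S i)))) < - 344 / 1000).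
  { split; apply Rmult_lt_reg_l with f; try lra. }
  assert (bound : forall v, -581 / 1000 < v < 581 / 1000 -> -152 / 1000 < e * v < 152 / 1000).
  { intros v [v1 v2]. split.
    - apply Rle_lt_trans with (e * (- 581 / 1000)); [lra|]. apply Rmult_lt_compat_l; lra.
    - apply Rlt_le_trans with (e * (581 / 1000)); [|lra]. apply Rmult_lt_compat_l; lra. }
  destruct (ff_cases d _ _ _ hd (e1 (S (S (S i)))) o3) as [[E [b1 b2]]|[[E [b1 b2]]|[E [b1 b2]]]]; rewrite E in hz.
  - exfalso.
    assert (hT2 : T2 = 2%Z).
    { apply ok8_neg in o3. rewrite E in o3. replace (- IZR (-2)) with 2 in o3 by lra.
      apply ok8_neg in o2. replace (- IZR 0) with (IZR 0) in o2 by lra.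
      pose proof (tail_ok_linked _ _ _ _ _ _ (S (S i)) (tail_ok_neg _ _ _ _ _ _ HT)) as l.
      unfold zneg, rneg in l. rewrite s2, E in l. apply linked_sym in l.
      destruct (ff_link d _ _ _ _ _ _ hd (even_opp _ (e2 (S (S i)))) (even_opp 0 ltac:(now exists 0%Z)) l) as (q & _).
      - now apply ok8_swap.
      - apply ok8_swap. exact o2.
      - unfold T2. lia. }
    rewrite hT2 in hz. pose proof (bound (r (S (S (S i)))) ltac:(lra)). lra.
  - exfalso. pose proof (bound (r (S (S (S i)))) ltac:(lra)).
    assert (h1 : -2 < IZR T2) by lra. assert (h3 : IZR T2 < 0) by lra.
    apply (lt_IZR (-2)) in h1. apply (lt_IZR _ 0) in h3. destruct ev as [x hx]. lia.
  - split; [|trivial]. pose proof (bound (r (S (S (S i)))) ltac:(lra)).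
    assert (h1 : -4 < IZR T2) by lra. assert (h3 : IZR T2 < 0) by lra.
    apply (lt_IZR (-4)) in h1. apply (lt_IZR _ 0) in h3. destruct ev as [x hx]. lia.
Qed.

Lemma ff_stays d K tau T p r i : delta_inf < d -> tail_ok d K tau T p r -> (S K <= i)%nat -> tau i = 2%Z ->
  forall j, tau (S i + 2 * j)%nat = 0%Z /\ T (S i + 2 * j)%nat = (-2)%Z /\
            tau (S i + S (2 * j))%nat = 2%Z /\ T (S i + S (2 * j))%nat = (-2)%Z.
Proof.
  intros hd HT hi h2.
  assert (H : forall j, tau (i + 2 * j)%nat = 2%Z).
  { induction j as [|j IH]; [now rewrite Nat.add_0_r|].
    destruct (ff_step d K tau T p r (i + 2 * j) hd HT ltac:(lia) IH) as (_ & _ & _ & q).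
    now replace (i + 2 * S j)%nat with (S (S (i + 2 * j))) by lia. }
  intros j. destruct (ff_step d K tau T p r (i + 2 * j) hd HT ltac:(lia) (H j)) as (q1 & q2 & q3 & q4).
  destruct (ff_step d K tau T p r (i + 2 * S j) hd HT ltac:(lia) (H (S j))) as (q5 & _).
  replace (S i + 2 * j)%nat with (S (i + 2 * j)) by lia.
  replace (S i + S (2 * j))%nat with (S (S (i + 2 * j))) by lia.
  replace (i + 2 * S j)%nat with (S (S (i + 2 * j))) in q5 by lia. auto.
Qed.

End FourSix.

(** * The case b = 2a - 2: admissible blocks *)

Section BetaNearHalfEta.

(** Since e (1 + D) = b D and f (1 + D) = a D, [hrel] is b = 2 a - 2 multiplied by D; [e8] is a >=
    8. *)
Context (e8 : 8 * e <= 1 + e * f) (hrel : e * (1 + e * f) = 2 * f * (1 + e * f) - 2 * (e * f)).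

Definition delta_two : R := (1 - 3 * e + 2 * (e * f) * (2 - e) / (1 - e * f)) *
  (1 + f - 2 * f * (e * f) * (1 - e + e * f) / (1 - e * f)).
(* A lower bound of [delta_two] that is polynomial in [e] and [f]. *)
Definition low_two : R := (1 - 3 * e + 4 * (e * f) - 2 * (e * (e * f))) * (1 + f - 2 * (f * (e * f))).

Lemma three_numbers : e < 128 / 1000 /\ f < 74 / 1000 /\ 0 < e * f < 1 / 100 /\ e <= 2 * f.
Proof.
  assert (h : 0 < e * f) by (apply Rmult_lt_0_compat; lra).
  assert (he : e < 13 / 100).
  { assert (e * f <= 3 / 10 * e) by (rewrite (Rmult_comm (3 / 10)); apply Rmult_le_compat_l; lra). lra. }
  assert (he' : e < 1271 / 10000).
  { assert (e * f <= 13 / 100 * e) by (rewrite (Rmult_comm (13 / 100)); apply Rmult_le_compat_l; lra). lra. }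
  assert (h1 : 0 < e * f * f) by (apply Rmult_lt_0_compat; lra).
  assert (h2 : e * f <= 1271 / 10000 * f) by (apply Rmult_le_compat_r; lra).
  assert (h3 : e * (e * f) <= 1271 / 10000 * (e * f)) by (apply Rmult_le_compat_r; lra).
  assert (h5 : 0 < e * (e * f)) by (apply Rmult_lt_0_compat; lra).
  assert (hf : f < 74 / 1000) by lra.
  assert (h4 : 0 < (e * f) * (1 - f)) by (apply Rmult_lt_0_compat; lra).
  repeat split; lra.
Qed.

Lemma low_two_le : low_two <= delta_two.
Proof.
  destruct three_numbers as (he & hf & hD & h2f). unfold low_two, delta_two.
  assert (hi : 0 < / (1 - e * f)) by (apply Rinv_0_lt_compat; lra).
  assert (a1 : 2 * (e * f) * (2 - e) <= 2 * (e * f) * (2 - e) / (1 - e * f)).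
  { apply Rmult_le_reg_r with (1 - e * f); [lra|]. rewrite div_mult_cancel by lra.
    assert (0 <= 2 * (e * f) * (2 - e) * (e * f)) by (repeat apply Rmult_le_pos; lra). lra. }
  assert (a2 : 2 * f * (e * f) * (1 - e + e * f) / (1 - e * f) <= 2 * f * (e * f)).
  { apply Rmult_le_reg_r with (1 - e * f); [lra|]. rewrite div_mult_cancel by lra.
    apply Rmult_le_compat_l; [repeat apply Rmult_le_pos; lra|].
    assert (e * f <= e * (1 / 2)) by (apply Rmult_le_compat_l; lra). lra. }
  assert (0 <= f * (e * f)) by (apply Rmult_le_pos; lra).
  assert (e * (e * f) <= 1 * (e * f)) by (apply Rmult_le_compat_r; lra).
  assert (f * (e * f) <= 1 * (e * f)) by (apply Rmult_le_compat_r; lra).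
  apply Rmult_le_compat; lra.
Qed.

Lemma decreasing_product A0 B0 s : 0 <= s -> 0 <= A0 -> e * A0 <= B0 -> (A0 - s) * (B0 + e * s) <= A0 * B0.
Proof.
  intros hs hA hB. assert (0 <= s * (B0 - e * A0)) by (apply Rmult_le_pos; lra).
  assert (0 <= e * (s * s)) by (repeat apply Rmult_le_pos; lra). lra.
Qed.

(** The correction 3 e f f exceeds the 2 e f f that a neighbouring tail contributes, so that T = 2
    and T = -2 become impossible between two blocks with tau = 0. *)
Lemma t_zero_bound d p r : low_two < d -> ok8 d 0 p r ->
  Rabs p < 2 * f - 3 * (e * f * f) /\ Rabs r < 2 * f - 3 * (e * f * f).
Proof.
  intros hd. destruct three_numbers as (he & hf & hD & h2f).
  assert (hD1 : 0 < e * f * f) by (apply Rmult_lt_0_compat; lra).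
  assert (hD2 : e * f * f <= 1 / 100 * f) by (apply Rmult_le_compat_r; lra).
  assert (H : forall M, d <= (1 - f - M) * (1 - e + e * M) -> M < 2 * f - 3 * (e * f * f)).
  { intros M h. apply Rnot_le_lt. intros hle. set (s := M - (2 * f - 3 * (e * f * f))).
    pose proof (decreasing_product (1 - 3 * f + 3 * (e * f * f)) (1 - e + e * (2 * f - 3 * (e * f * f))) s) as hp.
    assert (q : 0 <= e * (2 * f - 3 * (e * f * f))) by (apply Rmult_le_pos; lra).
    specialize (hp ltac:(unfold s; lra) ltac:(lra)).
    assert (q2 : e * (1 - 3 * f + 3 * (e * f * f)) <= e * 1) by (apply Rmult_le_compat_l; lra).
    specialize (hp ltac:(lra)).
    replace (1 - 3 * f + 3 * (e * f * f) - s) with (1 - f - M) in hp by (unfold s; ring).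
    replace (1 - e + e * (2 * f - 3 * (e * f * f)) + e * s) with (1 - e + e * M) in hp by (unfold s; ring).
    unfold low_two in hd.
    assert (g1 : 0 <= (e * f) * (e * f) * (10 - 23 * f)) by (repeat apply Rmult_le_pos; lra).
    assert (g2 : 0 <= (e * f) * (e * f) * (e * f) * (4 + 9 * f)) by (repeat apply Rmult_le_pos; lra).
    lra. }
  assert (G : forall p r, ok8 d 0 p r -> Rabs r <= Rabs p -> Rabs p < 2 * f - 3 * (e * f * f)).
  { clear p r. intros p r [kp kr ktp ktr k1 k1' k2 k2' k3 k3' k4 k4'] hpr. apply H. rewrite !Rplus_0_l in *.
    apply Rabs_le_between in hpr. revert hpr. unfold Rabs. destruct (Rcase_abs p); intros hpr.
    - apply Rle_trans with (1 := k1). assert (e * r <= e * - p) by (apply Rmult_le_compat_l; lra).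
      replace (1 - f + p) with (1 - f - - p) by ring. apply Rmult_le_compat_l; lra.
    - apply Rle_trans with (1 := k3). assert (e * - r <= e * p) by (apply Rmult_le_compat_l; lra).
      apply Rmult_le_compat_l; lra. }
  intros ho. destruct (Rle_dec (Rabs r) (Rabs p)) as [h|h].
  - pose proof (G p r ho h). lra.
  - pose proof (G r p (ok8_swap _ _ _ _ ho) ltac:(lra)). lra.
Qed.

Lemma t_no_four d t p r : low_two < d -> 4 <= t -> ok8 d t p r -> False.
Proof.
  intros hd ht. destruct three_numbers as (he & hf & hD & h2f).
  assert (hD1 : 0 < f * (e * f)) by (apply Rmult_lt_0_compat; lra).
  assert (hD2 : e * (e * f) <= 128 / 1000 * (e * f)) by (apply Rmult_le_compat_r; lra).
  assert (hD3 : f * (e * f) <= 74 / 1000 * (e * f)) by (apply Rmult_le_compat_r; lra).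
  assert (hL : (1 + f) * (1 - 3 * e) < low_two).
  { unfold low_two.
    assert (0 < e * f * (e * f) * (4 - 8 * f)) by (repeat apply Rmult_lt_0_compat; lra).
    assert (0 < e * f * (e * f) * (e * f)) by (repeat apply Rmult_lt_0_compat; lra). lra. }
  assert (G : forall p r, ok8 d t p r -> p <= r -> False).
  { clear p r. intros p r [kp kr ktp ktr k1 k1' k2 k2' k3 k3' k4 k4'] hpr.
    assert (e * p <= e * r) by (apply Rmult_le_compat_l; lra).
    assert (e * 4 <= e * t) by (apply Rmult_le_compat_l; lra).
    destruct (Rle_dec p 0) as [hp|hp].
    - pose proof (decreasing_product (1 + f) (1 - 3 * e) (- p) ltac:(lra) ltac:(lra) ltac:(lra)) as q.
      assert ((1 + f + p) * (1 + e - e * (t + r)) <= (1 + f + p) * (1 - 3 * e + e * - p)) by (apply Rmult_le_compat_l; lra).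
      lra.
    - assert (0 < e * p) by (apply Rmult_lt_0_compat; lra).
      assert ((1 - f - p) * (1 - e - e * (t + r)) <= (1 + f) * (1 - 3 * e)) by (apply Rmult_le_compat; lra). lra. }
  intros ho. destruct (Rle_dec p r); [apply (G p r)|apply (G r p)]; auto using ok8_swap. lra.
Qed.

(** The second vertex gives the upper bound, and with it the third gives the lower one. The latter
    is decided by terms of order e f f, where e and f have to be compared through [hrel]. *)
Lemma t_two_bound d p r : low_two < d -> ok8 d 2 p r ->
  2 * f - 18 * (e * f * f) < - p < 4 * f + 3 * (e * f) /\ 2 * f - 18 * (e * f * f) < - r < 4 * f + 3 * (e * f).
Proof.
  intros hd. destruct three_numbers as (he & hf & hD & h2f).
  assert (hD1 : 0 < e * f * f) by (apply Rmult_lt_0_compat; lra).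
  assert (hD2 : e * f * f <= 1 / 100 * f) by (apply Rmult_le_compat_r; lra).
  assert (hD3 : 0 < e * (e * f) <= 128 / 1000 * (e * f)) by (split; [apply Rmult_lt_0_compat|apply Rmult_le_compat_r]; lra).
  assert (U : forall p r, ok8 d 2 p r -> p <= r -> - p < 4 * f + 3 * (e * f)).
  { clear p r. intros p r [kp kr ktp ktr k1 k1' k2 k2' k3 k3' k4 k4'] hpr.
    apply Rnot_le_lt. intros hle. set (s := - p - (4 * f + 3 * (e * f))).
    pose proof (decreasing_product (1 - 3 * f - 3 * (e * f)) (1 - e + e * (4 * f + 3 * (e * f))) s ltac:(unfold s; lra) ltac:(lra)) as hp.
    assert (q : 0 <= e * (4 * f + 3 * (e * f))) by (apply Rmult_le_pos; lra).
    assert (q2 : e * (1 - 3 * f - 3 * (e * f)) <= e * 1) by (apply Rmult_le_compat_l; lra).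
    specialize (hp ltac:(lra)).
    replace (1 - 3 * f - 3 * (e * f) - s) with (1 + f + p) in hp by (unfold s; ring).
    replace (1 - e + e * (4 * f + 3 * (e * f)) + e * s) with (1 - e - e * p) in hp by (unfold s; ring).
    assert (e * p <= e * r) by (apply Rmult_le_compat_l; lra).
    assert (c : d <= (1 + f + p) * (1 - e - e * p)) by (apply Rle_trans with (1 := k2); apply Rmult_le_compat_l; lra).
    unfold low_two in hd.
    assert (g1 : 0 <= (e * f) * (e * f) * (25 - 8 * f)) by (repeat apply Rmult_le_pos; lra).
    assert (g2 : 0 <= (e * f) * (e * f) * (e * f)) by (repeat apply Rmult_le_pos; lra).
    assert (g3 : 0 <= (e * f) * (e * f) * e) by (repeat apply Rmult_le_pos; lra).
    lra. }
  assert (U' : forall p r, ok8 d 2 p r -> - p < 4 * f + 3 * (e * f)).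
  { clear p r. intros p r ho. destruct (Rle_dec p r) as [h|h]; [now apply (U p r)|].
    pose proof (U r p (ok8_swap _ _ _ _ ho)). lra. }
  assert (W : forall p r, ok8 d 2 p r -> 2 * f - 18 * (e * f * f) < - p).
  { clear p r. intros p r ho. pose proof (U' r p (ok8_swap _ _ _ _ ho)) as hr.
    destruct ho as [kp kr ktp ktr k1 k1' k2 k2' k3 k3' k4 k4'].
    apply Rnot_le_lt. intros hle.
    assert (e * - r <= e * (4 * f + 3 * (e * f))) by (apply Rmult_le_compat_l; lra).
    assert (c : (1 - f - p) * (1 - e - e * (2 + r)) <= (1 + f - 18 * (e * f * f)) * (1 - 3 * e + e * (4 * f + 3 * (e * f)))).
    { apply Rmult_le_compat; lra. }
    unfold low_two in hd.
    assert (g1 : 0 < e * f * (6 * f - 43 * (e * f) + 54 * (e * f * f) + 5 * (e * (e * f)))).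
    { apply Rmult_lt_0_compat; [lra|]. assert (e * f <= 128 / 1000 * f) by (apply Rmult_le_compat_r; lra). lra. }
    assert (g2 : 0 <= (e * f) * (e * f) * (e * f)) by (repeat apply Rmult_le_pos; lra).
    assert (g3 : e * f * (e * (1 + e * f)) = e * f * (2 * f * (1 + e * f) - 2 * (e * f))) by (rewrite hrel; ring).
    lra. }
  intros ho. pose proof (ok8_swap _ _ _ _ ho) as ho'.
  pose proof (U' p r ho). pose proof (U' r p ho'). pose proof (W p r ho). pose proof (W r p ho'). lra.
Qed.

Lemma t_cases d tau p r : low_two < d -> Z.Even tau -> ok8 d (IZR tau) p r ->
  (tau = (-2)%Z /\ ok8 d 2 (- p) (- r)) \/ (tau = 0%Z /\ ok8 d 0 p r) \/ (tau = 2%Z /\ ok8 d 2 p r).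
Proof.
  intros hd he ho. destruct (even_cases tau he) as [h|[h|[h|[h|h]]]].
  - exfalso. apply ok8_neg in ho. apply IZR_le in h. apply (t_no_four d (- IZR tau) (- p) (- r)); trivial; lra.
  - left. split; [trivial|]. subst tau. apply ok8_neg in ho. now replace (- IZR (-2)) with 2 in ho by lra.
  - right; left. now subst tau.
  - right; right. now subst tau.
  - exfalso. apply IZR_le in h. apply (t_no_four d (IZR tau) p r); trivial; lra.
Qed.

Lemma t_two_side d T tau' p r p' r' : low_two < d -> Z.Even T -> Z.Even tau' -> linked T 2 tau' p r p' r' ->
  ok8 d 2 p r -> ok8 d (IZR tau') p' r' -> (T = -4 /\ tau' = 2)%Z \/ (T = -2 /\ tau' = 0)%Z.
Proof.
  intros hd hT ht [l1 l2] ho ho'. destruct three_numbers as (he & hf & hD & h2f).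
  assert (hD1 : 0 < e * f * f) by (apply Rmult_lt_0_compat; lra).
  assert (hD2 : e * f * f <= 1 / 100 * f) by (apply Rmult_le_compat_r; lra).
  assert (hD3 : e * f <= 128 / 1000 * f) by (apply Rmult_le_compat_r; lra).
  assert (hD4 : e * f * f <= 74 / 1000 * (e * f)) by (rewrite (Rmult_comm (74 / 1000)); apply Rmult_le_compat_l; lra).
  destruct (t_two_bound d p r hd ho) as [bp br].
  assert (hep : 0 < e * - p) by (apply Rmult_lt_0_compat; lra).
  assert (pos : forall x y, f * x < f * y -> x < y) by (intros x y h; apply Rmult_lt_reg_l with f; lra).
  assert (bd : forall v, - (5 * f) < v < 5 * f -> - (e * f * (5 * f)) < e * f * v < e * f * (5 * f)).
  { intros v [v1 v2]. split.
    - replace (- (e * f * (5 * f))) with (e * f * - (5 * f)) by ring. apply Rmult_lt_compat_l; lra.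
    - apply Rmult_lt_compat_l; lra. }
  destruct (t_cases d tau' p' r' hd ht ho') as [[E o]|[[E o]|[E o]]]; rewrite E in l1.
  - exfalso. destruct (t_two_bound d _ _ hd o) as [bp' br'].
    assert (hT2 : IZR T < 0).
    { apply pos. pose proof (bd r' ltac:(lra)) as q. lra. }
    assert (hT3 : (T <= -2)%Z) by (apply (lt_IZR T 0) in hT2; destruct hT as [x ->]; lia).
    apply IZR_le in hT3.
    assert (f * (IZR T + e * (2 + p)) < f * 0) by (apply Rmult_lt_compat_l; lra). lra.
  - destruct (t_zero_bound d _ _ hd o) as [bp' br']. apply Rabs_def2 in bp', br'.
    pose proof (bd r' ltac:(lra)) as q.
    assert (hT2 : IZR T < 0) by (apply pos; lra).
    assert (hT3 : -4 < IZR T).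
    { apply pos. assert (f * (e * - p) > 0) by (apply Rmult_lt_0_compat; lra). lra. }
    apply (lt_IZR T 0) in hT2. apply (lt_IZR (-4)) in hT3. right. split; [|trivial]. destruct hT as [x ->]. lia.
  - destruct (t_two_bound d _ _ hd o) as [bp' br'].
    pose proof (bd r' ltac:(lra)) as q.
    assert (hT2 : IZR T < -2) by (apply pos; lra).
    assert (hT3 : -6 < IZR T) by (apply pos; lra).
    apply (lt_IZR T (-2)) in hT2. apply (lt_IZR (-6)) in hT3. left. split; [|trivial]. destruct hT as [x ->]. lia.
Qed.

Lemma t_zero_side d T tau' p r p' r' : low_two < d -> Z.Even T -> Z.Even tau' -> linked T 0 tau' p r p' r' ->
  ok8 d 0 p r -> ok8 d (IZR tau') p' r' ->
  (T = 0 /\ tau' = 0)%Z \/ (T = -2 /\ tau' = 2)%Z \/ (T = 2 /\ tau' = -2)%Z.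
Proof.
  intros hd hT ht l ho ho'. destruct three_numbers as (he & hf & hD & h2f).
  destruct (t_cases d tau' p' r' hd ht ho') as [[E o]|[[E o]|[E o]]].
  - right; right. split; [|trivial]. subst tau'.
    assert (l' : linked (- T) 2 0 (- r') (- p') (- r) (- p)).
    { destruct l as [l1 l2]. split; [rewrite l2|rewrite l1]; rewrite opp_IZR; ring. }
    destruct (t_two_side d _ 0 _ _ _ _ hd (even_opp _ hT) ltac:(now exists 0%Z) l') as [q|q]; try lia.
    + now apply ok8_swap.
    + apply ok8_swap. replace (IZR 0) with (- 0) by lra. now apply ok8_neg.
  - left. split; [|trivial]. subst tau'. destruct l as [l1 l2].
    destruct (t_zero_bound d _ _ hd o) as [_ br']. destruct (t_zero_bound d _ _ hd ho) as [_ br].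
    apply Rabs_def2 in br, br'.
    assert (hD1 : 0 < e * f * f) by (apply Rmult_lt_0_compat; lra).
    assert (q : - (e * f * (2 * f)) < e * f * r' < e * f * (2 * f)).
    { split; [|apply Rmult_lt_compat_l; lra]. replace (- (e * f * (2 * f))) with (e * f * - (2 * f)) by ring. apply Rmult_lt_compat_l; lra. }
    assert (h1 : -2 < IZR T) by (apply Rmult_lt_reg_l with f; lra).
    assert (h2 : IZR T < 2) by (apply Rmult_lt_reg_l with f; lra).
    apply (lt_IZR (-2)) in h1. apply (lt_IZR _ 2) in h2. destruct hT as [x ->]. lia.
  - right; left. split; [|trivial]. subst tau'. apply linked_sym in l.
    destruct (t_two_side d _ 0 _ _ _ _ hd hT ltac:(now exists 0%Z) l) as [q|q]; try lia.
    + now apply ok8_swap.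
    + now apply ok8_swap.
Qed.

(** An isolated block with tau = 2 between two blocks with tau = 0: both its tails are at most 2 f +
    2 e f f in absolute value, too short for the third vertex. *)
Lemma t_not_both d p r p0 r2 : low_two < d -> ok8 d 2 p r ->
  p = f * (-2 + e * p0) -> r = f * (-2 + e * r2) -> - (2 * f) < p0 -> - (2 * f) < r2 -> False.
Proof.
  intros hd [kp kr ktp ktr k1 k1' k2 k2' k3 k3' k4 k4'] hp hr h0 h2. destruct three_numbers as (he & hf & hD & h2f).
  assert (a1 : e * f * - (2 * f) <= e * f * p0) by (apply Rmult_le_compat_l; lra).
  assert (a2 : e * f * - (2 * f) <= e * f * r2) by (apply Rmult_le_compat_l; lra).
  assert (a3 : e * - r <= e * (2 * f + 2 * (e * f * f))) by (apply Rmult_le_compat_l; lra).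
  assert (c : (1 - f - p) * (1 - e - e * (2 + r)) <= (1 + f + 2 * (e * f * f)) * (1 - 3 * e + e * (2 * f + 2 * (e * f * f)))) by (apply Rmult_le_compat; lra).
  unfold low_two in hd.
  assert (g0 : 0 < e * (e * f) <= 128 / 1000 * (e * f)) by (split; [apply Rmult_lt_0_compat|apply Rmult_le_compat_r]; lra).
  assert (g1 : e * f * f <= 74 / 1000 * (e * f)) by (rewrite (Rmult_comm (74 / 1000)); apply Rmult_le_compat_l; lra).
  assert (g2 : 0 <= e * f * f) by (repeat apply Rmult_le_pos; lra).
  assert (g3 : 0 <= (e * f) * (e * f) * (4 - 14 * f)) by (repeat apply Rmult_le_pos; lra).
  assert (g4 : (e * f) * (e * f) * (f * (e * f)) <= (e * f) * (e * f) * 1).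
  { apply Rmult_le_compat_l; [repeat apply Rmult_le_pos; lra|]. lra. }
  assert (g5 : 0 <= (e * f) * (e * f) * (e * f)) by (repeat apply Rmult_le_pos; lra).
  assert (g6 : 0 <= (e * f) * (e * f)) by (repeat apply Rmult_le_pos; lra).
  assert (g7 : (e * f) * (e * f) <= 1 / 100 * (e * f)) by (apply Rmult_le_compat_r; lra).
  lra.
Qed.

(* Here [q] is the tail beyond the neighbouring block of type [C'_2]; a further block [C'_4]
   is what makes it at least [4 f - 2 D]. *)
Lemma t_zero_center d p r q : low_two < d -> ok8 d 0 p r -> p = f * (-2 + e * (2 - q)) -> 4 * f - 2 * (e * f) <= q ->
  2 * (e * f * f) < r.
Proof.
  intros hd [kp kr ktp ktr k1 k1' k2 k2' k3 k3' k4 k4'] hp hq. destruct three_numbers as (he & hf & hD & h2f).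
  apply Rnot_le_lt. intros hle.
  assert (a1 : e * f * (4 * f - 2 * (e * f)) <= e * f * q) by (apply Rmult_le_compat_l; lra).
  assert (a2 : e * r <= e * (2 * (e * f * f))) by (apply Rmult_le_compat_l; lra).
  assert (c : (1 - f + p) * (1 - e + e * (0 + r)) <= (1 - 3 * f + 2 * (e * f) - 4 * (e * f * f) + 2 * (e * f * (e * f))) * (1 - e + e * (2 * (e * f * f)))).
  { apply Rmult_le_compat; lra. }
  unfold low_two in hd.
  assert (g1 : (e * f) * (e * f) <= 128 / 1000 * (e * f * f)).
  { replace ((e * f) * (e * f)) with (e * (e * f * f)) by ring. apply Rmult_le_compat_r; [|lra]. repeat apply Rmult_le_pos; lra. }
  assert (g2 : 0 <= e * f * f) by (repeat apply Rmult_le_pos; lra).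
  assert (g3 : 0 <= (e * f) * (e * f)) by (repeat apply Rmult_le_pos; lra).
  assert (g4 : (e * f) * (e * f) * f <= (e * f) * (e * f) * (74 / 1000)) by (apply Rmult_le_compat_l; lra).
  assert (g5 : 0 <= (e * f) * (e * f) * (e * f)) by (repeat apply Rmult_le_pos; lra).
  assert (g6 : (e * f) * (e * f) * (e * f) <= (e * f) * (e * f) * (1 / 100)) by (apply Rmult_le_compat_l; lra).
  assert (g7 : (e * f) * (e * f) * (e * f) * (e * f) <= (e * f) * (e * f) * (e * f) * (1 / 100)) by (apply Rmult_le_compat_l; lra).
  assert (g8 : 0 <= (e * f) * (e * f) * (e * f) * f) by (repeat apply Rmult_le_pos; lra).
  assert (g9 : 0 <= (e * f) * (e * f) * f) by (repeat apply Rmult_le_pos; lra).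
  assert (g11 : 0 <= e * (e * f)) by (repeat apply Rmult_le_pos; lra).
  assert (g10 : 0 <= (e * f) * (e * f) * e <= (e * f) * (e * f) * (128 / 1000)) by (split; [repeat apply Rmult_le_pos; lra|apply Rmult_le_compat_l; lra]).
  lra.
Qed.

(* The common left and right tail in the constant word of [C_4]. *)
Definition c4_tail : R := (4 * f - 2 * (e * f)) / (1 - e * f).

Lemma c4_tail_eq : c4_tail = 4 * f - 2 * (e * f) + e * f * c4_tail /\ 3 * f < c4_tail < 5 * f.
Proof.
  destruct three_numbers as (he & hf & hD & h2f).
  assert (E : c4_tail * (1 - e * f) = 4 * f - 2 * (e * f)) by (unfold c4_tail; field; lra).
  assert (hD3 : e * f <= 128 / 1000 * f) by (apply Rmult_le_compat_r; lra).
  split; [lra|].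
  assert (h1 : 0 < c4_tail).
  { unfold c4_tail. apply Rdiv_lt_0_compat; lra. }
  assert (h2 : e * f * c4_tail <= 1 / 100 * c4_tail) by (apply Rmult_le_compat_r; lra).
  assert (h3 : 0 <= e * f * c4_tail) by (apply Rmult_le_pos; lra). lra.
Qed.

(* The tail across [C_2 A'_2] followed by [C'_4] for ever, and its mirror image. *)
Definition c4_far : R := 2 * f - e * f * (2 * f - 2 * (e * f) + e * f * c4_tail).

Lemma delta_two_eq : delta_two = (1 - 3 * e + e * c4_tail) * (1 - f + c4_far).
Proof. unfold delta_two, c4_far, c4_tail. destruct three_numbers as (he & hf & hD & h2f). field. lra. Qed.

(** The excess of -r over [c4_tail] is contracted by D while the next block also has tau = 2, and
    there is no excess when the next block has tau = 0. Being bounded, it vanishes. *)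
Lemma t_right_sup d K tau T p r : low_two < d -> tail_ok d K tau T p r ->
  forall i, (K <= i)%nat -> tau i = 2%Z -> - r i <= c4_tail.
Proof.
  intros hd HT. pose proof HT as (e1 & e2 & HB & ho). destruct three_numbers as (he & hf & hD & h2f).
  destruct c4_tail_eq as [E1 E2].
  (* The positive part of the excess, set to 0 at the other blocks, so that [contract_zero] applies
     at all indices. *)
  set (w := fun k => if (tau (K + k)%nat =? 2)%Z then Rmax 0 (- r (K + k)%nat - c4_tail) else 0).
  assert (hw0 : forall k, 0 <= w k).
  { intros k. unfold w. destruct (tau (K + k)%nat =? 2)%Z; [apply Rmax_l|lra]. }
  assert (Hw : forall k, w k = 0).
  { apply (contract_zero w 1).
    - intros k. rewrite (Rabs_right (w k)), (Rabs_right (w (S k))) by (apply Rle_ge, hw0).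
      unfold w at 1. destruct (Z.eqb_spec (tau (K + k)%nat) 2) as [E|E]; [|specialize (hw0 (S k)); lra].
      pose proof (ho (K + k)%nat ltac:(lia)) as o. rewrite E in o.
      pose proof (ho (S (K + k)) ltac:(lia)) as o'.
      pose proof (tail_ok_linked _ _ _ _ _ _ (K + k)%nat HT) as l. rewrite E in l.
      destruct (t_two_side d _ _ _ _ _ _ hd (e2 (K + k)%nat) (e1 (S (K + k))) l o o') as [[q1 q2]|[q1 q2]].
      + unfold w. replace (K + S k)%nat with (S (K + k)) by lia. rewrite q2. simpl.
        destruct l as [l _]. rewrite q1, q2 in l.
        assert (q : - r (K + k)%nat - c4_tail = e * f * (- r (S (K + k)) - c4_tail)) by (rewrite l; lra).
        rewrite q. set (z := - r (S (K + k)) - c4_tail). unfold Rmax at 1. destruct Rle_dec as [hz|hz].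
        * assert (0 <= z) by (apply Rmult_le_reg_l with (e * f); lra).
          rewrite Rmax_right by lra. apply Rmult_le_compat_r; lra.
        * apply Rmult_le_pos; [lra|apply Rmax_l].
      + rewrite q2 in o'. destruct (t_zero_bound d _ _ hd o') as [_ b]. apply Rabs_def2 in b.
        destruct l as [l _]. rewrite q1, q2 in l.
        assert (hD1 : 0 < e * f * f) by (apply Rmult_lt_0_compat; lra).
        assert (e * f * - r (S (K + k)) <= e * f * (2 * f)) by (apply Rmult_le_compat_l; lra).
        assert (e * f * (2 * f) <= 1 * (2 * f) / 100) by (assert (e * f * f <= 1 / 100 * f) by (apply Rmult_le_compat_r; lra); lra).
        rewrite Rmax_left by lra. specialize (hw0 (S k)). lra.
    - intros k. rewrite Rabs_right by (apply Rle_ge, hw0). unfold w.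
      destruct (tau (K + k)%nat =? 2)%Z; [|lra]. destruct (ho (K + k)%nat ltac:(lia)) as [kp kr].
      apply Rmax_lub; lra. }
  intros i hi E. specialize (Hw (i - K)%nat). unfold w in Hw.
  replace (K + (i - K))%nat with i in Hw by lia. rewrite E in Hw. simpl in Hw.
  pose proof (Rmax_r 0 (- r i - c4_tail)). lra.
Qed.

(* The word [... C'_4 C'_2 A_2 C_4 ...] never exceeds its limit value: with [X], [Y] the deviations
   of the two outer tails from the periodic one, the two critical vertices give
   [e Y < D^2 X] and [e X < D^2 Y] up to bounded factors. *)
Lemma t_center_value d X Y : delta_two < d -> 0 <= X -> 0 <= 1 - 3 * e + e * c4_tail - e * X ->
  d <= (1 - f + c4_far + (e * f) * (e * f) * X) * (1 - 3 * e + e * c4_tail - e * Y) ->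
  d <= (1 - f + c4_far + (e * f) * (e * f) * Y) * (1 - 3 * e + e * c4_tail - e * X) -> False.
Proof.
  intros hd hX hW c1 c2. destruct three_numbers as (he & hf & hD & h2f). destruct c4_tail_eq as [E1 E2].
  rewrite delta_two_eq in hd.
  set (U := 1 - f + c4_far) in *. set (W := 1 - 3 * e + e * c4_tail) in *. set (q := e * f * (e * f)) in *.
  assert (hq : 0 < q) by (unfold q; repeat apply Rmult_lt_0_compat; lra).
  assert (hqe : q <= e * (1 / 100)).
  { unfold q. replace (e * f * (e * f)) with (e * (f * (e * f))) by ring. apply Rmult_le_compat_l; [lra|].
    assert (f * (e * f) <= 1 * (e * f)) by (apply Rmult_le_compat_r; lra). lra. }
  assert (hU : 1 / 2 <= U).
  { unfold U, c4_far. assert (e * f * (2 * f - 2 * (e * f) + e * f * c4_tail) <= 1 / 100 * 1).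
    { assert (e * f * c4_tail <= 1 * c4_tail) by (apply Rmult_le_compat_r; lra).
      assert (0 <= e * f * c4_tail) by (apply Rmult_le_pos; lra).
      assert (e * f <= 128 / 1000 * f) by (apply Rmult_le_compat_r; lra).
      apply Rmult_le_compat; lra. }
    lra. }
  assert (hW1 : 0 < W < 1).
  { unfold W. assert (0 < e * c4_tail) by (apply Rmult_lt_0_compat; lra).
    assert (e * c4_tail <= e * 1) by (apply Rmult_le_compat_l; lra). lra. }
  assert (k1 : e * X * U < q * Y * (W - e * X)) by lra.
  assert (k2 : e * Y * U < q * X * (W - e * Y)) by lra.
  assert (hXU : 0 <= e * X * U) by (repeat apply Rmult_le_pos; lra).
  assert (hY : 0 < Y).
  { apply Rnot_le_lt. intros hle. assert (0 <= q * - Y * (W - e * X)) by (repeat apply Rmult_le_pos; lra). lra. }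
  assert (k3 : e * X * U < q * Y * W).
  { assert (0 <= q * Y * (e * X)) by (repeat apply Rmult_le_pos; lra). lra. }
  assert (k4 : e * Y * U < q * X * W).
  { assert (0 <= q * X * (e * Y)) by (repeat apply Rmult_le_pos; lra). lra. }
  assert (k5 : q * W <= e * (1 / 100)).
  { assert (q * W <= q * 1) by (apply Rmult_le_compat_l; lra). lra. }
  assert (k6 : e * (1 / 2) <= e * U) by (apply Rmult_le_compat_l; lra).
  assert (k7 : 0 < (X + Y) * (e * U - q * W)) by (apply Rmult_lt_0_compat; lra). lra.
Qed.

(** The outer tails deviate from [c4_tail] by the two arguments passed to [t_center_value]; the
    first deviation is nonnegative by [t_right_sup] for the negated word, and the critical vertices
    on the two sides of the turn are its two inequalities. *)
Lemma t_center d K tau T p r i : delta_two < d -> tail_ok d K tau T p r -> (K <= i)%nat ->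
  tau i = 2%Z -> T i = (-2)%Z -> tau (S i) = 0%Z -> T (S i) = 2%Z -> tau (S (S i)) = (-2)%Z -> False.
Proof.
  intros hd HT hi t1 t2 t3 t4 t5. pose proof low_two_le as hl. destruct three_numbers as (he & hf & hD & h2f).
  destruct c4_tail_eq as [E1 E2].
  pose proof (t_right_sup d K _ _ _ _ ltac:(lra) (tail_ok_neg _ _ _ _ _ _ HT) (S (S i)) ltac:(lia)) as hs.
  unfold zneg, rneg in hs. rewrite t5, Ropp_involutive in hs. specialize (hs eq_refl).
  destruct HT as (e1 & e2 & HB & ho).
  destruct (HB i) as [b1 b2]. destruct (HB (S i)) as [b3 b4]. rewrite t1, t2, t3 in *. rewrite t4, t5 in *.
  pose proof (ho i hi) as o1. rewrite t1 in o1. pose proof (ho (S (S i)) ltac:(lia)) as o2. rewrite t5 in o2.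
  destruct o1 as [kp kr ktp ktr k1 k1' k2 k2' k3 k3' k4 k4'].
  destruct o2 as [jp jr jtp jtr j1 j1' j2 j2' j3 j3' j4 j4'].
  apply (t_center_value d (c4_tail - r (S (S i))) (c4_tail + p i)); trivial; try lra.
  - replace (1 - f + c4_far + e * f * (e * f) * (c4_tail - r (S (S i)))) with (1 - f - r i); [lra|].
    rewrite b2, b4. unfold c4_far. ring.
  - replace (1 - f + c4_far + e * f * (e * f) * (c4_tail + p i)) with (1 - f + p (S (S i))); [lra|].
    rewrite b3, b1. unfold c4_far. ring.
Qed.

(** Backwards, [t_not_both] forces another block with tau = 2 behind the transition. Then
    [t_zero_center] makes the right tail at the block with tau = 0 larger than 2 e f f, so the word
    must turn to tau = -2, which [t_center] excludes. *)
Lemma t_center_left d K tau T p r i : delta_two < d -> tail_ok d K tau T p r -> (S K <= i)%nat ->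
  tau (S i) = 0%Z -> T i = (-2)%Z -> False.
Proof.
  intros hd HT hi t1 t2. pose proof low_two_le as hl. assert (hd' : low_two < d) by lra.
  destruct three_numbers as (he & hf & hD & h2f). destruct i as [|i]; [lia|].
  pose proof HT as (e1 & e2 & HB & ho).
  assert (hD1 : 0 < e * f * f) by (apply Rmult_lt_0_compat; lra).
  assert (hD2 : e * f * f <= 1 / 100 * f) by (apply Rmult_le_compat_r; lra).
  pose proof (ho i ltac:(lia)) as o0. pose proof (ho (S i) ltac:(lia)) as o1.
  pose proof (ho (S (S i)) ltac:(lia)) as o2. pose proof (ho (S (S (S i))) ltac:(lia)) as o3. rewrite t1 in o2.
  pose proof (tail_ok_linked _ _ _ _ _ _ i HT) as l0. pose proof (tail_ok_linked _ _ _ _ _ _ (S i) HT) as l1.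
  pose proof (tail_ok_linked _ _ _ _ _ _ (S (S i)) HT) as l2. rewrite t1 in l1, l2.
  destruct (t_zero_bound d _ _ hd' o2) as [bp2 br2]. apply Rabs_def2 in bp2, br2.
  assert (s1 : tau (S i) = 2%Z).
  { destruct (t_zero_side d _ _ _ _ _ _ hd' (e2 (S i)) (e1 (S i)) (linked_sym _ _ _ _ _ _ _ l1)) as [q|[q|q]]; try lia;
    now apply ok8_swap. }
  rewrite s1 in l0, l1, o1. rewrite t2 in l1.
  assert (s0 : T i = (-4)%Z /\ tau i = 2%Z).
  { destruct (t_two_side d _ _ _ _ _ _ hd' (e2 i) (e1 i) (linked_sym _ _ _ _ _ _ _ l0)) as [q|[q1 q2]]; trivial;
      try (now apply ok8_swap).
    exfalso. rewrite q1, q2 in l0. rewrite q2 in o0. destruct (t_zero_bound d _ _ hd' o0) as [bp0 _]. apply Rabs_def2 in bp0.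
    destruct l0 as [_ l0]. destruct l1 as [l1 _]. rewrite Rplus_0_l in l0, l1.
    apply (t_not_both d (p (S i)) (r (S i)) (p i) (r (S (S i)))); trivial; lra. }
  destruct s0 as [s0 s0']. rewrite s0, s0' in l0. rewrite s0' in o0. destruct (t_two_bound d _ _ hd' o0) as [bp0 _].
  destruct l0 as [_ l0]. destruct l1 as [l11 l12].
  assert (hq : 4 * f - 2 * (e * f) <= - p (S i)).
  { rewrite l0. assert (0 <= e * f * - p i) by (apply Rmult_le_pos; lra). lra. }
  assert (hr : 2 * (e * f * f) < r (S (S i))).
  { apply (t_zero_center d (p (S (S i))) (r (S (S i))) (- p (S i))); trivial. rewrite l12. ring. }
  destruct (t_zero_side d _ _ _ _ _ _ hd' (e2 (S (S i))) (e1 (S (S (S i)))) l2 o2 o3) as [[q1 q2]|[[q1 q2]|[q1 q2]]].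
  - rewrite q2 in o3. destruct (t_zero_bound d _ _ hd' o3) as [_ br3]. apply Rabs_def2 in br3.
    destruct l2 as [l2 _]. rewrite q1, q2 in l2.
    assert (e * f * r (S (S (S i))) <= e * f * (2 * f)) by (apply Rmult_le_compat_l; lra). lra.
  - rewrite q2 in o3. destruct (t_two_bound d _ _ hd' o3) as [_ br3]. destruct l2 as [l2 _]. rewrite q1, q2 in l2.
    assert (0 <= e * f * - r (S (S (S i)))) by (apply Rmult_le_pos; lra).
    assert (e * f <= 128 / 1000 * f) by (apply Rmult_le_compat_r; lra). lra.
  - apply (t_center d K tau T p r (S i)); trivial; lia.
Qed.

(** The mirror image of [t_center_left], except that the turn which remains at the end is handled by
    that lemma for the negated word. *)
Lemma t_center_right d K tau T p r i : delta_two < d -> tail_ok d K tau T p r -> (S (S K) <= i)%nat ->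
  tau i = 0%Z -> T i = (-2)%Z -> False.
Proof.
  intros hd HT hi t1 t2. pose proof low_two_le as hl. assert (hd' : low_two < d) by lra.
  destruct three_numbers as (he & hf & hD & h2f). destruct i as [|i]; [lia|].
  pose proof HT as (e1 & e2 & HB & ho).
  assert (hD1 : 0 < e * f * f) by (apply Rmult_lt_0_compat; lra).
  assert (hD2 : e * f * f <= 1 / 100 * f) by (apply Rmult_le_compat_r; lra).
  pose proof (ho i ltac:(lia)) as o0. pose proof (ho (S i) ltac:(lia)) as o1.
  pose proof (ho (S (S i)) ltac:(lia)) as o2. pose proof (ho (S (S (S i))) ltac:(lia)) as o3. rewrite t1 in o1.
  pose proof (tail_ok_linked _ _ _ _ _ _ i HT) as l0. pose proof (tail_ok_linked _ _ _ _ _ _ (S i) HT) as l1.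
  pose proof (tail_ok_linked _ _ _ _ _ _ (S (S i)) HT) as l2. rewrite t1 in l0, l1.
  destruct (t_zero_bound d _ _ hd' o1) as [bp1 br1]. apply Rabs_def2 in bp1, br1.
  assert (s2 : tau (S (S i)) = 2%Z).
  { destruct (t_zero_side d _ _ _ _ _ _ hd' (e2 (S i)) (e1 (S (S i))) l1) as [q|[q|q]]; trivial; try lia. }
  rewrite s2 in l1, l2, o2. rewrite t2 in l1.
  assert (s3 : T (S (S i)) = (-4)%Z /\ tau (S (S (S i))) = 2%Z).
  { destruct (t_two_side d _ _ _ _ _ _ hd' (e2 (S (S i))) (e1 (S (S (S i)))) l2) as [q|[q1 q2]]; trivial.
    exfalso. rewrite q1, q2 in l2. rewrite q2 in o3. destruct (t_zero_bound d _ _ hd' o3) as [_ br3]. apply Rabs_def2 in br3.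
    destruct l2 as [l2 _]. destruct l1 as [_ l1]. rewrite Rplus_0_l in l2, l1.
    apply (t_not_both d (p (S (S i))) (r (S (S i))) (p (S i)) (r (S (S (S i))))); trivial; lra. }
  destruct s3 as [s3 s3']. rewrite s3, s3' in l2. rewrite s3' in o3. destruct (t_two_bound d _ _ hd' o3) as [_ br3].
  destruct l2 as [l2 _]. destruct l1 as [l11 l12].
  assert (hq : 4 * f - 2 * (e * f) <= - r (S (S i))).
  { rewrite l2. assert (0 <= e * f * - r (S (S (S i)))) by (apply Rmult_le_pos; lra). lra. }
  assert (hr : 2 * (e * f * f) < p (S i)).
  { apply (t_zero_center d (r (S i)) (p (S i)) (- r (S (S i)))); trivial.
    - now apply ok8_swap.
    - rewrite l11. ring. }
  destruct (t_zero_side d _ _ _ _ _ _ hd' (e2 i) (e1 i) (linked_sym _ _ _ _ _ _ _ l0) (ok8_swap _ _ _ _ o1) (ok8_swap _ _ _ _ o0))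
    as [[q1 q2]|[[q1 q2]|[q1 q2]]].
  - rewrite q2 in o0. destruct (t_zero_bound d _ _ hd' o0) as [bp0 _]. apply Rabs_def2 in bp0.
    destruct l0 as [_ l0]. rewrite q1, q2 in l0.
    assert (e * f * p i <= e * f * (2 * f)) by (apply Rmult_le_compat_l; lra). lra.
  - rewrite q2 in o0. destruct (t_two_bound d _ _ hd' o0) as [bp0 _]. destruct l0 as [_ l0]. rewrite q1, q2 in l0.
    assert (0 <= e * f * - p i) by (apply Rmult_le_pos; lra).
    assert (e * f <= 128 / 1000 * f) by (apply Rmult_le_compat_r; lra). lra.
  - apply (t_center_left d K _ _ _ _ i hd (tail_ok_neg _ _ _ _ _ _ HT)); unfold zneg; lia.
Qed.

Lemma t_classify d K tau T p r : delta_two < d -> tail_ok d K tau T p r ->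
  exists n s, (K <= n)%nat /\ (s = 1 \/ s = -1)%Z /\
    ((forall i, tau (n + i)%nat = 0%Z /\ T (n + i)%nat = 0%Z) \/
     (forall i, tau (n + i)%nat = (2 * s)%Z /\ T (n + i)%nat = (-4 * s)%Z)).
Proof.
  intros hd HT. pose proof low_two_le as hl. assert (hd' : low_two < d) by lra.
  pose proof HT as (e1 & e2 & HB & ho).
  assert (Hz : forall i, (S (S K) <= i)%nat -> tau i = 0%Z -> T i = 0%Z /\ tau (S i) = 0%Z).
  { intros i hi E. pose proof (tail_ok_linked _ _ _ _ _ _ i HT) as l. rewrite E in l.
    pose proof (ho i ltac:(lia)) as o. rewrite E in o.
    destruct (t_zero_side d _ _ _ _ _ _ hd' (e2 i) (e1 (S i)) l o (ho (S i) ltac:(lia))) as [q|[[q1 q2]|[q1 q2]]]; trivial; exfalso.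
    - now apply (t_center_right d K tau T p r i).
    - apply (t_center_right d K _ _ _ _ i hd (tail_ok_neg _ _ _ _ _ _ HT)); unfold zneg; lia. }
  destruct (classic (exists i, (S (S K) <= i)%nat /\ tau i = 0%Z)) as [[i [hi h0]]|hno].
  - exists i, 1%Z. split; [lia|]. split; [lia|]. left.
    assert (H : forall j, tau (i + j)%nat = 0%Z).
    { induction j as [|j IH]; [now rewrite Nat.add_0_r|]. rewrite Nat.add_succ_r. apply Hz; [lia|trivial]. }
    intros j. split; [apply H|]. apply Hz; [lia|apply H].
  - assert (G : forall tau T p r, tail_ok d K tau T p r -> (forall i, (S (S K) <= i)%nat -> tau i <> 0%Z) ->
      forall i, (S (S K) <= i)%nat -> tau i = 2%Z -> T i = (-4)%Z /\ tau (S i) = 2%Z).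
    { clear - hd' e8 hrel f_pos fe e_small e_lt. intros tau T p r HT Hn i hi E. pose proof HT as (e1 & e2 & HB & ho).
      pose proof (tail_ok_linked _ _ _ _ _ _ i HT) as l. rewrite E in l.
      pose proof (ho i ltac:(lia)) as o. rewrite E in o.
      destruct (t_two_side d _ _ _ _ _ _ hd' (e2 i) (e1 (S i)) l o (ho (S i) ltac:(lia))) as [q|[q1 q2]]; trivial.
      exfalso. apply (Hn (S i)); [lia|trivial]. }
    assert (G' : forall tau T p r, tail_ok d K tau T p r -> (forall i, (S (S K) <= i)%nat -> tau i <> 0%Z) ->
      tau (S (S K)) = 2%Z -> forall i, tau (S (S K) + i)%nat = 2%Z /\ T (S (S K) + i)%nat = (-4)%Z).
    { intros tau' T' p' r' HT' Hn E. assert (H : forall i, tau' (S (S K) + i)%nat = 2%Z).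
      { induction i as [|i IH]; [now rewrite Nat.add_0_r|]. rewrite Nat.add_succ_r.
        apply (G tau' T' p' r' HT' Hn); [lia|trivial]. }
      intros i. split; [apply H|]. apply (G tau' T' p' r' HT' Hn); [lia|apply H]. }
    assert (hn : forall i, (S (S K) <= i)%nat -> tau i <> 0%Z) by (intros i hi E; apply hno; now exists i).
    destruct (t_cases d _ _ _ hd' (e1 (S (S K))) (ho (S (S K)) ltac:(lia))) as [[E _]|[[E _]|[E _]]].
    + exists (S (S K)), (-1)%Z. split; [lia|]. split; [lia|]. right. intros i.
      destruct (G' _ _ _ _ (tail_ok_neg _ _ _ _ _ _ HT)) with (i := i) as [q1 q2].
      * intros j hj. unfold zneg. specialize (hn j hj). lia.
      * unfold zneg. lia.
      * unfold zneg in q1, q2. lia.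
    + exfalso. apply (hn (S (S K))); [lia|trivial].
    + exists (S (S K)), 1%Z. split; [lia|]. split; [lia|]. right. intros i.
      destruct (G' _ _ _ _ HT hn E i). lia.
Qed.

End BetaNearHalfEta.

End Combinatorics.

(** * Vertex products of the periodic words *)

Section WordInequalities.

Context (e f : R) (f_pos : 0 < f) (fe : f < e) (e_small : 4 * e <= 1 + e * f) (e_lt : e < 3 / 10).

Local Notation D := (e * f).
Local Notation ok8 := (ok8 e f).
Local Notation delta_inf := (delta_inf e f).

Lemma ok8_strict d t p r :
  -(1 - f) < p < 1 - f -> -(1 - f) < r < 1 - f ->
  -(1 - e) < e * (t + p) < 1 - e -> -(1 - e) < e * (t + r) < 1 - e ->
  d < (1 - f + p) * (1 - e + e * (t + r)) -> d < (1 - f + r) * (1 - e + e * (t + p)) ->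
  d < (1 + f + p) * (1 + e - e * (t + r)) -> d < (1 + f + r) * (1 + e - e * (t + p)) ->
  d < (1 - f - p) * (1 - e - e * (t + r)) -> d < (1 - f - r) * (1 - e - e * (t + p)) ->
  d < (1 + f - p) * (1 + e + e * (t + r)) -> d < (1 + f - r) * (1 + e + e * (t + p)) ->
  exists c, d < c /\ ok8 c t p r.
Proof.
  intros h1 h2 h3 h4 q1 q2 q3 q4 q5 q6 q7 q8.
  exists (Rmin (Rmin (Rmin ((1 - f + p) * (1 - e + e * (t + r))) ((1 - f + r) * (1 - e + e * (t + p))))
               (Rmin ((1 + f + p) * (1 + e - e * (t + r))) ((1 + f + r) * (1 + e - e * (t + p)))))
         (Rmin (Rmin ((1 - f - p) * (1 - e - e * (t + r))) ((1 - f - r) * (1 - e - e * (t + p))))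
               (Rmin ((1 + f - p) * (1 + e + e * (t + r))) ((1 + f - r) * (1 + e + e * (t + p)))))).
  split; [repeat apply Rmin_glb_lt; trivial|].
  set (m := Rmin _ _).
  assert (H : m <= m) by lra. unfold m at 2 in H.
  apply Rle_trans with (r3 := Rmin (Rmin ((1 - f + p) * (1 - e + e * (t + r))) ((1 - f + r) * (1 - e + e * (t + p))))
               (Rmin ((1 + f + p) * (1 + e - e * (t + r))) ((1 + f + r) * (1 + e - e * (t + p))))) in H as Ha; [|apply Rmin_l].
  apply Rle_trans with (r3 := Rmin (Rmin ((1 - f - p) * (1 - e - e * (t + r))) ((1 - f - r) * (1 - e - e * (t + p))))
               (Rmin ((1 + f - p) * (1 + e + e * (t + r))) ((1 + f - r) * (1 + e + e * (t + p))))) in H as Hb; [|apply Rmin_r].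
  apply Rmin4 in Ha, Hb. constructor; tauto.
Qed.

Lemma gap_ok8 L x y : f < 18 / 100 -> 3 * f <= 2 * e -> 0 <= x <= 2 -> 0 <= y <= 2 ->
  L <= (1 - f - f * x) * (1 - e + D * y) -> L <= (1 - f - f * y) * (1 - e + D * x) ->
  L <= (1 - f) * (1 - e - 2 * D) -> ok8 L 0 (- (f * x)) (f * y).
Proof.
  intros hf h32 hx hy h1 h2 h3. destruct (D_facts e f f_pos fe e_small e_lt hf h32) as (hD & hD1 & he & _).
  assert (fx : 0 <= f * x <= f * 2) by (split; [apply Rmult_le_pos|apply Rmult_le_compat_l]; lra).
  assert (fy : 0 <= f * y <= f * 2) by (split; [apply Rmult_le_pos|apply Rmult_le_compat_l]; lra).
  assert (Dx : 0 <= D * x <= D * 2) by (split; [apply Rmult_le_pos|apply Rmult_le_compat_l]; lra).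
  assert (Dy : 0 <= D * y <= D * 2) by (split; [apply Rmult_le_pos|apply Rmult_le_compat_l]; lra).
  constructor; try lra; apply Rle_trans with (1 := h3); apply Rmult_le_compat; lra.
Qed.

(** The first expression bounds [delta_inf] from above, the second bounds the critical vertices
    inside an alternating run from below, the third the remaining vertices. Hence only the vertices
    next to the letter 0 decide the value of A_0 (A_2 A'_2)^k. *)
Lemma gap_middle_bound : f < 18 / 100 -> 3 * f <= 2 * e ->
  (1 - 3 * f + 2 * (f * D)) * (1 - e + 2 * (D * D)) < (1 - 3 * f) * (1 - e + 2 * D - 2 * (D * D)) /\
  (1 - 3 * f) * (1 - e + 2 * D - 2 * (D * D)) <= (1 - f) * (1 - e - 2 * D).
Proof.
  intros hf h32. destruct (D_facts e f f_pos fe e_small e_lt hf h32) as (hD & hD1 & he & _).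
  assert (hDD : 0 < D * D < 48 / 1000 * D) by (split; [apply Rmult_lt_0_compat|apply Rmult_lt_compat_r]; lra).
  assert (hfD : f * D <= 18 / 100 * D) by (apply Rmult_le_compat_r; lra).
  split.
  - assert (h1 : (1 - 3 * f) * (2 * D - 4 * (D * D)) >= 46 / 100 * (2 * D - 4 * (D * D))) by (apply Rle_ge, Rmult_le_compat_r; lra).
    assert (h2 : 2 * (f * D) * (1 - e + 2 * (D * D)) <= 2 * (18 / 100 * D) * 1).
    { assert (D <= e * (18 / 100)) by (apply Rmult_le_compat_l; lra). assert (0 <= f * D) by (apply Rmult_le_pos; lra). apply Rmult_le_compat; lra. }
    lra.
  - assert (h1 : 0 < f * (1 - 3 * e + 4 * D)) by (apply Rmult_lt_0_compat; lra).
    assert (0 <= (1 - 3 * f) * (D * D)) by (apply Rmult_le_pos; lra). lra.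
Qed.

Lemma delta_inf_upper : f < 18 / 100 -> 3 * f <= 2 * e ->
  delta_inf <= (1 - 3 * f + 2 * (f * D)) * (1 - e + 2 * (D * D)).
Proof.
  intros hf h32. destruct (D_facts e f f_pos fe e_small e_lt hf h32) as (hD & hD1 & he & _).
  destruct (w0_facts e f f_pos fe e_small e_lt hf h32) as [E1 E2]. rewrite (delta_inf_w0 e f f_pos fe e_small e_lt hf h32).
  set (w := 2 / (1 + D)) in *.
  assert (hw : 2 - 2 * D <= w) by (assert (D * w <= D * 2) by (apply Rmult_le_compat_l; lra); lra).
  assert (h1 : f * (2 - 2 * D) <= f * w) by (apply Rmult_le_compat_l; lra).
  assert (h2 : D * D * w <= D * D * 2) by (apply Rmult_le_compat_l; [apply Rmult_le_pos|]; lra).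
  assert (h3 : f * w <= f * 2) by (apply Rmult_le_compat_l; lra).
  clearbody w.
  assert (h4 : 0 <= D * D * w) by (repeat apply Rmult_le_pos; lra).
  apply Rmult_le_compat; lra.
Qed.

(** The counterpart of [c4_excluded]: for the first vertex the leading difference is 2 (3 f - e) -
    10 D, so the sign changes near 3 a - b = 5, and the even numbers 4 and 6 lie on opposite
    sides. *)
Lemma c4_ok8 : 2 * f <= e -> 6 * e <= 1 + D -> 6 * D <= (3 * f - e) * (1 + D) ->
  exists c, delta_inf < c /\ ok8 c (- 2) ((4 * f - 2 * D) / (1 - D)) ((4 * f - 2 * D) / (1 - D)).
Proof.
  intros hef h6 hc.
  assert (hD0 : 0 < D) by (apply Rmult_lt_0_compat; lra).
  assert (he : e < 172 / 1000).
  { assert (D <= e * (15 / 100)) by (apply Rmult_le_compat_l; lra). nra. }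
  assert (hf : f < 18 / 100) by lra.
  assert (hD : D <= 172 / 1000 * f) by (apply Rmult_le_compat_r; lra).
  assert (hDe : D <= 86 / 1000 * e) by (rewrite (Rmult_comm (86 / 1000)); apply Rmult_le_compat_l; lra).
  pose proof (delta_inf_upper hf ltac:(lra)) as hdu.
  set (r := (4 * f - 2 * D) / (1 - D)).
  assert (E : r = 4 * f - 2 * D + D * r) by (unfold r; field; lra).
  assert (r1 : 0 < r) by (unfold r; apply Rdiv_lt_0_compat; lra).
  assert (r2 : D * r <= 15 / 1000 * r) by (apply Rmult_le_compat_r; lra).
  assert (r3 : r < 42 / 10 * f) by lra.
  assert (r4 : 3 * f < r) by (assert (0 < D * r) by (apply Rmult_lt_0_compat; lra); lra).
  assert (r5 : D * (3 * f) <= D * r <= D * (42 / 10 * f)) by (split; apply Rmult_le_compat_l; lra).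
  assert (er : e * r = 4 * D - 2 * (e * D) + e * (D * r)) by (rewrite E at 1; ring).
  assert (er2 : 0 < e * r) by (apply Rmult_lt_0_compat; lra).
  assert (er3 : e * (3 * f) <= e * r <= e * (42 / 10 * f)) by (split; apply Rmult_le_compat_l; lra).
  assert (hc2 : 6 * D - 6 * (D * D) <= 3 * f - e).
  { apply Rmult_le_reg_r with (1 + D); [lra|]. assert (0 <= D * D * D) by (repeat apply Rmult_le_pos; lra). lra. }
  assert (hfD : 0 < f * D <= 86 / 1000 * D) by (split; [apply Rmult_lt_0_compat|apply Rmult_le_compat_r]; lra).
  assert (hDD : 0 < D * D <= 172 / 1000 * (f * D)).
  { split; [apply Rmult_lt_0_compat; lra|]. replace (D * D) with (e * (f * D)) by ring. apply Rmult_le_compat_r; lra. }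
  assert (heD : 0 < e * D <= 172 / 1000 * D) by (split; [apply Rmult_lt_0_compat|apply Rmult_le_compat_r]; lra).
  assert (hu : (1 - 3 * f + 2 * (f * D)) * (1 - e + 2 * (D * D)) <= 1 - 3 * f - e + 3 * D + 2 * (f * D) + 2 * (D * D)).
  { assert (0 <= D * D * (6 * f - 4 * (f * D) + 2)) by (apply Rmult_le_pos; lra). lra. }
  assert (hDr : 0 <= D * r <= 42 / 10 * (f * D)) by lra.
  assert (hfr : f * r <= f * (42 / 10 * f)) by (apply Rmult_le_compat_l; lra).
  assert (k1 : 1 - 3 * f - e + 3 * D + 2 * (f * D) + 2 * (D * D) < (1 - f + r) * (1 - 3 * e + e * r)).
  { apply Rlt_le_trans with ((1 + 3 * f - 2 * D + 3 * (f * D)) * (1 - 3 * e + 4 * D - 2 * (e * D))).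
    + assert (0 <= f * D * (e * D)) by (repeat apply Rmult_le_pos; lra).
      assert (f * D * (e * D) <= f * D * 1) by (apply Rmult_le_compat_l; lra).
      assert (0 <= f * D * D) by (repeat apply Rmult_le_pos; lra).
      assert (0 <= D * (e * D)) by (repeat apply Rmult_le_pos; lra).
      assert (hDDe : D * D * e <= D * D * 1) by (apply Rmult_le_compat_l; lra). lra.
    + assert (0 <= e * (D * r)) by (apply Rmult_le_pos; lra). apply Rmult_le_compat; lra. }
  assert (heDr : e * (D * r) <= e * (1 / 2 * D)) by (apply Rmult_le_compat_l; lra).
  assert (heDr0 : 0 <= e * (D * r)) by (apply Rmult_le_pos; lra).
  assert (k3 : 1 - 3 * f - e + 3 * D + 2 * (f * D) + 2 * (D * D) < (1 - f - r) * (1 + e - e * r)).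
  { apply Rlt_le_trans with ((1 - 5 * f + 15 / 10 * D) * (1 + e - 4 * D)); [|apply Rmult_le_compat; lra]. lra. }
  assert (k4 : 1 - 3 * f - e + 3 * D + 2 * (f * D) + 2 * (D * D) < (1 + f - r) * (1 - e + e * r)).
  { apply Rlt_le_trans with ((1 - 3 * f + 15 / 10 * D) * (1 - e + 35 / 10 * D)); [|apply Rmult_le_compat; lra]. lra. }
  assert (k2 : 1 < (1 + f + r) * (1 + 3 * e - e * r)).
  { apply Rlt_le_trans with ((1 + f + r) * 1); [lra|]. apply Rmult_le_compat_l; lra. }
  apply ok8_strict; lra.
Qed.

(** * The case b = 2a - 2: vertex products *)

Section EvenTwoAMinusTwo.

Context (e8 : 8 * e <= 1 + D) (hrel : e * (1 + D) = 2 * f * (1 + D) - 2 * D).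

(** A number above [delta_two] and below all vertex products of the words in question other than the
    first vertices at blocks of type C; only those need individual attention. *)
Definition two_bound : R := (1 - 3 * e + 4 * D - 2 * (e * D) + 5 * (D * D)) * (1 + f).

Lemma two_word_facts : e < 128 / 1000 /\ f < 74 / 1000 /\ 0 < D < 1 / 100 /\ e <= 2 * f /\ 2 * f - 2 * D <= e /\
  0 < D * D <= 1 / 100 * D /\ 0 < f * D <= 74 / 1000 * D /\ 0 < e * D <= 128 / 1000 * D /\ D <= 128 / 1000 * f /\
  D * D <= 128 / 1000 * (f * D) /\ D <= 74 / 1000 * e.
Proof.
  destruct (three_numbers e f f_pos fe e_lt e8 hrel) as (h1 & h2 & h3 & h4).
  assert (D <= 128 / 1000 * f) by (apply Rmult_le_compat_r; lra).
  assert (hDD : 0 < D * D <= 1 / 100 * D) by (split; [apply Rmult_lt_0_compat|apply Rmult_le_compat_r]; lra).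
  assert (0 < f * D <= 74 / 1000 * D) by (split; [apply Rmult_lt_0_compat|apply Rmult_le_compat_r]; lra).
  assert (0 < e * D <= 128 / 1000 * D) by (split; [apply Rmult_lt_0_compat|apply Rmult_le_compat_r]; lra).
  assert (D * D <= 128 / 1000 * (f * D)).
  { replace (D * D) with (e * (f * D)) by ring. apply Rmult_le_compat_r; lra. }
  assert (D <= 74 / 1000 * e) by (rewrite (Rmult_comm (74 / 1000)); apply Rmult_le_compat_l; lra).
  assert (2 * f - 2 * D <= e).
  { apply Rmult_le_reg_r with (1 + D); lra. }
  tauto.
Qed.

Lemma two_word_ok8 L p r : 2 * f - 2 * (f * D) <= p <= 4 * f - 2 * D + 5 * (f * D) ->
  2 * f - 2 * (f * D) <= r <= 4 * f - 2 * D + 5 * (f * D) -> L <= two_bound ->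
  L <= (1 - f + p) * (1 - 3 * e + e * r) -> L <= (1 - f + r) * (1 - 3 * e + e * p) -> ok8 L (- 2) p r.
Proof.
  destruct two_word_facts as (h1 & h2 & h3 & h4 & h5 & h6 & h7 & h8 & h9 & h10 & h11).
  assert (He : forall x, 2 * f - 2 * (f * D) <= x <= 4 * f - 2 * D + 5 * (f * D) ->
    2 * D - 2 * (D * D) <= e * x <= 4 * D - 2 * (e * D) + 5 * (D * D)).
  { intros x hx. split; [apply Rle_trans with (e * (2 * f - 2 * (f * D)))|apply Rle_trans with (e * (4 * f - 2 * D + 5 * (f * D)))];
      lra || (apply Rmult_le_compat_l; lra). }
  assert (b3 : two_bound <= (1 - 5 * f + 2 * D - 5 * (f * D)) * (1 + e - 4 * D + 2 * (e * D) - 5 * (D * D))) by (unfold two_bound; nra).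
  assert (b4 : two_bound <= (1 - 3 * f + 2 * D - 5 * (f * D)) * (1 - e + 2 * D - 2 * (D * D))) by (unfold two_bound; nra).
  assert (b2 : two_bound <= 1) by (unfold two_bound; nra).
  assert (c3 : forall x y, 2 * f - 2 * (f * D) <= x <= 4 * f - 2 * D + 5 * (f * D) ->
    2 * f - 2 * (f * D) <= y <= 4 * f - 2 * D + 5 * (f * D) -> two_bound <= (1 - f - x) * (1 + e - e * y)).
  { intros x y hx hy. specialize (He y hy). apply Rle_trans with (1 := b3). apply Rmult_le_compat; lra. }
  assert (c4 : forall x y, 2 * f - 2 * (f * D) <= x <= 4 * f - 2 * D + 5 * (f * D) ->
    2 * f - 2 * (f * D) <= y <= 4 * f - 2 * D + 5 * (f * D) -> two_bound <= (1 + f - x) * (1 - e + e * y)).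
  { intros x y hx hy. specialize (He y hy). apply Rle_trans with (1 := b4). apply Rmult_le_compat; lra. }
  assert (c2 : forall x y, 2 * f - 2 * (f * D) <= x <= 4 * f - 2 * D + 5 * (f * D) ->
    2 * f - 2 * (f * D) <= y <= 4 * f - 2 * D + 5 * (f * D) -> two_bound <= (1 + f + x) * (1 + 3 * e - e * y)).
  { intros x y hx hy. specialize (He y hy). apply Rle_trans with (1 := b2).
    apply Rle_trans with (1 * 1); [lra|]. apply Rmult_le_compat; lra. }
  intros hp hr hL k1 k2. pose proof (He p hp). pose proof (He r hr).
  pose proof (c2 p r hp hr). pose proof (c2 r p hr hp). pose proof (c3 p r hp hr). pose proof (c3 r p hr hp).
  pose proof (c4 p r hp hr). pose proof (c4 r p hr hp). clear He c2 c3 c4 b2 b3 b4.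
  constructor; lra.
Qed.

Lemma two_word_turn L z : 2 * f - 2 * D <= z <= 2 * f - 2 * D + 5 * (f * D) -> L <= two_bound ->
  ok8 L 0 (- z) z.
Proof.
  destruct two_word_facts as (h1 & h2 & h3 & h4 & h5 & h6 & h7 & h8 & h9 & h10 & h11).
  intros hz hL.
  assert (He : 2 * D - 2 * (e * D) <= e * z <= 2 * D).
  { split; [apply Rle_trans with (e * (2 * f - 2 * D))|apply Rle_trans with (e * (2 * f))];
      lra || (apply Rmult_le_compat_l; lra). }
  assert (b1 : two_bound <= (1 - 3 * f + 2 * D - 5 * (f * D)) * (1 - e + 2 * D - 2 * (e * D))) by (unfold two_bound; nra).
  assert (b2 : two_bound <= (1 - f) * (1 - e - 2 * D)) by (unfold two_bound; nra).
  assert (k1 : two_bound <= (1 - f - z) * (1 - e + e * z)) by (apply Rle_trans with (1 := b1); apply Rmult_le_compat; lra).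
  assert (k2 : two_bound <= (1 - f + z) * (1 - e - e * z)) by (apply Rle_trans with (1 := b2); apply Rmult_le_compat; lra).
  assert (k3 : two_bound <= (1 + f - z) * (1 + e - e * z)) by (apply Rle_trans with (1 := b2); apply Rmult_le_compat; lra).
  assert (k4 : two_bound <= (1 + f + z) * (1 + e + e * z)) by (apply Rle_trans with (1 := b2); apply Rmult_le_compat; lra).
  constructor; lra.
Qed.

Lemma two_bound_high h l : 4 * f - 2 * D <= h -> 2 * f - 2 * (f * D) <= l ->
  two_bound <= (1 - f + h) * (1 - 3 * e + e * l).
Proof.
  destruct two_word_facts as (h1 & h2 & h3 & h4 & h5 & h6 & h7 & h8 & h9 & h10 & h11).
  intros hh hl.
  assert (He : 2 * D - 2 * (D * D) <= e * l).
  { apply Rle_trans with (e * (2 * f - 2 * (f * D))); [lra|apply Rmult_le_compat_l; lra]. }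
  apply Rle_trans with ((1 + 3 * f - 2 * D) * (1 - 3 * e + 2 * D - 2 * (D * D))); [unfold two_bound; nra|].
  apply Rmult_le_compat; lra.
Qed.

Lemma delta_two_lt_bound : delta_two e f < two_bound.
Proof.
  destruct two_word_facts as (h1 & h2 & h3 & h4 & h5 & h6 & h7 & h8 & h9 & h10 & h11).
  destruct (c4_tail_eq e f f_pos fe e_lt e8 hrel) as [E1 E2].
  rewrite (delta_two_eq e f f_pos fe e_lt e8 hrel). unfold c4_far. set (R := c4_tail e f) in *.
  assert (k1 : D * (3 * f) <= D * R <= D * (5 * f)) by (split; apply Rmult_le_compat_l; lra).
  assert (k2 : e * R = 4 * D - 2 * (e * D) + e * (D * R)) by (rewrite E1 at 1; ring).
  assert (k3 : e * (D * R) <= e * (D * (5 * f))) by (apply Rmult_le_compat_l; lra).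
  assert (k4 : 0 <= e * (D * R)) by (apply Rmult_le_pos; lra).
  assert (k5 : 0 < D * (2 * f - 2 * D + D * R)) by (apply Rmult_lt_0_compat; lra).
  apply Rlt_le_trans with ((1 - 3 * e + e * R) * (1 + f)).
  - apply Rmult_lt_compat_l; lra.
  - apply Rmult_le_compat_r; lra.
Qed.

Lemma c4_ok8_two : exists c, delta_two e f < c /\ ok8 c (- 2) (c4_tail e f) (c4_tail e f).
Proof.
  destruct two_word_facts as (h1 & h2 & h3 & h4 & h5 & h6 & h7 & h8 & h9 & h10 & h11).
  destruct (c4_tail_eq e f f_pos fe e_lt e8 hrel) as [E1 E2].
  exists two_bound. split; [apply delta_two_lt_bound|].
  set (R := c4_tail e f) in *.
  assert (k1 : 0 <= D * R <= D * (5 * f)) by (split; [apply Rmult_le_pos|apply Rmult_le_compat_l]; lra).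
  apply two_word_ok8; try lra; apply two_bound_high; lra.
Qed.

End EvenTwoAMinusTwo.

Section FourSixWord.

Context (h4 : 4 * e = 1 + D) (h6 : 6 * f = 1 + D).

Lemma delta_inf_four_six : delta_inf < 3670 / 10000.
Proof.
  destruct (four_six_numbers e f f_pos fe e_small e_lt h4 h6) as (n1 & n2 & n3 & _).
  apply Rle_lt_trans with (1 := delta_inf_upper ltac:(lra) ltac:(lra)).
  assert (f * D <= 17426 / 100000 * (456 / 10000)) by (apply Rmult_le_compat; lra).
  assert (D * D <= 456 / 10000 * (456 / 10000)) by (apply Rmult_le_compat; lra).
  assert (0 <= D * D) by (apply Rmult_le_pos; lra).
  assert (0 <= f * D) by (apply Rmult_le_pos; lra).
  apply Rle_lt_trans with ((1 - 3 * (17425 / 100000) + 2 * (17426 / 100000 * (456 / 10000))) *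
    (1 - 261375 / 1000000 + 2 * (456 / 10000 * (456 / 10000)))); [apply Rmult_le_compat|]; lra.
Qed.

Lemma four_six_ok8 u v : u = f * (2 + e * (- 2 + v)) -> v = f * (2 + e * u) ->
  exists c, delta_inf < c /\ ok8 c 0 u u /\ ok8 c (- 2) v v.
Proof.
  intros E1 E2. destruct (four_six_numbers e f f_pos fe e_small e_lt h4 h6) as (n1 & n2 & n3 & _).
  (* This number separates [delta_inf] from the vertex products of the word, which are bounded below
     by products of corner values. *)
  exists (3670 / 10000). split; [pose proof delta_inf_four_six; lra|].
  assert (F1 : u = 2 * f - 2 * D + D * v) by (rewrite E1; ring).
  assert (F2 : v = 2 * f + D * u) by (rewrite E2; ring).
  assert (F3 : u * (1 - D * D) = 2 * f - 2 * D + 2 * (f * D)).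
  { replace (u * (1 - D * D)) with (u - D * (D * u)) by ring. replace (D * u) with (v - 2 * f) by lra. rewrite F1 at 1. ring. }
  assert (0 < D * D < 3 / 1000).
  { split; [apply Rmult_lt_0_compat; lra|]. apply Rle_lt_trans with (456 / 10000 * (456 / 10000)); [apply Rmult_le_compat|]; lra. }
  assert (0 < f * D < 8 / 1000).
  { split; [apply Rmult_lt_0_compat; lra|]. apply Rle_lt_trans with (17426 / 100000 * (456 / 10000)); [apply Rmult_le_compat|]; lra. }
  assert (u0 : 2 / 10 < u < 3 / 10).
  { split; apply Rmult_lt_reg_r with (1 - D * D); lra. }
  assert (v0 : 35 / 100 < v < 37 / 100).
  { assert (455 / 10000 * (2 / 10) <= D * u <= 456 / 10000 * (3 / 10)) by (split; apply Rmult_le_compat; lra). lra. }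
  assert (hv : 455 / 10000 * (35 / 100) <= D * v <= 456 / 10000 * (37 / 100)) by (split; apply Rmult_le_compat; lra).
  assert (u1 : 2731 / 10000 < u < 27445 / 100000) by lra.
  assert (hu : 455 / 10000 * (2731 / 10000) <= D * u <= 456 / 10000 * (27445 / 100000)) by (split; apply Rmult_le_compat; lra).
  assert (v1 : 3609 / 10000 < v < 3611 / 10000) by lra.
  assert (eu : 261375 / 1000000 * (2731 / 10000) <= e * u <= 26139 / 100000 * (27445 / 100000)) by (split; apply Rmult_le_compat; lra).
  assert (ev : 261375 / 1000000 * (3609 / 10000) <= e * v <= 26139 / 100000 * (3611 / 10000)) by (split; apply Rmult_le_compat; lra).
  assert (Hp : forall x y m n, m * n >= 367 / 1000 -> 0 <= m <= x -> 0 <= n <= y -> 3670 / 10000 <= x * y).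
  { intros x y m n h hx hy. apply Rle_trans with (m * n); [lra|apply Rmult_le_compat; lra]. }
  split; constructor; try lra.
  all: first [ apply (Hp _ _ (1 - 17426 / 100000 - 27445 / 100000) (1 - 26139 / 100000 - 72 / 1000)); lra
    | apply (Hp _ _ (1 - 17426 / 100000 + 3609 / 10000) (1 - 3 * (26139 / 100000) + 943 / 10000)); lra
    | apply (Hp _ _ (1 - 17426 / 100000 - 3611 / 10000) 1); lra
    | apply (Hp _ _ (8 / 10) (7 / 10)); lra
    | apply (Hp _ _ (1 / 2) (8 / 10)); lra ].
Qed.

End FourSixWord.

End WordInequalities.

(** * Values of periodic words of blocks *)

Lemma nth_bounded (P : list (Z * Z)) : exists m, forall n,
  (Z.abs (fst (nth n P (0, 0))) <= m /\ Z.abs (snd (nth n P (0, 0))) <= m)%Z.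
Proof.
  induction P as [|x P [m IH]].
  - exists 0%Z. intros [|n]; simpl; lia.
  - exists (Z.max m (Z.max (Z.abs (fst x)) (Z.abs (snd x)))). intros [|n]; simpl; [lia|specialize (IH n); lia].
Qed.

Lemma length_wpow (X : list (Z * Z)) k : length (wpow X k) = (k * length X)%nat.
Proof. induction k as [|k IH]; simpl; [trivial|]. unfold wpow in *. simpl. rewrite length_app. lia. Qed.

Lemma nth_wpow_two (x y d : Z * Z) k n : (n < 2 * k)%nat -> nth n (wpow [x; y] k) d = if Nat.even n then x else y.
Proof.
  revert n. induction k as [|k IH]; intros n hn; [lia|]. destruct n as [|[|n]]; trivial. simpl. apply IH. lia.
Qed.

Lemma nth_wpow_one (x d : Z * Z) k n : (n < k)%nat -> nth n (wpow [x] k) d = x.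
Proof. revert n. induction k as [|k IH]; intros [|n] hn; try lia; trivial. simpl. apply IH. lia. Qed.

Section Spectrum.

Context (a b : Z) (Ha : (4 <= a)%Z) (Hab : (a < b)%Z) (Hea : Z.Even a) (Heb : Z.Even b).

Local Notation e := (eta a b).
Local Notation f := (beta a b).
Local Notation D := (e * f).
Local Notation gam := (gamma_P a b).

Let f_pos : 0 < f. Proof. apply (eta_beta_facts a b Ha Hab Hea Heb). Qed.
Let fe : f < e. Proof. apply (eta_beta_facts a b Ha Hab Hea Heb). Qed.
Let e_small : 4 * e <= 1 + D. Proof. apply (eta_beta_facts a b Ha Hab Hea Heb). Qed.
Let e_lt : e < 3 / 10. Proof. apply (eta_beta_facts a b Ha Hab Hea Heb). Qed.
Let ae : IZR a * e = 1 + D. Proof. apply (eta_beta_facts a b Ha Hab Hea Heb). Qed.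
Let bf : IZR b * f = 1 + D. Proof. apply (eta_beta_facts a b Ha Hab Hea Heb). Qed.

Definition digits (P : list (Z * Z)) (tau T : nat -> Z) : Prop := forall i,
  (2 * fst (nth (i mod length P) P (0, 0)) - a + 2 = tau i /\
   2 * snd (nth (i mod length P) P (0, 0)) - b + 2 = T i)%Z.

Lemma gamma_P_represents P tau T : digits P tau T -> exists p r, represents e f a b (gam P) tau T p r.
Proof.
  intros HP. destruct (nth_bounded P) as [m Hm].
  destruct (blocks_represent e f a b f_pos fe e_lt (fun i => nth (i mod length P) P (0, 0)%Z) m)
    as (g & p & r & hg & hr); [intros i; apply Hm|].
  assert (E : gam P = g).
  { apply (uniqueness_sum (block_term e f (fun i => nth (i mod length P) P (0, 0)%Z))); trivial.
    unfold gamma_P, gamma_blocks. apply epsilon_spec. now exists g. }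
  exists p, r. rewrite E.
  replace tau with (fun i => 2 * fst (nth (i mod length P) P (0, 0)%Z) - a + 2)%Z
    by (apply functional_extensionality; intros i; apply HP).
  replace T with (fun i => 2 * snd (nth (i mod length P) P (0, 0)%Z) - b + 2)%Z
    by (apply functional_extensionality; intros i; apply HP).
  exact hr.
Qed.

(** p and r are the tails of the word repeated in both directions. The left tail of gamma itself
    begins at gamma and only converges to p. *)
Record good_word (P : list (Z * Z)) (c : R) (tau T : nat -> Z) (p r : nat -> R) : Prop := {
  good_digits : digits P tau T; good_traj : block_traj e f tau T p r;
  good_pos : 0 < c; good_ok : forall i, ok8 e f c (IZR (tau i)) (p i) (r i) }.

Lemma good_represents P c tau T p r : good_word P c tau T p r ->
  exists p0, represents e f a b (gam P) tau T p0 r.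
Proof.
  intros [HP HT hc Hok]. destruct (gamma_P_represents P tau T HP) as (p0 & r0 & HR). exists p0.
  replace r with r0; trivial. apply functional_extensionality.
  apply (represents_tail e f a b f_pos fe e_lt ae bf _ _ _ _ _ p r 1 HR HT).
  intros i. destruct (Hok i) as [_ h _]. apply Rabs_le. lra.
Qed.

Lemma good_block P c tau T p r : good_word P c tau T p r -> forall i, block_ok e f c (tau i) (p i) (r i).
Proof. intros H i. apply block_ok8. now apply H. Qed.

Lemma Mstar_eq gamma L : is_liminf_Z (Mfun e gamma) (L / (4 * (1 - D))) -> Mstar a b gamma = L.
Proof.
  intros H. unfold Mstar, M, alpha. rewrite (liminf_Z_eq _ _ H). unfold Dab. field. nra.
Qed.

Lemma good_liminf P c tau T p r : good_word P c tau T p r ->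
  liminf_nat (fun i => block_value e f (tau i) (p i) (r i)) (Mstar a b (gam P)) /\ Lstar a b (Mstar a b (gam P)) /\
  is_liminf_Z (Mfun e (gam P)) (M e (gam P)).
Proof.
  intros H. pose proof (good_block _ _ _ _ _ _ H) as Hb. destruct (good_represents _ _ _ _ _ _ H) as [p0 HR].
  destruct (liminf_nat_exists (fun i => block_value e f (tau i) (p i) (r i)) 0 c 4) as [L HL].
  { intros k _. destruct (Hb k) as [h1 h2]. split; [trivial|]. unfold block_value, cell.
    apply Rle_trans with (1 := Rmin_l _ _), Rle_trans with (1 := Rmin_l _ _), Rle_trans with (1 := Rmin_l _ _). nra. }
  destruct (word_value e f a b f_pos fe e_small e_lt ae bf _ _ _ _ _ p c L HR (good_traj _ _ _ _ _ _ H)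
    (good_pos _ _ _ _ _ _ H) Hb HL) as [h1 h2].
  rewrite (Mstar_eq _ _ h1).
  assert (h3 : is_liminf_Z (Mfun e (gam P)) (M e (gam P))) by (unfold M; now rewrite (liminf_Z_eq _ _ h1)).
  split; [trivial|split; trivial]. exists (gam P). split; [exact h2|split; [exact h3|]]. symmetry. now apply Mstar_eq.
Qed.

Lemma good_member P c tau T p r : good_word P c tau T p r ->
  Lstar a b (Mstar a b (gam P)) /\ c <= Mstar a b (gam P).
Proof.
  intros H. destruct (good_liminf _ _ _ _ _ _ H) as (h1 & h2 & _). split; [trivial|].
  apply Rnot_lt_le. intros hlt. destruct h1 as [_ h1].
  destruct (h1 ((c - Mstar a b (gam P)) / 2) ltac:(lra) 0%nat) as (k & _ & hk).
  destruct (good_block _ _ _ _ _ _ H k) as [_ h3]. lra.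
Qed.

Lemma good_exact P c tau T p r : good_word P c tau T p r ->
  (forall N, exists i, (N <= i)%nat /\ (1 - f + p i) * (1 - e + e * (IZR (tau i) + r i)) <= c) ->
  Mstar a b (gam P) = c.
Proof.
  intros H Hi. destruct (good_member _ _ _ _ _ _ H) as [_ h1]. apply Rle_antisym; [|trivial].
  destruct (good_liminf _ _ _ _ _ _ H) as ((h2 & _) & _).
  apply Rnot_lt_le. intros hlt. destruct (h2 (Mstar a b (gam P) - c) ltac:(lra)) as [N hN].
  destruct (Hi N) as (i & hi & hv). specialize (hN i hi).
  assert (Hb : block_ok e f (block_value e f (tau i) (p i) (r i)) (tau i) (p i) (r i)).
  { split; [apply (good_block _ _ _ _ _ _ H)|lra]. }
  apply block_ok8 in Hb. destruct Hb as [_ _ _ _ h _]. lra.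
Qed.

Lemma good_match gamma tau T p r K c P c' tau' T' p' r' s :
  represents e f a b gamma tau T p r -> 0 < c -> (forall i, (K <= i)%nat -> block_ok e f c (tau i) (p i) (r i)) ->
  good_word P c' tau' T' p' r' -> (s = 1 \/ s = -1)%Z ->
  (forall i, tau (K + i)%nat = (s * tau' i)%Z /\ T (K + i)%nat = (s * T' i)%Z) ->
  Mstar a b gamma = Mstar a b (gam P).
Proof.
  intros HR hc Hok H hs Hm. destruct (good_represents _ _ _ _ _ _ H) as [p0 HR'].
  destruct (matching_values e f a b f_pos fe e_small e_lt ae bf gamma tau T p r K c (gam P) tau' T' p0 r' p' c' s)
    as (L & h1 & h2); auto.
  - apply H.
  - apply H.
  - intros i. now apply good_block with (1 := H).
  - unfold Mstar, M, alpha. now rewrite (liminf_Z_eq _ _ h1), (liminf_Z_eq _ _ h2).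
Qed.

Lemma block_digits t : Z.Even t ->
  (2 * fst (blkA a b t) - a + 2 = 0 /\ 2 * snd (blkA a b t) - b + 2 = t /\
   2 * fst (blkA' a b t) - a + 2 = 0 /\ 2 * snd (blkA' a b t) - b + 2 = - t /\
   2 * fst (blkC a b t) - a + 2 = - 2 /\ 2 * snd (blkC a b t) - b + 2 = t /\
   2 * fst (blkC' a b t) - a + 2 = 2 /\ 2 * snd (blkC' a b t) - b + 2 = - t)%Z.
Proof.
  intros [t' ->]. destruct Hea as [a' ->], Heb as [b' ->]. unfold blkA, blkA', blkC, blkC'. cbn [fst snd].
  assert (h : forall x y, (x = 2 * y -> x / 2 = y)%Z) by (intros x y ->; now rewrite Z.mul_comm, Z.div_mul).
  rewrite (h (2 * a' - 2) (a' - 1))%Z, (h (2 * a' - 4) (a' - 2))%Z, (h (2 * a') a')%Z,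
    (h (2 * b' - 2 + 2 * t') (b' - 1 + t'))%Z, (h (2 * b' - 2 - 2 * t') (b' - 1 - t'))%Z by lia. lia.
Qed.

Let digits0 := block_digits 0 (ex_intro _ 0%Z eq_refl).
Let digits2 := block_digits 2 (ex_intro _ 1%Z eq_refl).
Let digits4 := block_digits 4 (ex_intro _ 2%Z eq_refl).

Lemma zero_good : good_word [blkA a b 0] ((1 - e) * (1 - f)) (fun _ => 0%Z) (fun _ => 0%Z) (fun _ => 0) (fun _ => 0).
Proof.
  constructor.
  - intros i. cbn [length]. rewrite Nat.mod_1_r. cbn [nth]. tauto.
  - intros i. lra.
  - apply Rmult_lt_0_compat; lra.
  - intros i. assert (0 < D) by (apply Rmult_lt_0_compat; lra). constructor; lra.
Qed.

Lemma delta1_zero : delta1 a b 0 = (1 - e) * (1 - f).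
Proof.
  apply (good_exact _ _ _ _ _ _ zero_good). intros N. exists N. split; [trivial|lra].
Qed.

Lemma c4_good c R : R = 4 * f - 2 * D + D * R -> 0 < c -> ok8 e f c (- 2) R R ->
  good_word [blkC a b 4] c (fun _ => (-2)%Z) (fun _ => 4%Z) (fun _ => R) (fun _ => R).
Proof.
  intros hR hc Hok. constructor; trivial.
  - intros i. cbn [length]. rewrite Nat.mod_1_r. cbn [nth]. tauto.
  - intros i. rewrite hR at 1 3. split; ring.
Qed.

Lemma even_mod_two i : (i mod 2 = if Nat.even i then 0 else 1)%nat.
Proof. rewrite <- Nat.bit0_mod, Nat.bit0_odd, <- Nat.negb_even. now destruct (Nat.even i). Qed.

Lemma alt_good c w : w * (1 + D) = 2 -> 0 < c -> ok8 e f c 0 (- (f * w)) (f * w) ->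
  good_word [blkA a b 2; blkA' a b 2] c (fun _ => 0%Z) alt_word
    (fun i => if Nat.even i then - (f * w) else f * w) (fun i => if Nat.even i then f * w else - (f * w)).
Proof.
  intros hw hc Hok. constructor; trivial.
  - intros i. simpl length. rewrite even_mod_two. unfold alt_word. destruct (Nat.even i); simpl; tauto.
  - intros i. unfold alt_word. rewrite Nat.even_succ, <- Nat.negb_even.
    assert (E : f * w = f * (2 - e * (f * w))) by (replace 2 with (w * (1 + D)) at 1 by trivial; ring).
    destruct (Nat.even i); simpl; lra.
  - intros i. destruct (Nat.even i); trivial. apply ok8_neg in Hok. rewrite Ropp_involutive, Ropp_0 in Hok. trivial.
Qed.

Lemma four_six_good c u v : u = f * (2 + e * (- 2 + v)) -> v = f * (2 + e * u) ->
  0 < c -> ok8 e f c 0 u u -> ok8 e f c (- 2) v v ->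
  good_word [blkA a b 2; blkC a b 2] c (fun i => if Nat.even i then 0 else -2)%Z (fun _ => 2%Z)
    (fun i => if Nat.even i then u else v) (fun i => if Nat.even i then u else v).
Proof.
  intros hu hv hc Hu Hv. constructor; trivial.
  - intros i. simpl length. rewrite even_mod_two. destruct (Nat.even i); simpl; tauto.
  - intros i. rewrite Nat.even_succ, <- Nat.negb_even. destruct (Nat.even i); simpl; lra.
  - intros i. destruct (Nat.even i); trivial.
Qed.

(** Absolute values of the tails along an alternating run, in units of f. *)
Fixpoint alt_orbit (x : R) (n : nat) : R := match n with O => x | S n' => 2 - D * alt_orbit x n' end.

Lemma alt_orbit_eq x n w : w * (1 + D) = 2 -> alt_orbit x n = w + (- D) ^ n * (x - w).
Proof. intros hw. induction n as [|n IH]; simpl; [ring|]. rewrite IH. rewrite <- hw. ring. Qed.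

Lemma alt_orbit_bounds x n : D <= 1 -> 0 <= x <= 2 * D -> 0 <= alt_orbit x n <= 2 /\ (n <> O -> 2 - 2 * D <= alt_orbit x n).
Proof.
  intros hD hx. assert (hD0 : 0 < D) by (apply Rmult_lt_0_compat; lra).
  induction n as [|n [IH _]]; simpl; [split; [lra|easy]|].
  assert (0 <= D * alt_orbit x n <= D * 2) by (split; [apply Rmult_le_pos|apply Rmult_le_compat_l]; lra).
  split; [|intros _]; lra.
Qed.

Lemma gap_digits k : digits ([blkA a b 0] ++ wpow [blkA a b 2; blkA' a b 2] k) (fun _ => 0%Z) (gap_word k).
Proof.
  intros i. rewrite length_app, length_wpow. simpl length. replace (1 + k * 2)%nat with (2 * k + 1)%nat by lia.
  unfold gap_word. assert (hm : (i mod (2 * k + 1) < 2 * k + 1)%nat) by (apply Nat.mod_upper_bound; lia).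
  set (m := (i mod (2 * k + 1))%nat) in *. destruct m as [|m]; simpl app; simpl nth; [simpl; tauto|].
  rewrite nth_wpow_two by lia. rewrite Nat.odd_succ. simpl. destruct (Nat.even m); tauto.
Qed.

(** At the letter 0 the run arrives with tail w; passing the zero multiplies it by D, and the orbit
    of D w must return to w after the 2 k letters of the run. The right tails are the same orbit
    read backwards. *)
Definition gap_left (w : R) (m : nat) : R :=
  match m with O => - (f * w) | S n => f * (if Nat.even n then - alt_orbit (D * w) n else alt_orbit (D * w) n) end.
Definition gap_right (k : nat) (w : R) (m : nat) : R :=
  match m with O => f * (D * w) | S n => f * (if Nat.even n then alt_orbit (D * w) (2 * k - n) else - alt_orbit (D * w) (2 * k - n)) end.

Lemma gap_good k w L : (1 <= k)%nat -> D <= 1 -> 0 <= w <= 2 -> alt_orbit (D * w) (2 * k) = w -> 0 < L ->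
  L <= (1 - f - f * w) * (1 - e + D * (D * w)) -> L <= (1 - f - f * (D * w)) * (1 - e + D * w) ->
  L <= (1 - 3 * f) * (1 - e + 2 * D - 2 * (D * D)) -> L <= (1 - f) * (1 - e - 2 * D) -> f < 18 / 100 -> 3 * f <= 2 * e ->
  good_word ([blkA a b 0] ++ wpow [blkA a b 2; blkA' a b 2] k) L (fun _ => 0%Z) (gap_word k)
    (fun i => gap_left w (i mod (2 * k + 1))) (fun i => gap_right k w (i mod (2 * k + 1))).
Proof.
  intros hk hD hw Hw hL L1 L2 L3 L4 f18 e32. assert (hD0 : 0 < D) by (apply Rmult_lt_0_compat; lra).
  assert (hDw : 0 <= D * w <= 2 * D) by (split; [apply Rmult_le_pos|rewrite (Rmult_comm 2); apply Rmult_le_compat_l]; lra).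
  pose proof (fun n => alt_orbit_bounds (D * w) n hD hDw) as Hb.
  constructor; trivial.
  - apply gap_digits.
  - apply (cyclic_traj e f (2 * k + 1) (fun _ => 0%Z)
      (fun m => if Nat.eqb m 0 then 0%Z else if Nat.odd m then 2%Z else (-2)%Z) (gap_left w) (gap_right k w)); trivial.
    + lia.
    + rewrite Nat.add_1_r. cbn [gap_left]. rewrite Nat.even_mul, Hw. simpl. ring.
    + rewrite Nat.add_1_r. cbn [gap_right]. rewrite Nat.even_mul, Nat.sub_diag. simpl. ring.
    + intros [|m] hm; cbn [gap_left gap_right]; simpl Nat.eqb; cbv iota.
      * rewrite Nat.sub_0_r, Hw. simpl Nat.even. cbv iota. cbn [alt_orbit]. split; ring.
      * rewrite Nat.odd_succ, Nat.even_succ, <- Nat.negb_even. cbn [alt_orbit].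
        replace (2 * k - m)%nat with (S (2 * k - S m)) by lia. cbn [alt_orbit].
        destruct (Nat.even m); simpl negb; cbv iota; split; ring.
  - intros i. set (m := (i mod (2 * k + 1))%nat).
    assert (hm : (m < 2 * k + 1)%nat) by (apply Nat.mod_upper_bound; lia).
    destruct m as [|n]; cbn [gap_left gap_right].
    + apply gap_ok8; trivial; lra || (split; lra).
    + assert (H : ok8 e f L 0 (- (f * alt_orbit (D * w) n)) (f * alt_orbit (D * w) (2 * k - n))).
      { destruct (Hb n) as [b1 b2], (Hb (2 * k - n)%nat) as [b3 b4].
        assert (hgen : forall x y, 2 - 2 * D <= x <= 2 -> 2 - 2 * D <= y <= 2 -> L <= (1 - f - f * x) * (1 - e + D * y)).
        { intros x y hx hy. apply Rle_trans with (1 := L3).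
          assert (f * x <= f * 2) by (apply Rmult_le_compat_l; lra).
          assert (D * (2 - 2 * D) <= D * y) by (apply Rmult_le_compat_l; lra).
          assert (0 <= D * (1 - D)) by (apply Rmult_le_pos; lra).
          apply Rmult_le_compat; lra. }
        destruct (Nat.eq_dec n 0) as [->|hn].
        - rewrite Nat.sub_0_r, Hw. cbn [alt_orbit]. apply gap_ok8; trivial; try lra.
        - destruct (Nat.eq_dec n (2 * k)) as [->|hn2].
          + rewrite Nat.sub_diag, Hw. cbn [alt_orbit]. apply gap_ok8; trivial; try lra.
          + specialize (b2 hn). specialize (b4 ltac:(lia)). apply gap_ok8; trivial; apply hgen; lra. }
      destruct (Nat.even n).
      * rewrite <- Ropp_mult_distr_r. exact H.
      * apply ok8_neg in H. rewrite Ropp_0, Ropp_involutive in H. now rewrite <- Ropp_mult_distr_r.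
Qed.

(** * The values of A_0 (A_2 A'_2)^k *)

Section Gap.

Context (f18 : f < 18 / 100) (e32 : 3 * f <= 2 * e).

(* For [t = D ^ (2 * k)] this is the fixed point [w = alt_orbit (D * w) (2 * k)], that is, the
   tail on the side of [A_0] in the word [A_0 (A_2 A'_2) ^ k] in units of [f]. *)
Definition gap_point (t : R) : R := 2 / (1 + D) * ((1 - t) / (1 - D * t)).
Definition gap_value (t : R) : R := (1 - f - f * gap_point t) * (1 - e + D * (D * gap_point t)).

Lemma D_bounds : 0 < D < 48 / 1000 /\ e < 264 / 1000.
Proof. destruct (D_facts e f f_pos fe e_small e_lt f18 e32) as (h1 & h2 & h3 & _). lra. Qed.

Lemma gap_point_lt t t' : 0 <= t < t' -> t' <= 1 -> 0 <= gap_point t' < gap_point t.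
Proof.
  intros h1 h2. destruct D_bounds as [[d1 d2] _].
  assert (D * t <= D * 1) by (apply Rmult_le_compat_l; lra).
  assert (D * t' <= D * 1) by (apply Rmult_le_compat_l; lra).
  assert (0 < 2 / (1 + D)) by (apply Rdiv_lt_0_compat; lra).
  unfold gap_point. split.
  - apply Rmult_le_pos; [lra|]. apply Rdiv_le_0_compat; lra.
  - apply Rmult_lt_compat_l; [lra|]. apply Rlt_div_l; [lra|].
    replace ((1 - t) / (1 - D * t) * (1 - D * t')) with ((1 - t) * (1 - D * t') / (1 - D * t)) by (field; lra).
    apply Rlt_div_r; [lra|]. assert (0 < (t' - t) * (1 - D)) by (apply Rmult_lt_0_compat; lra). lra.
Qed.

Lemma gap_point_bounds t : 0 <= t <= 1 -> 0 <= gap_point t <= 2 / (1 + D).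
Proof.
  intros ht. destruct D_bounds as [[d1 d2] _].
  assert (E : gap_point 0 = 2 / (1 + D)) by (unfold gap_point; field; lra).
  assert (E1 : gap_point 1 = 0) by (unfold gap_point; field; lra).
  assert (0 < 2 / (1 + D)) by (apply Rdiv_lt_0_compat; lra).
  destruct (Req_dec t 0) as [->|h0]; [lra|]. destruct (Req_dec t 1) as [->|h1]; [lra|].
  pose proof (gap_point_lt 0 t ltac:(lra) ltac:(lra)). lra.
Qed.

(** The tail decreases in t, and the value decreases in the tail: the factor with slope f outweighs
    the one with slope D^2. *)
Lemma gap_value_lt t t' : 0 <= t < t' -> t' <= 1 -> gap_value t < gap_value t'.
Proof.
  intros h1 h2. destruct D_bounds as [[d1 d2] de]. destruct (gap_point_lt t t' h1 h2) as [g1 g2].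
  destruct (gap_point_bounds t ltac:(lra)) as [_ g3].
  destruct (w0_facts e f f_pos fe e_small e_lt f18 e32) as [_ [_ w2]].
  unfold gap_value. set (x := gap_point t) in *. set (y := gap_point t') in *. clearbody x y.
  assert (k : 0 < (x - y) * (f * (1 - e) - D * D * (1 - f) + f * (D * D) * (x + y))).
  { apply Rmult_lt_0_compat; [lra|]. assert (0 <= f * (D * D) * (x + y)) by (apply Rmult_le_pos; [apply Rmult_le_pos; [|apply Rmult_le_pos]|]; lra).
    assert (D <= 1 * f) by (apply Rmult_le_compat_r; lra).
    assert (D * D <= f * (48 / 1000)) by (apply Rmult_le_compat; lra).
    assert (0 <= D * D * f) by (apply Rmult_le_pos; [apply Rmult_le_pos|]; lra).
    assert (f * (264 / 1000) >= f * e) by (apply Rle_ge, Rmult_le_compat_l; lra). lra. }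
  lra.
Qed.

Lemma gap_value_zero : gap_value 0 = delta_inf e f.
Proof.
  rewrite (delta_inf_w0 e f f_pos fe e_small e_lt f18 e32). unfold gap_value.
  replace (gap_point 0) with (2 / (1 + D)); [ring|]. unfold gap_point. destruct D_bounds. field. lra.
Qed.

Lemma pow_D k : (1 <= k)%nat -> 0 < D ^ (2 * k) <= D * D.
Proof.
  intros hk. destruct D_bounds as [[d1 d2] _]. split; [apply pow_lt; lra|].
  replace (2 * k)%nat with (2 + 2 * (k - 1))%nat by lia. rewrite pow_add.
  apply Rle_trans with (D ^ 2 * 1); [|simpl; lra]. apply Rmult_le_compat_l; [apply pow_le; lra|].
  rewrite <- (pow1 (2 * (k - 1))). apply pow_incr. lra.
Qed.

Lemma gap_word_good k : (1 <= k)%nat -> exists p r,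
  good_word ([blkA a b 0] ++ wpow [blkA a b 2; blkA' a b 2] k) (gap_value (D ^ (2 * k))) (fun _ => 0%Z) (gap_word k) p r /\
  forall n, p (n * (2 * k + 1))%nat = - (f * gap_point (D ^ (2 * k))) /\
            r (n * (2 * k + 1))%nat = f * (D * gap_point (D ^ (2 * k))).
Proof.
  intros hk. destruct D_bounds as [[d1 d2] de]. destruct (pow_D k hk) as [t1 t2].
  destruct (w0_facts e f f_pos fe e_small e_lt f18 e32) as [w1 w2].
  assert (hDD : D * D <= 48 / 1000 * D) by (apply Rmult_le_compat_r; lra).
  set (t := D ^ (2 * k)) in *.
  destruct (gap_point_bounds t ltac:(lra)) as [g1 g2].
  assert (Ht : D * t <= D * (D * D)) by (apply Rmult_le_compat_l; lra).
  assert (Ht0 : 0 < D * t) by (apply Rmult_lt_0_compat; lra).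
  assert (HDDD : D * (D * D) <= D * (48 / 1000 * D)) by (apply Rmult_le_compat_l; lra).
  assert (g3 : 2 - 2 * D <= gap_point t).
  { replace (2 - 2 * D) with (2 / (1 + D) * (1 - D * D)) by (field; lra).
    unfold gap_point. apply Rmult_le_compat_l; [lra|]. apply Rle_div_r; [lra|].
    assert (0 <= D * D * (D * t)) by (apply Rmult_le_pos; [apply Rmult_le_pos|]; lra). nra. }
  assert (Hw : alt_orbit (D * gap_point t) (2 * k) = gap_point t).
  { rewrite (alt_orbit_eq _ _ (2 / (1 + D)) w1). replace ((- D) ^ (2 * k)) with t.
    - unfold gap_point. field. lra.
    - unfold t. rewrite !pow_mult. f_equal. ring. }
  destruct (gap_middle_bound e f f_pos fe e_small e_lt f18 e32) as [m1 m2].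
  set (w := gap_point t) in *.
  assert (hfw : f * (2 - 2 * D) <= f * w <= f * 2) by (split; apply Rmult_le_compat_l; lra).
  assert (hDw : 0 <= D * w <= D * 2) by (split; [apply Rmult_le_pos|apply Rmult_le_compat_l]; lra).
  assert (hDDw : 0 <= D * (D * w) <= D * (D * 2)) by (split; [apply Rmult_le_pos|apply Rmult_le_compat_l]; lra).
  assert (hDfw : f * (D * w) <= f * w).
  { apply Rmult_le_compat_l; [lra|]. assert (D * w <= 1 * w) by (apply Rmult_le_compat_r; lra). lra. }
  exists (fun i => gap_left w (i mod (2 * k + 1))), (fun i => gap_right k w (i mod (2 * k + 1))). split.
  - assert (hv : gap_value t <= (1 - 3 * f) * (1 - e + 2 * D - 2 * (D * D))).
    { apply Rle_trans with (2 := Rlt_le _ _ m1). unfold gap_value. fold w. apply Rmult_le_compat; lra. }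
    apply gap_good; trivial; try lra.
    + unfold gap_value. fold w. apply Rmult_lt_0_compat; lra.
    + unfold gap_value. fold w. lra.
    + unfold gap_value. fold w.
      assert (0 <= (w - D * w) * (f * (1 - e) + D * (1 - f))).
      { apply Rmult_le_pos; [assert (D * w <= 1 * w) by (apply Rmult_le_compat_r; lra); lra|].
        assert (0 <= f * (1 - e)) by (apply Rmult_le_pos; lra). assert (0 <= D * (1 - f)) by (apply Rmult_le_pos; lra). lra. }
      lra.
  - intros n. rewrite Nat.Div0.mod_mul. split; reflexivity.
Qed.

Lemma delta1_eq k : delta1 a b k = gap_value (D ^ (2 * k)).
Proof.
  destruct D_bounds as [[d1 d2] _]. destruct k as [|k].
  - rewrite delta1_zero. simpl. unfold gap_value. replace (gap_point 1) with 0 by (unfold gap_point; field; lra). ring.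
  - destruct (gap_word_good (S k) ltac:(lia)) as (p & r & H & Hn). apply (good_exact _ _ _ _ _ _ H).
    intros N. exists (N * (2 * S k + 1))%nat. split; [lia|]. destruct (Hn N) as [-> ->].
    unfold gap_value. right. ring.
Qed.

Lemma delta1_decreasing k : delta1 a b (S k) < delta1 a b k.
Proof.
  destruct D_bounds as [[d1 d2] _]. rewrite !delta1_eq.
  assert (0 < D ^ (2 * k) <= 1) by (split; [apply pow_lt; lra|rewrite <- (pow1 (2 * k)); apply pow_incr; lra]).
  assert (E : D ^ (2 * S k) = D * D * D ^ (2 * k)) by (replace (2 * S k)%nat with (2 + 2 * k)%nat by lia; rewrite pow_add; ring).
  assert (D * D < 1 * 1) by (apply Rmult_le_0_lt_compat; lra).
  assert (D * D * D ^ (2 * k) < 1 * D ^ (2 * k)) by (apply Rmult_lt_compat_r; lra).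
  apply gap_value_lt; [|lra]. split; [apply pow_le|]; lra.
Qed.

Lemma delta1_gt k : delta_inf e f < delta1 a b k.
Proof.
  destruct D_bounds as [[d1 d2] _]. rewrite delta1_eq, <- gap_value_zero.
  apply gap_value_lt; [split; [lra|apply pow_lt; lra]|]. rewrite <- (pow1 (2 * k)). apply pow_incr. lra.
Qed.

Lemma delta1_limit : Un_cv (delta1 a b) (delta_inf e f).
Proof.
  destruct D_bounds as [[d1 d2] _]. apply is_lim_seq_Reals. rewrite <- gap_value_zero.
  apply is_lim_seq_ext with (fun k => gap_value ((D * D) ^ k)).
  { intros k. rewrite delta1_eq, pow_mult. f_equal. simpl. ring_simplify. f_equal. ring. }
  apply (is_lim_seq_continuous gap_value).
  - apply continuity_pt_filterlim. apply (ex_derive_continuous gap_value). unfold gap_value, gap_point.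
    auto_derive. repeat split; lra.
  - apply is_lim_seq_geom. rewrite Rabs_right by (apply Rle_ge, Rmult_le_pos; lra).
    assert (D * D < 1 * 1) by (apply Rmult_le_0_lt_compat; lra). lra.
Qed.

Lemma delta1_member k : Lstar a b (delta1 a b k).
Proof.
  destruct k as [|k]; [apply (good_member _ _ _ _ _ _ zero_good)|].
  destruct (gap_word_good (S k) ltac:(lia)) as (p & r & H & _). apply (good_member _ _ _ _ _ _ H).
Qed.

Lemma alt_word_good : exists c p r, delta_inf e f < c /\
  good_word [blkA a b 2; blkA' a b 2] c (fun _ => 0%Z) alt_word p r.
Proof.
  destruct D_bounds as [[d1 d2] de].
  destruct (w0_facts e f f_pos fe e_small e_lt f18 e32) as [w1 w2].
  destruct (gap_middle_bound e f f_pos fe e_small e_lt f18 e32) as [m1 m2].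
  pose proof (delta_inf_upper e f f_pos fe e_small e_lt f18 e32) as hu.
  set (w := 2 / (1 + D)) in *. clearbody w.
  assert (hDw : D * (19 / 10) <= D * w <= D * 2) by (split; apply Rmult_le_compat_l; lra).
  assert (hDDw : D * (2 - 2 * D) <= D * w) by (apply Rmult_le_compat_l; lra).
  assert (hfw : f * w <= f * 2) by (apply Rmult_le_compat_l; lra).
  assert (hDD : D * D <= 48 / 1000 * D) by (apply Rmult_le_compat_r; lra).
  do 3 eexists. split; [apply Rle_lt_trans with (1 := hu), m1|]. apply (alt_good _ w).
  - lra.
  - apply Rmult_lt_0_compat; lra.
  - apply gap_ok8; trivial; try lra; apply Rmult_le_compat; lra.
Qed.

Lemma delta05_member : Lstar a b (delta05 a b) /\ delta_inf e f < delta05 a b.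
Proof.
  destruct alt_word_good as (c & p & r & hc & H). destruct (good_member _ _ _ _ _ _ H) as [h1 h2].
  split; [exact h1|]. unfold delta05. lra.
Qed.

End Gap.

Lemma delta04_member c R : R = 4 * f - 2 * D + D * R -> 0 < c -> ok8 e f c (- 2) R R ->
  Lstar a b (delta04 a b) /\ c <= delta04 a b.
Proof. intros hR hc Hok. apply (good_member _ _ _ _ _ _ (c4_good c R hR hc Hok)). Qed.

(** * The values of the words in part (3) *)

Section DoubleSpiral.

Context (e8 : 8 * e <= 1 + D) (hrel : e * (1 + D) = 2 * f * (1 + D) - 2 * D).

(** The tails along a run of C_4, contracted to [c4_tail] with ratio D. *)
Fixpoint spiral (l : R) (n : nat) : R := match n with O => l | S n' => 4 * f - 2 * D + D * spiral l n' end.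

Lemma spiral_eq l n : spiral l n = c4_tail e f + D ^ n * (l - c4_tail e f).
Proof.
  destruct (c4_tail_eq e f f_pos fe e_lt e8 hrel) as [E _].
  induction n as [|n IH]; simpl; [ring|]. rewrite IH. rewrite E at 3. ring.
Qed.

(* The word of [delta2] is [h]-antiperiodic, with [h = k + 2]. *)
Definition anti_Z (h : nat) (g : nat -> Z) (m : nat) : Z := if (m <? h)%nat then g m else (- g (m - h)%nat)%Z.
Definition anti_R (h : nat) (g : nat -> R) (m : nat) : R := if (m <? h)%nat then g m else - g (m - h)%nat.

Lemma anti_cyclic_traj h tau T p r : (1 <= h)%nat ->
  tau h = (- tau 0%nat)%Z -> p h = - p 0%nat -> r h = - r 0%nat ->
  (forall m, (m < h)%nat -> p (S m) = f * (IZR (T m) + e * (IZR (tau m) + p m)) /\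
     r m = f * (IZR (T m) + e * (IZR (tau (S m)) + r (S m)))) ->
  block_traj e f (fun i => anti_Z h tau (i mod (2 * h))) (fun i => anti_Z h T (i mod (2 * h)))
    (fun i => anti_R h p (i mod (2 * h))) (fun i => anti_R h r (i mod (2 * h))).
Proof.
  intros hh h1 h2 h3 H.
  assert (E1 : forall m, (m <= h)%nat -> anti_Z h tau m = tau m /\ anti_R h p m = p m /\ anti_R h r m = r m).
  { intros m hm. unfold anti_Z, anti_R. destruct (Nat.ltb_spec m h); [tauto|].
    replace m with h by lia. rewrite Nat.sub_diag, h1, h2, h3. tauto. }
  assert (E2 : forall m, anti_Z h tau (h + m) = (- tau m)%Z /\ anti_R h p (h + m) = - p m /\
    anti_R h r (h + m) = - r m /\ anti_Z h T (h + m) = (- T m)%Z).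
  { intros m. unfold anti_Z, anti_R. destruct (Nat.ltb_spec (h + m) h); [lia|].
    replace (h + m - h)%nat with m by lia. tauto. }
  apply cyclic_traj with (N := (2 * h)%nat).
  - lia.
  - replace (2 * h)%nat with (h + h)%nat by lia. destruct (E2 h) as [-> _], (E1 0%nat ltac:(lia)) as [-> _]. lia.
  - replace (2 * h)%nat with (h + h)%nat by lia. destruct (E2 h) as (_ & -> & _), (E1 0%nat ltac:(lia)) as (_ & -> & _). lra.
  - replace (2 * h)%nat with (h + h)%nat by lia. destruct (E2 h) as (_ & _ & -> & _), (E1 0%nat ltac:(lia)) as (_ & _ & ->). lra.
  - intros m hm. destruct (le_lt_dec h m) as [hl|hl].
    + replace m with (h + (m - h))%nat by lia. destruct (H (m - h)%nat ltac:(lia)) as [q1 q2].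
      destruct (E2 (m - h)%nat) as (-> & -> & -> & ->). replace (S (h + (m - h)))%nat with (h + S (m - h))%nat by lia.
      destruct (E2 (S (m - h))) as (-> & -> & -> & _). rewrite !opp_IZR, q1. split; [ring|]. rewrite q2. ring.
    + destruct (E1 m ltac:(lia)) as (-> & -> & ->), (E1 (S m) ltac:(lia)) as (-> & -> & ->).
      unfold anti_Z. destruct (Nat.ltb_spec m h); [|lia]. now apply H.
Qed.

Definition spiral_tau (k m : nat) : Z := match m with O => 0 | S n => if (n <? k + 1)%nat then -2 else 0 end%Z.
Definition spiral_T (k m : nat) : Z := match m with O => 2 | S n => if (n <? k)%nat then 4 else 2 end%Z.
(** The half period is A_2 C_4^k C_2. At A_2 the tails are -z and z, by antiperiodicity; l is the
    tail entering the run at either end, so the right tails are the left ones in reverse order. *)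
Definition spiral_p (k : nat) (z l : R) (m : nat) : R :=
  match m with O => - z | S n => if (n <? k + 1)%nat then spiral l n else z end.
Definition spiral_r (k : nat) (z l : R) (m : nat) : R :=
  match m with O => z | S n => if (n <? k + 1)%nat then spiral l (k - n) else - z end.

Definition spiral_word (k : nat) : list (Z * Z) :=
  [blkA a b 2] ++ wpow [blkC a b 4] k ++ [blkC a b 2; blkA' a b 2] ++ wpow [blkC' a b 4] k ++ [blkC' a b 2].

Lemma spiral_digits k : digits (spiral_word k) (fun i => anti_Z (k + 2) (spiral_tau k) (i mod (2 * (k + 2))))
  (fun i => anti_Z (k + 2) (spiral_T k) (i mod (2 * (k + 2)))).
Proof.
  intros i. assert (hl : length (spiral_word k) = (2 * (k + 2))%nat).
  { unfold spiral_word. rewrite !length_app, !length_wpow. simpl. lia. }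
  rewrite hl. assert (hm : (i mod (2 * (k + 2)) < 2 * (k + 2))%nat) by (apply Nat.mod_upper_bound; lia).
  set (m := (i mod (2 * (k + 2)))%nat) in *. clearbody m. unfold spiral_word, anti_Z.
  destruct m as [|n]; [destruct (Nat.ltb_spec 0 (k + 2)); [simpl; tauto|lia]|].
  cbn [app nth]. destruct (Nat.ltb_spec (S n) (k + 2)) as [h1|h1].
  - cbn [spiral_tau spiral_T]. destruct (Nat.ltb_spec n (k + 1)) as [_|h2]; [|lia].
    destruct (Nat.ltb_spec n k) as [h3|h3].
    + rewrite app_nth1 by (rewrite length_wpow; simpl; lia). rewrite nth_wpow_one by trivial. tauto.
    + rewrite app_nth2; rewrite length_wpow; simpl length; [|lia].
      replace (n - k * 1)%nat with 0%nat by lia. cbn [app nth]. tauto.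
  - rewrite app_nth2; rewrite length_wpow; simpl length; [|lia].
    replace (n - k * 1)%nat with (S (n - (k + 1))) by lia. replace (S n - (k + 2))%nat with (n - (k + 1))%nat by lia.
    set (q := (n - (k + 1))%nat) in *. assert (hq : (q < k + 2)%nat) by lia. clearbody q. cbn [app nth].
    destruct q as [|q]; cbn [spiral_tau spiral_T nth].
    + tauto.
    + destruct (Nat.ltb_spec q (k + 1)) as [_|h2]; [|lia]. destruct (Nat.ltb_spec q k) as [h3|h3].
      * rewrite app_nth1 by (rewrite length_wpow; simpl; lia). rewrite nth_wpow_one by trivial. tauto.
      * rewrite app_nth2; rewrite length_wpow; simpl length; [|lia].
        replace (q - k * 1)%nat with 0%nat by lia. cbn [nth]. tauto.
Qed.

Lemma spiral_word_good k L z l : (1 <= k)%nat -> z = 2 * f - 2 * D + D * spiral l k -> l = 2 * f - D * z -> 0 <= l ->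
  0 < L -> L <= two_bound e f -> L <= (1 - f + l) * (1 - 3 * e + e * spiral l k) ->
  good_word (spiral_word k) L (fun i => anti_Z (k + 2) (spiral_tau k) (i mod (2 * (k + 2))))
    (fun i => anti_Z (k + 2) (spiral_T k) (i mod (2 * (k + 2))))
    (fun i => anti_R (k + 2) (spiral_p k z l) (i mod (2 * (k + 2))))
    (fun i => anti_R (k + 2) (spiral_r k z l) (i mod (2 * (k + 2)))).
Proof.
  intros hk hz hl hl0 hL0 hLb hL.
  destruct (two_word_facts e f f_pos fe e_lt e8 hrel) as (h1 & h2 & h3 & h4 & h5 & h6 & h7 & h8 & h9 & h10 & h11).
  assert (hs : forall n, 0 <= spiral l n -> 4 * f - 2 * D <= spiral l (S n)).
  { intros n hn. simpl. assert (0 <= D * spiral l n) by (apply Rmult_le_pos; lra). lra. }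
  assert (hs0 : forall n, 0 <= spiral l n).
  { induction n as [|n IH]; [exact hl0|]. specialize (hs n IH). lra. }
  assert (hz0 : 2 * f - 2 * D <= z).
  { assert (0 <= D * spiral l k) by (apply Rmult_le_pos; [lra|apply hs0]). lra. }
  assert (hl2 : l <= 2 * f) by (assert (0 <= D * z) by (apply Rmult_le_pos; lra); lra).
  assert (hs5 : forall n, spiral l n <= 5 * f).
  { induction n as [|n IH]; simpl; [lra|].
    assert (D * spiral l n <= D * (5 * f)) by (apply Rmult_le_compat_l; lra). lra. }
  assert (hsD : forall n, D * spiral l n <= 5 * (f * D)).
  { intros n. replace (5 * (f * D)) with (D * (5 * f)) by ring. apply Rmult_le_compat_l; [lra|apply hs5]. }
  pose proof (hsD k) as hsk. assert (hz1 : z <= 2 * f) by lra.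
  assert (hl1 : 2 * f - 2 * (f * D) <= l).
  { assert (D * z <= D * (2 * f)) by (apply Rmult_le_compat_l; lra). lra. }
  assert (hr : forall n, 2 * f - 2 * (f * D) <= spiral l n <= 4 * f - 2 * D + 5 * (f * D)).
  { intros [|n]; [simpl; lra|]. specialize (hs n (hs0 n)). specialize (hsD n). simpl in *. lra. }
  constructor; trivial.
  - apply spiral_digits.
  - apply anti_cyclic_traj; [lia| | | |].
    + rewrite Nat.add_succ_r. cbn [spiral_tau]. destruct (Nat.ltb_spec (k + 1) (k + 1)); [lia|trivial].
    + rewrite Nat.add_succ_r. cbn [spiral_p]. destruct (Nat.ltb_spec (k + 1) (k + 1)); [lia|ring].
    + rewrite Nat.add_succ_r. cbn [spiral_r]. destruct (Nat.ltb_spec (k + 1) (k + 1)); [lia|trivial].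
    + intros [|n] hm; cbn [spiral_tau spiral_T spiral_p spiral_r].
      * destruct (Nat.ltb_spec 0 (k + 1)); [|lia]. rewrite Nat.sub_0_r. cbn [spiral]. split; [rewrite hl|rewrite hz]; ring.
      * destruct (Nat.ltb_spec n (k + 1)); [|lia].
        destruct (Nat.ltb_spec (S n) (k + 1)), (Nat.ltb_spec n k); try lia.
        -- replace (k - n)%nat with (S (k - S n)) by lia. cbn [spiral]. split; ring.
        -- replace n with k by lia. rewrite Nat.sub_diag. cbn [spiral]. split; [rewrite hz|rewrite hl at 1]; ring.
  - intros i. assert (hm : (i mod (2 * (k + 2)) < 2 * (k + 2))%nat) by (apply Nat.mod_upper_bound; lia).
    assert (Hb : forall m, (m < k + 2)%nat -> ok8 e f L (IZR (spiral_tau k m)) (spiral_p k z l m) (spiral_r k z l m)).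
    { intros [|n] hn; cbn [spiral_tau spiral_p spiral_r].
      - apply (two_word_turn e f f_pos fe e_lt e8 hrel); trivial. lra.
      - destruct (Nat.ltb_spec n (k + 1)); [|lia].
        (* Inside the run each first vertex has a tail of at least 4 f - 2 D as its leading one.
           Only the two ends, where the leading tail is l, need the hypothesis on L. *)
        assert (Hh : forall x y, (1 <= x)%nat -> L <= (1 - f + spiral l x) * (1 - 3 * e + e * spiral l y)).
        { intros x y hx. apply Rle_trans with (1 := hLb).
          apply (two_bound_high e f f_pos fe e_lt e8 hrel); [|apply hr].
          destruct x; [lia|]. apply hs, hs0. }
        apply (two_word_ok8 e f f_pos fe e_lt e8 hrel); trivial.
        + destruct n as [|n]; [rewrite Nat.sub_0_r; exact hL|apply Hh; lia].
        + destruct (Nat.eq_dec n k) as [->|hnk]; [rewrite Nat.sub_diag; exact hL|apply Hh; lia]. }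
    unfold anti_Z, anti_R. destruct (Nat.ltb_spec (i mod (2 * (k + 2))) (k + 2)) as [hi|hi].
    + now apply Hb.
    + rewrite opp_IZR. apply ok8_neg, Hb. lia.
Qed.

(* For [t = D ^ k], the amount by which the tail next to [A_2] falls short of [c4_tail]. *)
Definition spiral_gap (t : R) : R := t * (c4_tail e f - c4_far e f) / (1 + D * D * t).
Definition spiral_value (t : R) : R :=
  (1 - f + c4_far e f + D * D * spiral_gap t) * (1 - 3 * e + e * c4_tail e f - e * spiral_gap t).

Lemma c4_far_bounds : 2 * f - 2 * (f * D) <= c4_far e f <= 2 * f /\ 3 * f <= c4_tail e f <= 5 * f.
Proof.
  destruct (two_word_facts e f f_pos fe e_lt e8 hrel) as (h1 & h2 & h3 & h4 & h5 & h6 & h7 & h8 & h9 & h10 & h11).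
  destruct (c4_tail_eq e f f_pos fe e_lt e8 hrel) as [E1 E2]. unfold c4_far.
  assert (k1 : 0 <= D * c4_tail e f <= 1 / 100 * (5 * f)) by (split; [apply Rmult_le_pos|apply Rmult_le_compat]; lra).
  assert (k2 : 0 <= D * (2 * f - 2 * D + D * c4_tail e f) <= D * (2 * f)).
  { split; [apply Rmult_le_pos|apply Rmult_le_compat_l]; try lra.
    replace (D * c4_tail e f) with (e * (f * c4_tail e f)) in * by ring.
    assert (f * c4_tail e f <= f * 2) by (apply Rmult_le_compat_l; lra).
    assert (e * (f * c4_tail e f) <= e * (f * 2)) by (apply Rmult_le_compat_l; lra). lra. }
  lra.
Qed.

Lemma spiral_gap_le t t' : 0 <= t <= t' -> 0 <= spiral_gap t <= spiral_gap t'.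
Proof.
  intros ht. destruct c4_far_bounds as [b1 b2].
  destruct (two_word_facts e f f_pos fe e_lt e8 hrel) as (_ & _ & h3 & _ & _ & h6 & _).
  assert (0 < f * D) by (apply Rmult_lt_0_compat; lra).
  assert (hfD : f * D <= f * (1 / 100)) by (apply Rmult_le_compat_l; lra).
  assert (0 <= D * D * t) by (apply Rmult_le_pos; lra). assert (0 <= D * D * t') by (apply Rmult_le_pos; lra).
  unfold spiral_gap. set (q := c4_tail e f - c4_far e f) in *. assert (hq : 0 < q) by (unfold q; lra). clearbody q.
  split; [apply Rdiv_le_0_compat; [apply Rmult_le_pos|]; lra|].
  apply Rle_div_l; [lra|]. replace (t' * q / (1 + D * D * t') * (1 + D * D * t)) with
    (t' * q * (1 + D * D * t) / (1 + D * D * t')) by (field; lra).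
  assert (0 <= (t' - t) * q) by (apply Rmult_le_pos; lra).
  apply -> Rle_div_r; lra.
Qed.

(** A larger gap raises the first factor with slope D^2 but lowers the second with slope e, and D^2
    is much smaller than e. *)
Lemma spiral_value_le t t' : 0 <= t <= t' -> spiral_value t' <= spiral_value t.
Proof.
  intros ht. destruct (spiral_gap_le t t' ht) as [g1 g2]. destruct c4_far_bounds as [b1 b2].
  destruct (two_word_facts e f f_pos fe e_lt e8 hrel) as (h1 & h2 & h3 & h4 & h5 & h6 & h7 & h8 & h9 & h10 & h11).
  unfold spiral_value. set (x := spiral_gap t) in *. set (y := spiral_gap t') in *.
  set (R := c4_tail e f) in *. set (F := c4_far e f) in *. clearbody x y R F.
  assert (k1 : D * D <= e * (1 / 100)).
  { replace (D * D) with (e * (f * D)) by ring. apply Rmult_le_compat_l; lra. }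
  assert (k2 : 0 <= e * R <= e * 1) by (split; [apply Rmult_le_pos|apply Rmult_le_compat_l]; lra).
  assert (k3 : D * D * (1 - 3 * e + e * R) <= e * (1 / 100) * 1) by (apply Rmult_le_compat; lra).
  assert (k4 : e * (1 / 100) <= e * (1 - f + F)) by (apply Rmult_le_compat_l; lra).
  assert (k5 : 0 <= D * D * e * (x + y)) by (apply Rmult_le_pos; [apply Rmult_le_pos|]; lra).
  assert (k6 : 0 <= (y - x) * (e * (1 - f + F) - D * D * (1 - 3 * e + e * R) + D * D * e * (x + y))).
  { apply Rmult_le_pos; lra. }
  lra.
Qed.

Lemma spiral_value_zero : spiral_value 0 = delta_two e f.
Proof.
  rewrite (delta_two_eq e f f_pos fe e_lt e8 hrel). unfold spiral_value, spiral_gap.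
  replace (0 * (c4_tail e f - c4_far e f) / (1 + D * D * 0)) with 0 by (field; lra). ring.
Qed.

Lemma delta2_eq k : (1 <= k)%nat -> delta2 a b k = spiral_value (D ^ k).
Proof.
  intros hk. destruct c4_far_bounds as [b1 b2].
  destruct (two_word_facts e f f_pos fe e_lt e8 hrel) as (h1 & h2 & h3 & h4 & h5 & h6 & h7 & h8 & h9 & h10 & h11).
  assert (ht : 0 < D ^ k <= 1) by (split; [apply pow_lt; lra|rewrite <- (pow1 k); apply pow_incr; lra]).
  set (X := spiral_gap (D ^ k)). set (l := c4_far e f + D * D * X).
  assert (hX : 0 <= X <= 5 * f).
  { destruct (spiral_gap_le (D ^ k) 1 ltac:(lra)) as [g1 g2]. split; [exact g1|]. apply Rle_trans with (1 := g2).
    unfold spiral_gap. apply Rle_div_l; [lra|]. assert (0 <= 5 * f * (D * D * 1)) by (apply Rmult_le_pos; lra).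
    assert (f * D <= f * (1 / 100)) by (apply Rmult_le_compat_l; lra). lra. }
  assert (hDX : 0 <= D * D * X) by (apply Rmult_le_pos; lra).
  assert (hDt : 0 <= D * D * D ^ k) by (apply Rmult_le_pos; lra).
  assert (hs : spiral l k = c4_tail e f - X).
  { rewrite spiral_eq. unfold l, X, spiral_gap. field. lra. }
  assert (hz : l = 2 * f - D * (2 * f - 2 * D + D * spiral l k)).
  { rewrite hs. unfold l, c4_far. ring. }
  assert (hv : spiral_value (D ^ k) = (1 - f + l) * (1 - 3 * e + e * spiral l k)).
  { rewrite hs. unfold spiral_value. fold X. unfold l. ring. }
  assert (hle : spiral_value (D ^ k) <= two_bound e f).
  { apply Rle_trans with (spiral_value 0); [apply spiral_value_le; lra|]. rewrite spiral_value_zero.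
    left. apply (delta_two_lt_bound e f f_pos fe e_lt e8 hrel). }
  assert (hpos : 0 < spiral_value (D ^ k)).
  { rewrite hv, hs. assert (e * (c4_tail e f - X) >= e * (- 1)) by (apply Rle_ge, Rmult_le_compat_l; lra).
    assert (f * D <= f * (1 / 100)) by (apply Rmult_le_compat_l; lra).
    apply Rmult_lt_0_compat; unfold l; lra. }
  assert (H := spiral_word_good k (spiral_value (D ^ k)) (2 * f - 2 * D + D * spiral l k) l hk eq_refl hz
    ltac:(unfold l; assert (f * D <= f * (1 / 100)) by (apply Rmult_le_compat_l; lra); lra) hpos hle (Req_le _ _ hv)).
  apply (good_exact _ _ _ _ _ _ H). intros N. exists (1 + N * (2 * (k + 2)))%nat. split; [lia|].
  rewrite Nat.Div0.mod_add, Nat.mod_small by lia. unfold anti_Z, anti_R.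
  destruct (Nat.ltb_spec 1 (k + 2)); [|lia]. cbn [spiral_tau spiral_p spiral_r].
  destruct (Nat.ltb_spec 0 (k + 1)); [|lia]. rewrite Nat.sub_0_r. cbn [spiral]. rewrite hv. right. ring.
Qed.

Lemma delta2_increasing k : (1 <= k)%nat -> delta2 a b k <= delta2 a b (S k).
Proof.
  intros hk. destruct (two_word_facts e f f_pos fe e_lt e8 hrel) as (_ & _ & h3 & _).
  rewrite !delta2_eq by lia. apply spiral_value_le.
  assert (ht : 0 < D ^ k) by (apply pow_lt; lra). simpl. split; [apply Rmult_le_pos; lra|].
  rewrite <- (Rmult_1_l (D ^ k)) at 2. apply Rmult_le_compat_r; lra.
Qed.

Lemma delta2_limit : Un_cv (delta2 a b) (delta_two e f).
Proof.
  destruct (two_word_facts e f f_pos fe e_lt e8 hrel) as (_ & _ & h3 & _).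
  apply is_lim_seq_Reals. rewrite <- spiral_value_zero.
  apply is_lim_seq_ext_loc with (fun k => spiral_value (D ^ k)).
  { exists 1%nat. intros k hk. symmetry. now apply delta2_eq. }
  apply (is_lim_seq_continuous spiral_value).
  - apply continuity_pt_filterlim. apply (ex_derive_continuous spiral_value). unfold spiral_value, spiral_gap.
    auto_derive. repeat split; lra.
  - apply is_lim_seq_geom. rewrite Rabs_right; lra.
Qed.

End DoubleSpiral.

End Spectrum.

(** * The upper part of the spectrum *)

Section Classification.

Context (a b : Z) (Ha : (4 <= a)%Z) (Hab : (a < b)%Z) (Hea : Z.Even a) (Heb : Z.Even b).

Local Notation e := (eta a b).
Local Notation f := (beta a b).
Local Notation D := (e * f).
Local Notation gam := (gamma_P a b).

Let f_pos : 0 < f. Proof. apply (eta_beta_facts a b Ha Hab Hea Heb). Qed.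
Let fe : f < e. Proof. apply (eta_beta_facts a b Ha Hab Hea Heb). Qed.
Let e_small : 4 * e <= 1 + D. Proof. apply (eta_beta_facts a b Ha Hab Hea Heb). Qed.
Let e_lt : e < 3 / 10. Proof. apply (eta_beta_facts a b Ha Hab Hea Heb). Qed.
Let ae : IZR a * e = 1 + D. Proof. apply (eta_beta_facts a b Ha Hab Hea Heb). Qed.
Let bf : IZR b * f = 1 + D. Proof. apply (eta_beta_facts a b Ha Hab Hea Heb). Qed.

Lemma Lstar_tail x d : Lstar a b x -> e <= d -> 4 * D <= d -> d < x ->
  exists gamma tau T p r K d', x = Mstar a b gamma /\ represents e f a b gamma tau T p r /\ d < d' /\
    tail_ok e f d' K tau T p r.
Proof.
  intros (gamma & hl & hM & ->) hd1 hd2 hx. exists gamma.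
  destruct (spectrum_blocks e f a b f_pos fe e_small e_lt ae bf gamma (M e gamma) d hl hM hd1 hd2 hx)
    as (tau & T & p & r & K & d' & HR & hd' & Hok).
  exists tau, T, p, r, K, d'. split; [trivial|split; [trivial|split; [trivial|]]].
  destruct (represents_chain e f a b ae bf _ _ _ _ _ HR) as (z & g & X & Y & M & hz & HC & H0 & hM' & HB & Hg & hX & hY).
  split; [|split; [|split; [trivial|]]].
  - intros i. destruct (Hg i) as [-> _]. destruct Hea as [a' ->]. exists (g (2 * i)%nat - a' + 1)%Z. lia.
  - intros i. destruct (Hg i) as [_ ->]. destruct Heb as [b' ->]. exists (g (S (2 * i)) - b' + 1)%Z. lia.
  - intros i hi. apply block_ok8. auto.
Qed.

Lemma tail_match x gamma tau T p r K d n s P c tau' T' p' r' :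
  x = Mstar a b gamma -> represents e f a b gamma tau T p r -> 0 < d -> tail_ok e f d K tau T p r ->
  (K <= n)%nat -> (s = 1 \/ s = -1)%Z -> good_word a b P c tau' T' p' r' ->
  (forall i, tau (n + i)%nat = (s * tau' i)%Z /\ T (n + i)%nat = (s * T' i)%Z) -> x = Mstar a b (gam P).
Proof.
  intros -> HR hd (_ & _ & _ & Hok) hn hs HG Hm.
  apply (good_match a b Ha Hab Hea Heb gamma tau T p r n d P c tau' T' p' r' s); trivial.
  intros i hi. apply block_ok8, Hok. lia.
Qed.

(** Two opposite vertices suffice: the first and third products multiply to ((1 - f)^2 - q^2)((1 -
    e)^2 - y^2). *)
Lemma Lstar_upper x : Lstar a b x -> x <= (1 - e) * (1 - f).
Proof.
  intros hx. apply Rnot_lt_le. intros hlt.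
  assert (hD : 0 < D <= 3 / 10 * (3 / 10)) by (split; [apply Rmult_lt_0_compat|apply Rmult_le_compat]; lra).
  assert (h0 : 7 / 10 * (7 / 10) <= (1 - e) * (1 - f)) by (apply Rmult_le_compat; lra).
  destruct (Lstar_tail x ((1 - e) * (1 - f)) hx ltac:(lra) ltac:(lra) hlt)
    as (gamma & tau & T & p & r & K & d & _ & _ & hd & (_ & _ & _ & Hok)).
  destruct (Hok K (le_n K)) as [hp hr _ hy h1 _ _ _ h3 _ _ _].
  set (y := e * (IZR (tau K) + r K)) in *. set (q := p K) in *.
  assert (k1 : d * d <= ((1 - f + q) * (1 - e + y)) * ((1 - f - q) * (1 - e - y))) by (apply Rmult_le_compat; lra).
  assert (k2 : (1 - e) * (1 - f) * ((1 - e) * (1 - f)) < d * d) by (apply Rmult_le_0_lt_compat; lra).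
  assert (k3 : 0 <= q * q) by apply Rle_0_sqr. assert (k4 : 0 <= y * y) by apply Rle_0_sqr.
  assert (k5 : ((1 - f) * (1 - f) - q * q) * ((1 - e) * (1 - e) - y * y) <= ((1 - f) * (1 - f)) * ((1 - e) * (1 - e))).
  { assert (0 <= (1 - f - q) * (1 - f + q)) by (apply Rmult_le_pos; lra).
    assert (0 <= (1 - e - y) * (1 - e + y)) by (apply Rmult_le_pos; lra).
    apply Rmult_le_compat; lra. }
  lra.
Qed.

Lemma Lstar_max : is_max (Lstar a b) (delta1 a b 0) /\ delta1 a b 0 = (1 - e) * (1 - f).
Proof.
  pose proof (delta1_zero a b Ha Hab Hea Heb) as E. split; [|exact E]. split.
  - apply (good_member a b Ha Hab Hea Heb _ _ _ _ _ _ (zero_good a b Ha Hab Hea Heb)).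
  - rewrite E. apply Lstar_upper.
Qed.

Lemma zero_tail_match x gamma tau T p r K d : f < 18 / 100 -> 3 * f <= 2 * e ->
  x = Mstar a b gamma -> represents e f a b gamma tau T p r -> delta_inf e f < d -> tail_ok e f d K tau T p r ->
  (forall i, (K <= i)%nat -> tau i = 0%Z) -> (exists k, x = delta1 a b k) \/ x = delta05 a b.
Proof.
  intros f18 e32 hx HR hd HT H0.
  pose proof (delta_inf_lower e f f_pos fe e_lt) as hlow.
  assert (hpos : 0 < (1 - e) * (1 - 3 * f)) by (apply Rmult_lt_0_compat; lra).
  pose proof (tail_zero_tail e f f_pos fe e_small e_lt d K tau T p r ltac:(lra) HT H0) as HZ.
  destruct (zero_tail_classify e f f_pos fe e_small e_lt f18 e32 d K T _ _ hd HZ) as (n & s & hn & hs & Hc).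
  pose proof (tail_match x gamma tau T p r K d n s) as TM.
  destruct Hc as [Hc|[Hc|(k & hk & Hc)]].
  - left. exists 0%nat. apply (TM _ _ _ _ _ _ hx HR ltac:(lra) HT hn hs (zero_good a b Ha Hab Hea Heb)).
    intros i. rewrite H0, Hc by lia. lia.
  - right. destruct (alt_word_good a b Ha Hab Hea Heb f18 e32) as (c & p' & r' & _ & HG).
    apply (TM _ _ _ _ _ _ hx HR ltac:(lra) HT hn hs HG). intros i. rewrite H0 by lia. rewrite Hc. lia.
  - left. exists k. destruct (gap_word_good a b Ha Hab Hea Heb f18 e32 k hk) as (p' & r' & HG & _).
    apply (TM _ _ _ _ _ _ hx HR ltac:(lra) HT hn hs HG). intros i. rewrite H0 by lia. rewrite Hc. lia.
Qed.

Lemma delta_inf_eq : delta_inf1 a b = delta_inf e f.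
Proof. reflexivity. Qed.

Lemma beta_lt : f < 18 / 100.
Proof.
  assert (hb : (6 <= b)%Z) by (destruct Hea as [a' Ea], Heb as [b' Eb]; lia).
  apply IZR_le in hb. assert (6 * f <= IZR b * f) by (apply Rmult_le_compat_r; lra).
  assert (D <= 3 / 10 * f) by (apply Rmult_le_compat_r; lra). lra.
Qed.

Lemma ratio_le m n : (0 <= n)%Z -> (n * a <= m * b)%Z -> IZR n * f <= IZR m * e.
Proof.
  intros hn h. apply IZR_le in h. rewrite !mult_IZR in h.
  assert (ha : 0 < IZR a) by (apply IZR_lt; lia). apply Rmult_le_reg_l with (IZR a); [lra|].
  assert (IZR n * IZR a * f <= IZR m * IZR b * f) by (apply Rmult_le_compat_r; lra).
  assert (IZR m * (IZR a * e) = IZR m * (IZR b * f)) by (rewrite ae, bf; ring). lra.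
Qed.

(** From f (1 + D) = a D and e (1 + D) = b D. It turns the parity gap between b <= 3a - 6 and b >=
    3a - 4 into the gap between 6 D and 4 D. *)
Lemma block_relation : (3 * f - e) * (1 + D) = IZR (3 * a - b) * D.
Proof.
  rewrite minus_IZR, mult_IZR. replace ((3 * f - e) * (1 + D)) with (3 * f * (1 + D) - e * (1 + D)) by ring.
  rewrite <- ae at 1. rewrite <- bf. ring.
Qed.

Lemma eta_le_sixth : (6 <= a)%Z -> 6 * e <= 1 + D.
Proof. intros h. apply IZR_le in h. rewrite <- ae. apply Rmult_le_compat_r; lra. Qed.

Lemma D_pos : 0 < D.
Proof. apply Rmult_lt_0_compat; lra. Qed.

Lemma three_a_cond : (6 <= 3 * a - b)%Z <-> 6 * D <= (3 * f - e) * (1 + D).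
Proof.
  rewrite block_relation. pose proof D_pos. split; intros h.
  - apply IZR_le in h. apply Rmult_le_compat_r; lra.
  - apply le_IZR. apply Rmult_le_reg_r with D; lra.
Qed.

(** * The spectrum for 2a <= b *)

Section WideRange.

Context (h2a : (2 * a <= b)%Z).

Let hef : 2 * f <= e.
Proof. pose proof (ratio_le 1 2 ltac:(lia) ltac:(lia)). lra. Qed.

Lemma wide_first : 6 * e <= 1 + D \/ (4 * e = 1 + D /\ (e = 2 * f \/ 10 * f <= 1 + D)).
Proof.
  destruct (Z_le_gt_dec 6 a) as [h|h]; [left; now apply eta_le_sixth|right].
  assert (E : a = 4%Z) by (destruct Hea as [a' ->]; lia).
  assert (E4 : 4 * e = 1 + D) by (rewrite <- ae, E; reflexivity). split; [exact E4|].
  destruct (Z_le_gt_dec 10 b) as [h'|h'].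
  - right. apply IZR_le in h'. rewrite <- bf. apply Rmult_le_compat_r; lra.
  - left. assert (E' : b = 8%Z) by (destruct Heb as [b' ->]; lia).
    assert (8 * f = 1 + D) by (rewrite <- bf, E'; reflexivity). lra.
Qed.

Lemma wide_second : 6 * D <= (3 * f - e) * (1 + D) \/ (3 * f - e) * (1 + D) <= 4 * D.
Proof.
  destruct (Z_le_gt_dec 6 (3 * a - b)) as [h|h]; [left; now apply three_a_cond|right].
  assert (h' : (3 * a - b <= 4)%Z) by (destruct Hea as [a' ->], Heb as [b' ->]; lia).
  rewrite block_relation. apply IZR_le in h'. pose proof D_pos. apply Rmult_le_compat_r; lra.
Qed.

Lemma wide_c4 : 6 * e <= 1 + D -> 6 * D <= (3 * f - e) * (1 + D) -> exists c R,
  delta_inf e f < c /\ R = 4 * f - 2 * D + D * R /\ ok8 e f c (- 2) R R /\ 0 < c.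
Proof.
  intros h6 hc. pose proof D_pos. destruct (c4_ok8 e f f_pos fe e_small e_lt hef h6 hc) as (c & h1 & h2).
  pose proof (delta_inf_lower e f f_pos fe e_lt).
  assert (0 < (1 - e) * (1 - 3 * f)) by (apply Rmult_lt_0_compat; lra).
  exists c, ((4 * f - 2 * D) / (1 - D)). split; [trivial|]. split; [|split; [trivial|lra]].
  assert (D <= 3 / 10 * f) by (apply Rmult_le_compat_r; lra). field. lra.
Qed.

Lemma wide_two x gamma tau T p r K d i : x = Mstar a b gamma -> represents e f a b gamma tau T p r ->
  delta_inf e f < d -> tail_ok e f d K tau T p r -> (K <= i)%nat -> (tau i = 2 \/ tau i = -2)%Z ->
  (6 <= 3 * a - b)%Z /\ x = delta04 a b.
Proof.
  intros hx HR hd HT hi h2.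
  assert (Hs : exists s, (s = 1 \/ s = -1)%Z /\ (forall j, (i <= j)%nat -> tau j = (s * -2)%Z /\ T j = (s * 4)%Z) /\
    6 * e <= 1 + D /\ 6 * D <= (3 * f - e) * (1 + D)).
  { destruct h2 as [h2|h2].
    - exists (-1)%Z. split; [now right|].
      destruct (two_classify e f f_pos fe e_small e_lt d K tau T p r i hef hd wide_first wide_second HT hi h2) as [h3 h4].
      split; [exact h3|exact h4].
    - exists 1%Z. split; [now left|].
      destruct (two_classify e f f_pos fe e_small e_lt d K _ _ _ _ i hef hd wide_first wide_second
        (tail_ok_neg _ _ _ _ _ _ _ _ HT) hi) as [h3 h4]; [unfold zneg; lia|].
      split; [|exact h4]. intros j hj. destruct (h3 j hj). unfold zneg in *. lia. }
  destruct Hs as (s & hs & Hm & h6 & hc). split; [now apply three_a_cond|].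
  destruct (wide_c4 h6 hc) as (c & R & hcd & hR & hok & hc0).
  pose proof (delta_inf_lower e f f_pos fe e_lt).
  assert (0 < (1 - e) * (1 - 3 * f)) by (pose proof beta_lt; apply Rmult_lt_0_compat; lra).
  apply (tail_match x gamma tau T p r K d i s _ c _ _ _ _ hx HR ltac:(lra) HT hi hs (c4_good a b Ha Hab Hea Heb c R hR hc0 hok)).
  intros j. apply Hm. lia.
Qed.

Lemma wide_spectrum x : Lstar a b x -> delta_inf e f < x ->
  (exists k, x = delta1 a b k) \/ x = delta05 a b \/ ((6 <= 3 * a - b)%Z /\ x = delta04 a b).
Proof.
  intros hL hx. pose proof (delta_inf_lower e f f_pos fe e_lt) as hlow. pose proof beta_lt as f18.
  pose proof D_pos. assert (hfD : D <= 3 / 10 * (18 / 100)) by (apply Rmult_le_compat; lra).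
  assert (hlow2 : (1 - 3 / 10) * (1 - 3 * (18 / 100)) <= (1 - e) * (1 - 3 * f)) by (apply Rmult_le_compat; lra).
  destruct (Lstar_tail x (delta_inf e f) hL ltac:(lra) ltac:(lra) hx) as (gamma & tau & T & p & r & K & d & E & HR & hd & HT).
  destruct (classic (exists i, (K <= i)%nat /\ (tau i = 2 \/ tau i = -2)%Z)) as [(i & hi & h2)|hno].
  - right. right. now apply (wide_two x gamma tau T p r K d i).
  - destruct (zero_tail_match x gamma tau T p r K d f18 ltac:(lra) E HR hd HT) as [h|h]; [|now left|now right; left].
    intros i hi. destruct HT as (h1 & _ & _ & Hok).
    destruct (tau_cases e f f_pos fe e_small e_lt d (tau i) (p i) (r i) hef ltac:(lra) (h1 i) (Hok i hi)) as [h|[h|h]];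
      trivial; exfalso; apply hno; exists i; tauto.
Qed.

End WideRange.

(** * The spectrum for (4, 6) *)

Section FourSixSpectrum.

Context (Ea : a = 4%Z) (Eb : b = 6%Z).

Let h4 : 4 * e = 1 + D.
Proof. transitivity (IZR a * e); [now rewrite Ea|exact ae]. Qed.
Let h6 : 6 * f = 1 + D.
Proof. transitivity (IZR b * f); [now rewrite Eb|exact bf]. Qed.

Lemma four_six_word_good : exists c p r, delta_inf e f < c /\
  good_word a b [blkA a b 2; blkC a b 2] c (fun i => if Nat.even i then 0 else -2)%Z (fun _ => 2%Z) p r.
Proof.
  destruct (four_six_numbers e f f_pos fe e_small e_lt h4 h6) as (n1 & n2 & n3 & n4).
  assert (hDD : D * D < 1 * 1) by (apply Rmult_le_0_lt_compat; lra).
  set (u := (2 * f - 2 * D + 2 * (f * D)) / (1 - D * D)).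
  assert (hu : u = f * (2 + e * (- 2 + f * (2 + e * u)))) by (unfold u; field; lra).
  destruct (four_six_ok8 e f f_pos fe e_small e_lt h4 h6 u _ hu eq_refl) as (c & h1 & h2 & h3).
  exists c. do 2 eexists. split; [trivial|].
  apply (four_six_good a b Ha Hab Hea Heb c u (f * (2 + e * u))); trivial. lra.
Qed.

Lemma four_six_spectrum x : Lstar a b x -> delta_inf e f < x ->
  (exists k, x = delta1 a b k) \/ x = delta05 a b \/ x = delta_m2 a b.
Proof.
  intros hL hx. destruct (four_six_numbers e f f_pos fe e_small e_lt h4 h6) as (n1 & n2 & n3 & n4).
  destruct (Lstar_tail x (delta_inf e f) hL ltac:(lra) ltac:(lra) hx) as (gamma & tau & T & p & r & K & d & E & HR & hd & HT).
  destruct (classic (exists i, (S K <= i)%nat /\ (tau i = 2 \/ tau i = -2)%Z)) as [(i & hi & h2)|hno].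
  - right. right. destruct four_six_word_good as (c & p' & r' & _ & HG).
    assert (Hs : exists s, (s = 1 \/ s = -1)%Z /\ forall j, tau (S i + j)%nat = (s * if Nat.even j then 0 else -2)%Z /\
      T (S i + j)%nat = (s * 2)%Z).
    { assert (Hpar : forall tau0 T0 : nat -> Z, (forall j, tau0 (S i + 2 * j)%nat = 0%Z /\ T0 (S i + 2 * j)%nat = (-2)%Z /\
          tau0 (S i + S (2 * j))%nat = 2%Z /\ T0 (S i + S (2 * j))%nat = (-2)%Z) ->
        forall j, tau0 (S i + j)%nat = (-1 * if Nat.even j then 0 else -2)%Z /\ T0 (S i + j)%nat = (-1 * 2)%Z).
      { intros tau0 T0 H j. destruct (Nat.even j) eqn:Ej.
        - apply Nat.even_spec in Ej. destruct Ej as [m ->]. destruct (H m) as (q1 & q2 & _). lia.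
        - assert (Oj : Nat.odd j = true) by (rewrite <- Nat.negb_even, Ej; trivial).
          apply Nat.odd_spec in Oj. destruct Oj as [m ->]. rewrite Nat.add_1_r. destruct (H m) as (_ & _ & q3 & q4). lia. }
      destruct h2 as [h2|h2].
      - exists (-1)%Z. split; [now right|]. apply Hpar.
        exact (ff_stays e f f_pos fe e_small e_lt h4 h6 d K tau T p r i hd HT hi h2).
      - exists 1%Z. split; [now left|]. intros j.
        destruct (Hpar (zneg tau) (zneg T)) with (j := j) as [q1 q2].
        { apply (ff_stays e f f_pos fe e_small e_lt h4 h6 d K _ _ _ _ i hd (tail_ok_neg _ _ _ _ _ _ _ _ HT) hi).
          unfold zneg. lia. }
        unfold zneg in *. lia. }
    destruct Hs as (s & hs & Hm).
    apply (tail_match x gamma tau T p r K d (S i) s _ c _ _ _ _ E HR ltac:(lra) HT ltac:(lia) hs HG). exact Hm.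
  - assert (HT' : tail_ok e f d (S K) tau T p r).
    { destruct HT as (q1 & q2 & q3 & q4). split; [trivial|split; [trivial|split; [trivial|]]]. intros i hi. apply q4. lia. }
    destruct (zero_tail_match x gamma tau T p r (S K) d ltac:(lra) ltac:(lra) E HR hd HT') as [h|h]; [|now left|now right; left].
    intros i hi. destruct HT' as (q1 & _ & _ & Hok).
    destruct (ff_cases e f f_pos fe e_small e_lt h4 h6 d (tau i) (p i) (r i) hd (q1 i) (Hok i hi)) as [[h _]|[[h _]|[h _]]];
      trivial; exfalso; apply hno; exists i; tauto.
Qed.

End FourSixSpectrum.

(** * The spectrum above the two limit points *)

Lemma Lstar_above_delta_inf1 : (2 * a <= b)%Z \/ (a = 4%Z /\ b = 6%Z) ->
  (forall k : nat, delta1 a b (S k) < delta1 a b k) /\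
  Un_cv (delta1 a b) (delta_inf1 a b) /\
  (forall x : R, (Lstar a b x /\ delta_inf1 a b < x) <->
     ((exists k : nat, x = delta1 a b k) \/ x = delta05 a b \/
      ((2 * a <= b <= 3 * a - 6)%Z /\ x = delta04 a b) \/
      ((a = 4%Z /\ b = 6%Z) /\ x = delta_m2 a b))).
Proof.
  intros hc. rewrite delta_inf_eq. pose proof beta_lt as f18.
  assert (e32 : 3 * f <= 2 * e) by (apply (ratio_le 2 3); lia).
  split; [|split].
  - now apply delta1_decreasing.
  - now apply delta1_limit.
  - intros x. split.
    + intros [hL hx]. destruct hc as [hw|[Ea Eb]].
      * destruct (wide_spectrum hw x hL hx) as [h|[h|[h1 h2]]]; [now left|now right; left|].
        right. right. left. split; [lia|trivial].
      * destruct (four_six_spectrum Ea Eb x hL hx) as [h|[h|h]]; [now left|now right; left|].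
        right. right. right. tauto.
    + intros [[k ->]|[->|[[h ->]|[[Ea Eb] ->]]]].
      * split; [now apply delta1_member|now apply delta1_gt].
      * now apply delta05_member.
      * destruct (wide_c4 ltac:(lia) ltac:(apply eta_le_sixth; lia) (proj1 three_a_cond ltac:(lia))) as (c & R & hcd & hR & hok & hc0).
        destruct (delta04_member a b Ha Hab Hea Heb c R hR hc0 hok) as [m1 m2]. split; [exact m1|lra].
      * destruct (four_six_word_good Ea Eb) as (c & p & r & hcd & HG).
        destruct (good_member a b Ha Hab Hea Heb _ _ _ _ _ _ HG) as [m1 m2]. split; [exact m1|]. unfold delta_m2. lra.
Qed.

Lemma Lstar_above_delta_inf2 : b = (2 * a - 2)%Z /\ (8 <= a)%Z ->
  (forall k : nat, (1 <= k)%nat -> delta2 a b k <= delta2 a b (S k)) /\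
  Un_cv (delta2 a b) (delta_inf2 a b) /\
  (forall x : R, (Lstar a b x /\ delta_inf2 a b < x) <-> (x = delta1 a b 0 \/ x = delta04 a b)).
Proof.
  intros [Eb h8].
  assert (e8 : 8 * e <= 1 + D) by (apply IZR_le in h8; rewrite <- ae; apply Rmult_le_compat_r; lra).
  assert (hrel : e * (1 + D) = 2 * f * (1 + D) - 2 * D).
  { assert (hb : IZR b = 2 * IZR a - 2) by (rewrite Eb, minus_IZR, mult_IZR; reflexivity).
    rewrite <- bf at 1. rewrite <- ae at 1. rewrite hb. ring. }
  change (delta_inf2 a b) with (delta_two e f).
  split; [|split].
  - now apply delta2_increasing.
  - now apply delta2_limit.
  - destruct (two_word_facts e f f_pos fe e_lt e8 hrel) as (h1 & h2 & h3 & h4 & h5 & h6 & h7 & hh8 & h9 & h10 & h11).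
    destruct (c4_tail_eq e f f_pos fe e_lt e8 hrel) as [R1 R2].
    destruct (c4_far_bounds a b Ha Hab Hea Heb e8 hrel) as [F1 _].
    assert (hfD : f * D <= f * (1 / 100)) by (apply Rmult_le_compat_l; lra).
    assert (hlow : 57 / 100 <= delta_two e f).
    { rewrite (delta_two_eq e f f_pos fe e_lt e8 hrel).
      assert (0 <= e * c4_tail e f) by (apply Rmult_le_pos; lra).
      apply Rle_trans with ((1 - 3 * (128 / 1000)) * (1 - 74 / 1000)); [lra|]. apply Rmult_le_compat; lra. }
    destruct (c4_ok8_two e f f_pos fe e_lt e8 hrel) as (c & hcd & hok).
    assert (hc0 : 0 < c) by lra.
    intros x. split.
    + intros [hL hx].
      destruct (Lstar_tail x (delta_two e f) hL ltac:(lra) ltac:(lra) hx) as (gamma & tau & T & p & r & K & d & E & HR & hd & HT).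
      destruct (t_classify e f f_pos fe e_lt e8 hrel d K tau T p r hd HT) as (n & s & hn & hs & [Hm|Hm]).
      * left. apply (tail_match x gamma tau T p r K d n s _ _ _ _ _ _ E HR ltac:(lra) HT hn hs (zero_good a b Ha Hab Hea Heb)).
        intros i. destruct (Hm i). lia.
      (* The sign is -s because C_4 has tau = -2, whereas [t_classify] is normalised by tau = 2
         s. *)
      * right. apply (tail_match x gamma tau T p r K d n (- s)%Z _ c _ _ _ _ E HR ltac:(lra) HT hn ltac:(lia)
          (c4_good a b Ha Hab Hea Heb c _ R1 hc0 hok)).
        intros i. destruct (Hm i). lia.
    + intros [->| ->].
      * destruct Lstar_max as [[m1 _] ->]. rewrite (proj2 Lstar_max) in m1. split; [exact m1|].
        apply Rlt_le_trans with (1 := delta_two_lt_bound e f f_pos fe e_lt e8 hrel). unfold two_bound.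
        assert (0 <= f * (e * D)) by (apply Rmult_le_pos; lra).
        assert (f * (D * D) <= f * (1 / 100 * D)) by (apply Rmult_le_compat_l; lra). lra.
      * destruct (delta04_member a b Ha Hab Hea Heb c _ R1 hc0 hok) as [m1 m2]. split; [exact m1|lra].
Qed.

End Classification.

Theorem theorem1 (a b : Z) (Ha : (4 <= a)%Z) (Hab : (a < b)%Z)
  (Hea : Z.Even a) (Heb : Z.Even b) :
  (* (1) *)
  (is_max (Lstar a b) (delta1 a b 0) /\
   delta1 a b 0 = (1 - eta a b) * (1 - beta a b)) /\
  (* (2) *)
  (((2 * a <= b)%Z \/ (a = 4%Z /\ b = 6%Z)) ->
     (forall k : nat, delta1 a b (S k) < delta1 a b k) /\
     Un_cv (delta1 a b) (delta_inf1 a b) /\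
     (forall x : R, (Lstar a b x /\ delta_inf1 a b < x) <->
        ((exists k : nat, x = delta1 a b k) \/ x = delta05 a b \/
         ((2 * a <= b <= 3 * a - 6)%Z /\ x = delta04 a b) \/
         ((a = 4%Z /\ b = 6%Z) /\ x = delta_m2 a b)))) /\
  (* (3) *)
  ((b = (2 * a - 2)%Z /\ (8 <= a)%Z) ->
     (forall k : nat, (1 <= k)%nat -> delta2 a b k <= delta2 a b (S k)) /\
     Un_cv (delta2 a b) (delta_inf2 a b) /\
     (forall x : R, (Lstar a b x /\ delta_inf2 a b < x) <->
        (x = delta1 a b 0 \/ x = delta04 a b))).
Proof.
  split; [|split]; [apply Lstar_max|apply Lstar_above_delta_inf1|apply Lstar_above_delta_inf2]; trivial.
Qed.
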